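(* Let $f_i$, $i=1,\dots,m$, be $\gamma$-strongly convex functions on $\mathbb{R}^n$, and consider the problem $\min_{\sqrt{\mathbf W}\mathbf x=0}F(\mathbf x)$ with $F(\mathbf x)=\frac1m\sum_{i=1}^mf_i(x_i)$, $\mathbf x=(x_1^\top,\dots,x_m^\top)^\top\in\mathbb{R}^{mn}$, with solution $\mathbf x^*=(x^{*\top},\dots,x^{*\top})^\top$. Let $R_\lambda$ be such that $\|\lambda^*\|_2\le R_\lambda$, where $\lambda^*$ is an exact solution of the dual problem $\min_{\mathbf y\in\mathbb{R}^{mn}}\frac1m\sum_{i=1}^m\psi_i\big(m[\sqrt{\mathbf W}\mathbf y]_i\big)$. Let $\|\nabla f_i(x^* )\|_2\le M$ for all $i=1,\dots,m$. Then after $$N=O\left(\sqrt{\frac{M^2}{\gamma\varepsilon}\chi(W)}\right)$$ iterations, the output $\mathbf x^N$ of the decentralized dual stochastic accelerated gradient algorithm (described in the context) satisfies with probability at least $1-3\alpha$ $$F(\mathbf x^N)-F(\mathbf x^* )\le\varepsilon,\qquad\|\sqrt{\mathbf W}\mathbf x^N\|_2\le\varepsilon/R_\lambda.$$ The number of dual oracle calls of $\nabla\psi_i(\lambda_i,\xi_i)$ (per node $i$) is $$\widetilde O\left(\max\left\{\sqrt{\frac{M^2}{\gamma\varepsilon}\chi(W)},\ \frac{M^2\sigma_\psi^2}{\varepsilon^2}\chi(W)\right\}\right),$$ where $\sigma_\psi^2$ is the sub-Gaussian variance of $\nabla\psi_i(\lambda_i,\xi_i)$.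
   Context: $W\in\mathbb{R}^{m\times m}$ is the Laplacian of a connected undirected graph on $m$ nodes, $\mathbf W=W\otimes I_n$ with $n\times n$ blocks $\mathbf W_{ij}$; $\mathbf W\mathbf x=0\Leftrightarrow\sqrt{\mathbf W}\mathbf x=0\Leftrightarrow x_1=\dots=x_m$. $\chi(W)=\lambda_{\max}(W)/\lambda_{\min}^+(W)$, where $\lambda_{\min}^+$ is the smallest non-zero eigenvalue. $\psi_i(\lambda)=\max_{x\in\mathbb{R}^n}\{\langle\lambda,x\rangle-f_i(x)\}$. $[\mathbf v]_i\in\mathbb{R}^n$ is the $i$-th block of $\mathbf v$. The stochastic dual oracle returns $\nabla\psi_i(\lambda,\xi_i)$ with $\mathbb{E}\nabla\psi_i(\lambda,\xi_i)=\nabla\psi_i(\lambda)$ and $\mathbb{E}\exp\big(\|\nabla\psi_i(\lambda,\xi_i)-\nabla\psi_i(\lambda)\|_2^2/\sigma_\psi^2\big)\le\exp(1)$. Algorithm. Put $L_\Psi=m\lambda_{\max}(W)/\gamma$, $\sigma_\Psi^2=O(\lambda_{\max}(W)m\sigma_\psi^2)$, $S_0=\alpha_0=0$, $\bar\lambda_i^0=\bar\eta_i^0=\bar\zeta_i^0=0$. For $k=0,\dots,N-1$, with $\alpha_{k+1}>0$ defined by $S_{k+1}=S_k+\alpha_{k+1}=2L_\Psi\alpha_{k+1}^2$, each node $i$ computes: $\bar\lambda_i^{k+1}=(\alpha_{k+1}\bar\zeta_i^k+S_k\bar\eta_i^k)/S_{k+1}$; the mini-batch average $g_i^{k+1}$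 of $r_{k+1}=\max\{1,50\sigma_\Psi^2\alpha_{k+1}\ln(N/\alpha)/\varepsilon\}$ independent stochastic gradients $\nabla\psi_i(m\bar\lambda_i^{k+1},\xi_i)$; $\bar\zeta_i^{k+1}=\bar\zeta_i^k-\alpha_{k+1}\sum_{j=1}^m\mathbf W_{ij}g_j^{k+1}$; $\bar\eta_i^{k+1}=(\alpha_{k+1}\bar\zeta_i^{k+1}+S_k\bar\eta_i^k)/S_{k+1}$. The output is $\mathbf x^N=(\tilde x_1^\top,\dots,\tilde x_m^\top)^\top$, $\tilde x_i=\frac1{S_N}\sum_{k=0}^N\alpha_kg_i^k$. This is the accelerated method for the dual in the variables $\bar{\boldsymbol\lambda}=\sqrt{\mathbf W}\boldsymbol\lambda$, etc. Here $\alpha$ is the confidence parameter, $\varepsilon>0$ the target accuracy, and $\widetilde O$ hides logarithmic factors.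
   Formalization: The O-bounds hold for all ε below a threshold depending on the problem data (not on α, σ_ψ or the oracle), and their constants may depend on κ with R_λ ≤ κM/√(m λ_min^+(W)), R_λ>0; for arbitrary R_λ or all ε with uniform constants the claim fails. *)

(* Defs.v *)
From HB Require Import structures.
From mathcomp Require Import all_boot all_order all_algebra.
From mathcomp Require Import all_classical all_reals all_analysis.
Set Implicit Arguments.
Unset Strict Implicit.
Unset Printing Implicit Defensive.
Import Order.TTheory GRing.Theory Num.Theory.
Import numFieldNormedType.Exports.
Local Open Scope classical_set_scope.
Local Open Scope ring_scope.

(* The topology and [differentiable] on ['cV[R]_n] come from the library's
   sup norm; all quantitative bounds below use the Euclidean norm [enorm]. *)
Section Euclidean.
Variables (R : realType) (n : nat).
Implicit Types (x y lam : 'cV[R]_n) (f : 'cV[R]_n -> R).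

Definition dot x y : R := \sum_(a < n) x a 0 * y a 0.

Definition enorm x : R := Num.sqrt (dot x x).

Definition strongly_convex (gamma : R) f :=
  forall x y (t : R), 0 <= t <= 1 ->
    f (t *: x + (1 - t) *: y) <=
      t * f x + (1 - t) * f y - gamma / 2 * t * (1 - t) * enorm (x - y) ^+ 2.

Definition grad f x : 'cV[R]_n := \col_a 'D_(delta_mx a 0) f x.

(* For strongly convex [f] the supremum is finite and attained. *)
Definition conjugate f lam : R := sup (range (fun x => dot lam x - f x)).

End Euclidean.

(* Vectors of R^(mn) are made of m blocks in R^n; coordinate a of block i has
   index [mxvec_index i a]. *)
Section Blocks.
Variables (R : realType) (m n : nat).

Definition stack (x : 'I_m -> 'cV[R]_n) : 'cV[R]_(m * n) :=
  (mxvec (\matrix_(i < m, a < n) x i a 0))^T.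

Definition blockv (v : 'cV[R]_(m * n)) (i : 'I_m) : 'cV[R]_n :=
  \col_a v (mxvec_index i a) 0.

Definition blockm (A : 'M[R]_(m * n)) (i j : 'I_m) : 'M[R]_n :=
  \matrix_(a, b) A (mxvec_index i a) (mxvec_index j b).

(* Entry ((i, a), (j, b)) of the Kronecker product is [A i j * B a b]. *)
Definition kron (A : 'M[R]_m) (B : 'M[R]_n) : 'M[R]_(m * n) :=
  \matrix_(p, q)
    mxvec (\matrix_(i < m, a < n)
      mxvec (\matrix_(j < m, b < n) (A i j * B a b)) 0 q) 0 p.

End Blocks.

Section Spectral.
Variables (R : realType) (m : nat).

Definition connected_graph (e : rel 'I_m) :=
  [/\ symmetric e, irreflexive e & forall i j, connect e i j].

Definition laplacian (e : rel 'I_m) : 'M[R]_m :=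
  \matrix_(i, j) (if i == j then #|e i|%:R else - (e i j)%:R).

Definition lambda_max (W : 'M[R]_m) : R := sup [set a | eigenvalue W a].

(* Meaningful only if [W] has a nonzero eigenvalue; the Laplacian of a
   connected graph has one exactly when it has at least two nodes. *)
Definition lambda_minp (W : 'M[R]_m) : R :=
  inf [set a | eigenvalue W a /\ a != 0].

Definition chi (W : 'M[R]_m) : R := lambda_max W / lambda_minp W.

(* [S] is the (unique) symmetric positive semidefinite square root of [A]. *)
Definition psd_sqrt (A S : 'M[R]_m) :=
  [/\ S^T = S, forall v : 'cV[R]_m, 0 <= dot v (S *m v) & S *m S = A].

End Spectral.

Section Problem.
Variables (R : realType) (m n : nat).
Variables (f : 'I_m -> 'cV[R]_n -> R) (sqrtW : 'M[R]_(m * n)).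

Definition primal (x : 'cV[R]_(m * n)) : R :=
  m%:R^-1 * \sum_(i < m) f i (blockv x i).

Definition primal_solution (x : 'cV[R]_(m * n)) :=
  sqrtW *m x = 0 /\ forall y, sqrtW *m y = 0 -> primal x <= primal y.

Definition dual (y : 'cV[R]_(m * n)) : R :=
  m%:R^-1 *
    \sum_(i < m) conjugate (f i) (m%:R *: blockv (sqrtW *m y) i).

Definition dual_solution (y : 'cV[R]_(m * n)) := forall z, dual y <= dual z.

End Problem.

Section Oracle.
Variables (R : realType) (dO dX : measure_display).
Variables (Omega : measurableType dO) (Xi : measurableType dX).
Variable P : probability Omega R.

Definition mutually_independent (I : eqType) (X : I -> Omega -> Xi) :=
  forall (s : seq I) (B : I -> set Xi),
    uniq s -> (forall i, measurable (B i)) ->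
    P (\bigcap_(i in [set i | i \in s]) (X i @^-1` B i)) =
      (\prod_(i <- s) P (X i @^-1` B i))%E.

(* [G i lam z] is the stochastic gradient of the conjugate of [f i] at [lam]
   for the random input [z]; [xi k i l] is the [l]-th input drawn by node [i]
   at iteration [k].  Joint measurability is expressed with the product
   sigma-algebra on [n.-tuple R]. *)
Record stochastic_dual_oracle (m n : nat) (f : 'I_m -> 'cV[R]_n -> R)
    (sigma : R) (G : 'I_m -> 'cV[R]_n -> Xi -> 'cV[R]_n)
    (xi : nat -> 'I_m -> nat -> Omega -> Xi) : Prop := StochasticDualOracle {
  oracle_measurable : forall i a,
    measurable_fun [set: n.-tuple R * Xi]
      (fun p => G i (\col_b tnth p.1 b) p.2 a 0);
  sample_measurable : forall k i l, measurable_fun [set: Omega] (xi k i l);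
  sample_independent :
    mutually_independent (fun t : nat * 'I_m * nat => xi t.1.1 t.1.2 t.2);
  oracle_unbiased : forall k i l lam a,
    ('E_P[(fun w => G i lam (xi k i l w) a 0)%R] =
      (grad (conjugate (f i)) lam a 0)%R%:E)%E;
  oracle_subgaussian : forall k i l lam,
    ('E_P[(fun w => expR
        (enorm (G i lam (xi k i l w) - grad (conjugate (f i)) lam) ^+ 2
          / sigma ^+ 2))%R] <= (expR 1)%R%:E)%E
}.

End Oracle.

Section Algorithm.
Variables (R : realType) (m n : nat).

Definition partial_sum (al : nat -> R) (k : nat) : R := \sum_(j < k.+1) al j.

Definition step_sizes (L : R) (al : nat -> R) :=
  al 0%N = 0 /\
  forall k, 0 < al k.+1 /\ partial_sum al k.+1 = 2 * L * al k.+1 ^+ 2.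

Definition nat_ceil (x : R) : nat := `|Num.ceil x|%N.

(* The prescribed real batch size, rounded up to an integer. *)
Definition batch_size (sigma2 eps alpha : R) (N : nat) (al : nat -> R)
    (k : nat) : nat :=
  maxn 1 (nat_ceil (50 * sigma2 * al k * ln (N%:R / alpha) / eps)).

Definition oracle_calls (r : nat -> nat) (N : nat) : nat :=
  (\sum_(k < N) r k.+1)%N.

(* One realisation of the method: [q k i l lam] is the answer of the oracle of
   node [i] to its [l]-th query at iteration [k]. *)
Variables (bW : 'M[R]_(m * n)) (al : nat -> R) (r : nat -> nat).
Variable q : nat -> 'I_m -> nat -> 'cV[R]_n -> 'cV[R]_n.

Let S := partial_sum al.

Record state := State { zeta : 'I_m -> 'cV[R]_n; eta : 'I_m -> 'cV[R]_n }.

Definition lam_next (k : nat) (s : state) (i : 'I_m) : 'cV[R]_n :=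
  (S k.+1)^-1 *: (al k.+1 *: zeta s i + S k *: eta s i).

Definition grad_next (k : nat) (s : state) (i : 'I_m) : 'cV[R]_n :=
  (r k.+1)%:R^-1 *: \sum_(l < r k.+1) q k.+1 i l (m%:R *: lam_next k s i).

Definition zeta_next (k : nat) (s : state) (i : 'I_m) : 'cV[R]_n :=
  zeta s i - al k.+1 *: \sum_(j < m) blockm bW i j *m grad_next k s j.

Definition eta_next (k : nat) (s : state) (i : 'I_m) : 'cV[R]_n :=
  (S k.+1)^-1 *: (al k.+1 *: zeta_next k s i + S k *: eta s i).

Fixpoint iterate (k : nat) : state :=
  if k is k'.+1
  then State (zeta_next k' (iterate k')) (eta_next k' (iterate k'))
  else State (fun=> 0) (fun=> 0).

(* [g^0] is never computed; it only occurs multiplied by [al 0 = 0]. *)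
Definition grad_at (k : nat) (i : 'I_m) : 'cV[R]_n :=
  if k is k'.+1 then grad_next k' (iterate k') i else 0.

Definition output (N : nat) : 'cV[R]_(m * n) :=
  stack (fun i => (S N)^-1 *: \sum_(k < N.+1) al k *: grad_at k i).

End Algorithm.

(* Main.v *)
(** The similar-triangles analysis of the accelerated method, applied to the dual
    with stochastic gradients, bounds the squared distance |z_k - lambda^*|^2 / 2
    of the dual iterate, the primal gap and the squared distance of the averaged
    exact gradients to x^* by one and the same quantity
    B_k = |lambda^*|^2 / 2 + sum_j (<e_j, lambda^* - z_j> + |e_j|^2),
    where e_j is sqrt(W) times the j-th weighted gradient noise.  Let Y_k be the
    sum of the weighted noises.  Drawing one more sample changes the potential
    B_k + lambda_max |Y_k|^2 by a linear and a quadratic form in the noise, and the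
    squared norm of the coefficient of the linear form is at most
    8 lambda_max times the potential itself.  Hence, for suitable decreasing rates
    s, the exponential exp(s * potential) is a supermartingale up to bounded
    factors, and with probability at least 1 - alpha the potential after N
    iterations is at most S_N eps / 8.  On that event all conclusions are
    deterministic; the passage from exact to noisy averages in the primal value
    uses that f_i is 2M-Lipschitz near its point of differentiability x^*. *)

(* The coefficients of the linear noise terms contain [lamstar - z_j], and no bound on the dual
   iterates is known in advance. Instead of an induction over high-probability events, the potential
   is made self-bounding: it controls the very coefficients that drive it. So one exponential moment
   handles all iterations, and a single event of probability at least [1 - alpha] carries both
   conclusions. The price is that each sample lets the exponent grow by a small multiple of itself.
   A reciprocal rate growing linearly with the variance spent pays for this, and while that variance
   stays below the cap [V] the rate loses at most a factor 2. The term [lambda_max |Y_k|^2] is there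
   because the output averages noisy gradients: its distance to the average of the exact ones is
   [|Y_N| / S_N]. Samples enter one by one, which reduces mini-batches to the moment hypothesis for
   a single oracle answer. Smallness of [eps] keeps the exact average near the solution and the
   noise shift short enough for the Lipschitz bound; the radius involved is fixed before any
   stochastic data. *)
Require Import Defs.
From HB Require Import structures.
From mathcomp Require Import all_boot all_order all_algebra.
From mathcomp Require Import all_classical all_reals all_analysis.
From mathcomp Require Import measurable_realfun ring lra.
Set Implicit Arguments.
Unset Strict Implicit.
Unset Printing Implicit Defensive.
Import Order.TTheory GRing.Theory Num.Theory.
Import numFieldNormedType.Exports.
Local Open Scope classical_set_scope.
Local Open Scope ring_scope.

(** * Euclidean space and block vectors *)

Section DotProduct.
Variables (R : realType) (n : nat).
Implicit Types (x y z : 'cV[R]_n) (a b : R).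

Lemma dotC x y : dot x y = dot y x.
Proof. by apply: eq_bigr => i _; rewrite mulrC. Qed.

Lemma dotDl x y z : dot (x + y) z = dot x z + dot y z.
Proof. by rewrite /dot -big_split; apply: eq_bigr => i _; rewrite mxE mulrDl. Qed.

Lemma dotZl a x y : dot (a *: x) y = a * dot x y.
Proof. by rewrite /dot big_distrr; apply: eq_bigr => i _; rewrite mxE /= mulrA. Qed.

Lemma dotDr x y z : dot x (y + z) = dot x y + dot x z.
Proof. by rewrite dotC dotDl !(dotC x). Qed.

Lemma dotZr a x y : dot x (a *: y) = a * dot x y.
Proof. by rewrite dotC dotZl dotC. Qed.

Lemma dotNl x y : dot (- x) y = - dot x y.
Proof. by rewrite -scaleN1r dotZl mulN1r. Qed.

Lemma dotNr x y : dot x (- y) = - dot x y.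
Proof. by rewrite dotC dotNl dotC. Qed.

Lemma dot0l x : dot 0 x = 0.
Proof. by rewrite -(scale0r 0) dotZl mul0r. Qed.

Lemma dot0r x : dot x 0 = 0.
Proof. by rewrite dotC dot0l. Qed.

Definition dotE := (dotDl, dotDr, dotNl, dotNr, dotZl, dotZr, dot0l, dot0r).

Lemma dot_suml (I : Type) (s : seq I) (P : pred I) (F : I -> 'cV[R]_n) y :
  dot (\sum_(i <- s | P i) F i) y = \sum_(i <- s | P i) dot (F i) y.
Proof.
by apply: (big_morph (fun u => dot u y)); [move=> u v; exact: dotDl | exact: dot0l].
Qed.

Lemma dot_ge0 x : 0 <= dot x x.
Proof. by apply: sumr_ge0 => i _; rewrite -expr2 sqr_ge0. Qed.

Lemma dot_eq0 x : dot x x = 0 -> x = 0.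
Proof.
move=> /psumr_eq0P x0; apply/colP => i; rewrite mxE.
have /eqP := x0 (fun j _ => sqr_ge0 (x j 0)) i isT.
by rewrite mulf_eq0 orbb => /eqP.
Qed.

Lemma enorm_sq x : enorm x ^+ 2 = dot x x.
Proof. by rewrite sqr_sqrtr // dot_ge0. Qed.

Lemma enorm_ge0 x : 0 <= enorm x.
Proof. exact: sqrtr_ge0. Qed.

Lemma enorm0 : enorm (0 : 'cV[R]_n) = 0.
Proof. by rewrite /enorm dot0l sqrtr0. Qed.

Lemma enormN x : enorm (- x) = enorm x.
Proof. by rewrite /enorm !dotE opprK. Qed.

Lemma enormZ a x : enorm (a *: x) = `|a| * enorm x.
Proof.
by rewrite /enorm !dotE mulrA -expr2 sqrtrM ?sqr_ge0 // sqrtr_sqr.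
Qed.

Lemma enorm_le (b : R) x : 0 <= b -> (enorm x <= b) = (dot x x <= b ^+ 2).
Proof. by move=> b0; rewrite -enorm_sq ler_pXn2r // nnegrE enorm_ge0. Qed.

Lemma dot_sq_le x y : dot x y ^+ 2 <= dot x x * dot y y.
Proof.
have [y0|y0] := eqVneq (dot y y) 0.
  by rewrite (dot_eq0 y0) !dot0r expr0n /= mulr0.
have yp : 0 < dot y y by rewrite lt_neqAle eq_sym y0 dot_ge0.
have := dot_ge0 (dot y y *: x - dot x y *: y).
rewrite !dotE (dotC y x) => H.
rewrite -(ler_pM2l yp); move: H; rewrite -subr_ge0 => H.
by rewrite -subr_ge0; apply: le_trans H _; rewrite le_eqVlt; apply/orP; left; apply/eqP; ring.
Qed.

Lemma cauchy_schwarz x y : `|dot x y| <= enorm x * enorm y.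
Proof.
rewrite -(@ler_pXn2r _ 2) ?nnegrE ?mulr_ge0 ?enorm_ge0 //.
by rewrite real_normK ?num_real // exprMn !enorm_sq dot_sq_le.
Qed.

Lemma dot_le x y : dot x y <= enorm x * enorm y.
Proof. exact: le_trans (ler_norm _) (cauchy_schwarz x y). Qed.

Lemma enormD x y : enorm (x + y) <= enorm x + enorm y.
Proof.
rewrite enorm_le ?addr_ge0 ?enorm_ge0 // !dotE (dotC y x) sqrrD !enorm_sq.
by have := dot_le x y; lra.
Qed.

Lemma coord_le_enorm x i : `|x i 0| <= enorm x.
Proof.
rewrite -(@ler_pXn2r _ 2) ?nnegrE ?enorm_ge0 // enorm_sq real_normK ?num_real //.
rewrite /dot (bigD1 i) //= -expr2 lerDl; apply: sumr_ge0 => j _.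
by rewrite -expr2 sqr_ge0.
Qed.

Lemma enorm_le_coord x (b : R) : 0 <= b -> (forall i, `|x i 0| <= b) ->
  enorm x <= n%:R * b.
Proof.
move=> b0 xb; rewrite enorm_le ?mulr_ge0 //.
apply: (@le_trans _ _ (\sum_(i < n) b ^+ 2)).
  apply: ler_sum => i _; rewrite -expr2 -real_normK ?num_real //.
  by rewrite ler_pXn2r ?nnegrE.
rewrite sumr_const card_ord exprMn -[leLHS]mulr_natl ler_wpM2r ?sqr_ge0 //.
by rewrite -natrX ler_nat; case: n => // k; rewrite expnS leq_pmulr.
Qed.

Lemma dot_delta x i : dot x (delta_mx i 0) = x i 0.
Proof.
rewrite /dot (bigD1 i) //= mxE !eqxx mulr1 big1 ?addr0 // => j ji.
by rewrite mxE (negbTE ji) mulr0.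
Qed.

Lemma enorm_delta i : enorm (delta_mx i 0 : 'cV[R]_n) = 1.
Proof. by rewrite /enorm dot_delta mxE !eqxx sqrtr1. Qed.

Lemma dot_mulmxr (k : nat) (A : 'M[R]_(n, k)) x (w : 'cV[R]_k) :
  dot x (A *m w) = dot (A^T *m x) w.
Proof.
rewrite /dot; under eq_bigr do rewrite mxE big_distrr.
rewrite exchange_big; apply: eq_bigr => j _; rewrite mxE big_distrl /=.
by apply: eq_bigr => i _; rewrite mxE; ring.
Qed.

End DotProduct.

Section BlockVectors.
Variables (R : realType) (m n : nat).
Implicit Types (u v : 'cV[R]_(m * n)).

Lemma blockv_stack (x : 'I_m -> 'cV[R]_n) i : blockv (stack x) i = x i.
Proof. by apply/colP => a; rewrite mxE mxE mxvecE mxE. Qed.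

Lemma big_mxvec_index (F : 'I_(m * n) -> R) :
  \sum_p F p = \sum_i \sum_a F (mxvec_index i a).
Proof.
rewrite (reindex _ (curry_mxvec_bij m n)) /= pair_bigA /=.
by apply: eq_bigr => -[i a].
Qed.

Lemma eq_blockv u v : (forall i, blockv u i = blockv v i) -> u = v.
Proof.
move=> uv; apply/colP => p; case/mxvec_indexP: p => i a.
by have /colP/(_ a) := uv i; rewrite !mxE.
Qed.

Lemma dot_blockv u v : dot u v = \sum_i dot (blockv u i) (blockv v i).
Proof.
rewrite /dot big_mxvec_index; apply: eq_bigr => i _.
by apply: eq_bigr => a _; rewrite !mxE.
Qed.

Lemma blockvD u v i : blockv (u + v) i = blockv u i + blockv v i.
Proof. by apply/colP => a; rewrite !mxE. Qed.

Lemma blockvN v i : blockv (- v) i = - blockv v i.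
Proof. by apply/colP => a; rewrite !mxE. Qed.

Lemma blockvZ (c : R) v i : blockv (c *: v) i = c *: blockv v i.
Proof. by apply/colP => a; rewrite !mxE. Qed.

Lemma blockv0 i : blockv (0 : 'cV[R]_(m * n)) i = 0.
Proof. by apply/colP => a; rewrite !mxE. Qed.

Lemma blockv_mulmx (A : 'M[R]_(m * n)) v i :
  blockv (A *m v) i = \sum_j blockm A i j *m blockv v j.
Proof.
apply/colP => a; rewrite !mxE big_mxvec_index summxE; apply: eq_bigr => j _.
by rewrite mxE; apply: eq_bigr => b _; rewrite !mxE.
Qed.

Lemma kronE (A : 'M[R]_m) (B : 'M[R]_n) i a j b :
  kron A B (mxvec_index i a) (mxvec_index j b) = A i j * B a b.
Proof. by rewrite mxE mxvecE mxE mxvecE mxE. Qed.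

Lemma dot_kron1 (A : 'M[R]_m) v :
  dot v (kron A 1%:M *m v) =
  \sum_a (let w := \col_i v (mxvec_index i a) 0 in dot w (A *m w)).
Proof.
rewrite /dot big_mxvec_index exchange_big; apply: eq_bigr => a _ /=.
apply: eq_bigr => i _; rewrite [in RHS]mxE; congr (_ * _).
rewrite mxE [RHS]mxE big_mxvec_index; apply: eq_bigr => j _.
rewrite (bigD1 a) //= kronE [1%:M _ _]mxE eqxx mulr1 [in RHS]mxE big1 ?addr0 //.
by move=> b ba; rewrite kronE mxE eq_sym (negbTE ba) mulr0 mul0r.
Qed.

End BlockVectors.

(** * Strongly convex functions and their conjugates *)

(* [strongly_convex 0] is plain convexity. *)
Section ConvexAnalysis.
Variables (R : realType) (n : nat).
Implicit Types (x y u d lam : 'cV[R]_n) (f : 'cV[R]_n -> R).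

Lemma strongly_convexW (gamma : R) f :
  0 <= gamma -> strongly_convex gamma f -> strongly_convex 0 f.
Proof.
move=> g0 fc x y t /andP[t0 t1]; apply: le_trans (fc x y t _) _; first by rewrite t0.
rewrite !mul0r subr0 lerBlDr lerDl.
by rewrite !mulr_ge0 ?subr_ge0 ?invr_ge0 ?enorm_ge0.
Qed.

Lemma convex_ray f x d (t : R) : strongly_convex 0 f -> 0 <= t <= 1 ->
  f (x + t *: d) - f x <= t * (f (x + d) - f x).
Proof.
move=> fc t01; have := fc (x + d) x t t01.
have -> : t *: (x + d) + (1 - t) *: x = x + t *: d.
  by apply/colP => a; rewrite !mxE; ring.
by lra.
Qed.

Lemma convex_midpoint f x d1 d2 : strongly_convex 0 f ->
  f (x + (d1 + d2)) - f x <=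
    2^-1 * (f (x + 2 *: d1) - f x) + 2^-1 * (f (x + 2 *: d2) - f x).
Proof.
move=> fc; have := fc (x + 2 *: d1) (x + 2 *: d2) 2^-1.
have -> : 2^-1 *: (x + 2 *: d1) + (1 - 2^-1) *: (x + 2 *: d2) = x + (d1 + d2).
  by apply/colP => a; rewrite !mxE; field.
by move=> /(_ ltac:(lra)); lra.
Qed.

(** Convexity is used one coordinate at a time: each induction step splits off a basis direction by
    [convex_midpoint], which doubles the increments and therefore halves [delta]. Along a single
    direction the slope is bounded by the increment at distance 1. *)
Lemma convex_sub_le f x : strongly_convex 0 f ->
  exists C delta : R, [/\ 0 <= C, 0 < delta &
    forall d, enorm d <= delta -> f (x + d) - f x <= C * enorm d].
Proof.
move=> fc.
suff H (s : seq 'I_n) : exists C delta : R, [/\ 0 <= C, 0 < delta &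
    forall d, (forall a, `|d a 0| <= delta) ->
    f (x + \sum_(a <- s) d a 0 *: delta_mx a 0) - f x <=
      C * \sum_(a <- s) `|d a 0|].
  have [C [delta [C0 d0 Hd]]] := H (index_enum 'I_n).
  exists (C * n%:R), delta; split => //; first by rewrite mulr_ge0.
  move=> d dd.
  have dE : d = \sum_a d a 0 *: delta_mx a 0.
    apply/colP => b; rewrite summxE (bigD1 b) //= !mxE !eqxx mulr1.
    by rewrite big1 ?addr0 // => a ab; rewrite !mxE eq_sym (negbTE ab) mulr0.
  rewrite {1}dE; apply: le_trans (Hd d _) _.
    by move=> a; apply: le_trans (coord_le_enorm d a) dd.
  rewrite -mulrA ler_wpM2l //.
  apply: (@le_trans _ _ (\sum_(a < n) enorm d)).
    by apply: ler_sum => a _; exact: coord_le_enorm.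
  by rewrite sumr_const card_ord mulr_natl.
elim: s => [|b s [C [delta [C0 d0 IH]]]].
  by exists 0, 1; split => // d _; rewrite big_nil addr0 subrr mul0r.
pose Cb := Num.max 0 (Num.max (f (x + delta_mx b 0) - f x)
                              (f (x - delta_mx b 0) - f x)).
exists (Num.max C Cb), (Num.min delta 1 / 2); split.
- by rewrite le_max C0.
- by rewrite divr_gt0 // lt_min d0 ltr01.
move=> d dd; rewrite !big_cons.
have dd1 a : `|2 * d a 0| <= delta /\ `|2 * d a 0| <= 1.
  have := dd a; rewrite normrM ger0_norm //.
  have : Num.min delta 1 <= delta by rewrite ge_min lexx.
  have : Num.min delta 1 <= 1 by rewrite ge_min lexx orbT.
  by lra.
apply: le_trans (convex_midpoint x _ _ fc) _.
have H1 : f (x + 2 *: (d b 0 *: delta_mx b 0)) - f x <= 2 * `|d b 0| * Cb.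
  have [_] := dd1 b; rewrite normrM ger0_norm // => d1.
  have [dp|dn] := lerP 0 (d b 0).
    rewrite scalerA; apply: le_trans (convex_ray x _ fc _) _.
      by rewrite mulr_ge0 //=; move: d1; rewrite ger0_norm.
    rewrite ger0_norm // ler_wpM2l ?mulr_ge0 // /Cb le_max; apply/orP; right.
    by rewrite le_max lexx.
  have -> : 2 *: (d b 0 *: delta_mx b 0) =
      (2 * `|d b 0|) *: (- delta_mx b 0) :> 'cV[R]_n.
    by rewrite ltr0_norm // scalerA scalerN mulrN scaleNr opprK.
  apply: le_trans (convex_ray x _ fc _) _.
    by rewrite d1 mulr_ge0.
  rewrite ler_wpM2l ?mulr_ge0 // /Cb le_max; apply/orP; right.
  by rewrite le_max lexx orbT.
have H2 : f (x + 2 *: (\sum_(j <- s) d j 0 *: delta_mx j 0)) - f x <=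
    C * (2 * \sum_(j <- s) `|d j 0|).
  have := IH (2 *: d) => /(_ _)/le_trans; rewrite scaler_sumr.
  have -> : \sum_(a <- s) (2 *: d) a 0 *: delta_mx a 0 =
     \sum_(i <- s) 2 *: (d i 0 *: delta_mx i 0) :> 'cV[R]_n.
    by apply: eq_bigr => a _; rewrite mxE scalerA.
  apply; first by move=> a; rewrite mxE; case: (dd1 a).
  rewrite ler_wpM2l // mulr_sumr; apply: ler_sum => a _.
  by rewrite mxE normrM ger0_norm.
have H3 : `|d b 0| * Cb <= Num.max C Cb * `|d b 0|.
  by rewrite mulrC ler_wpM2r // le_max lexx orbT.
have H4 : C * (\sum_(j <- s) `|d j 0|) <= Num.max C Cb * \sum_(j <- s) `|d j 0|.
  by rewrite ler_wpM2r ?sumr_ge0 // le_max lexx.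
by rewrite mulrDr; lra.
Qed.

Definition locally_lipschitz f := forall x, exists C delta : R,
  [/\ 0 <= C, 0 < delta &
      forall d, enorm d <= delta -> `|f (x + d) - f x| <= C * enorm d].

Lemma convex_locally_lipschitz f : strongly_convex 0 f -> locally_lipschitz f.
Proof.
move=> fc x; have [C [delta [C0 d0 H]]] := convex_sub_le x fc.
exists C, delta; split => // d dd; rewrite ler_norml H // andbT.
(* The lower bound mirrors the upper one, since [x] is the midpoint of [x + d] and [x - d]. *)
have := fc (x + d) (x - d) 2^-1 ltac:(lra).
have -> : 2^-1 *: (x + d) + (1 - 2^-1) *: (x - d) = x.
  by apply/colP => a; rewrite !mxE; field.
by have := H (- d); rewrite enormN => /(_ dd); lra.
Qed.

Lemma strongly_convex_subl (gamma : R) f lam :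
  strongly_convex gamma f -> strongly_convex gamma (fun x => f x - dot lam x).
Proof. by move=> fc x y t t01; have := fc x y t t01; rewrite !dotE; lra. Qed.

(** The Lipschitz bound at 0 settles the ball of radius [delta]. Strong convexity on the segment
    from 0 to [x], evaluated where it crosses the sphere, bounds [f x] below by a quadratic in
    [enorm x] with linear coefficient [- K]; completing the square gives the constant. *)
Lemma strongly_convex_bounded_below (gamma : R) f :
  0 < gamma -> strongly_convex gamma f -> exists b, forall x, b <= f x.
Proof.
move=> g0 fc; have fc0 := strongly_convexW (ltW g0) fc.
have [C [delta [C0 d0 H]]] := convex_locally_lipschitz fc0 0.
pose K := C + gamma / 2 * delta.
exists (f 0 - C * delta - K ^+ 2 / (2 * gamma)) => x.
have K2 : 0 <= K ^+ 2 / (2 * gamma) by rewrite divr_ge0 ?sqr_ge0 // mulr_ge0 // ltW.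
have [xd|xd] := lerP (enorm x) delta.
  have := H x xd; rewrite add0r ler_norml => /andP[+ _].
  have : C * enorm x <= C * delta by rewrite ler_wpM2l.
  by lra.
have x0 : 0 < enorm x by apply: lt_trans xd.
pose t := delta / enorm x.
have tp : 0 < t by rewrite divr_gt0.
have tx : t * enorm x = delta by rewrite /t mulfVK // gt_eqF.
have t1 : t <= 1 by rewrite ler_pdivrMr // mul1r ltW.
have := H (t *: x); rewrite add0r enormZ ger0_norm ?(ltW tp) // tx lexx.
rewrite ler_norml => /(_ isT)/andP[Hl _].
have := fc x 0 t; rewrite (ltW tp) t1 scaler0 addr0 subr0 => /(_ isT) H2.
have H3 : t * (f 0 - C * enorm x + gamma / 2 * (1 - t) * enorm x ^+ 2) <= t * f x.
  apply: le_trans (_ : f (t *: x) - (1 - t) * f 0 +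
      gamma / 2 * t * (1 - t) * enorm x ^+ 2 <= _); last by lra.
  have -> : t * (f 0 - C * enorm x + gamma / 2 * (1 - t) * enorm x ^+ 2) =
     t * f 0 - C * (t * enorm x) + gamma / 2 * t * (1 - t) * enorm x ^+ 2 by ring.
  by rewrite tx; lra.
rewrite ler_pM2l // in H3; apply: le_trans H3.
have -> : f 0 - C * enorm x + gamma / 2 * (1 - t) * enorm x ^+ 2 =
  f 0 - C * enorm x + gamma / 2 * (enorm x ^+ 2 - (t * enorm x) * enorm x) by ring.
rewrite tx.
have -> : f 0 - C * enorm x + gamma / 2 * (enorm x ^+ 2 - delta * enorm x) =
  f 0 - K ^+ 2 / (2 * gamma) + gamma / 2 * (enorm x - K / gamma) ^+ 2.
  by rewrite /K; field; rewrite gt_eqF.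
have := mulr_ge0 C0 (ltW d0).
have := sqr_ge0 (enorm x - K / gamma).
by nra.
Qed.

Lemma le_of_small_perturbation (a b C delta : R) : 0 <= C -> 0 < delta ->
  (forall t, 0 < t -> t <= delta -> a <= b + C * t) -> a <= b.
Proof.
move=> C0 d0 H; rewrite leNgt; apply/negP => ba.
pose t := Num.min delta ((a - b) / (2 * (C + 1))).
have ab : 0 < a - b by rewrite subr_gt0.
have C1 : 0 < 2 * (C + 1) by rewrite mulr_gt0 // ltr_wpDl.
have tp : 0 < t by rewrite lt_min d0 divr_gt0.
have tl : t <= (a - b) / (2 * (C + 1)) by rewrite ge_min lexx orbT.
have := H t tp; rewrite ge_min lexx => /(_ isT).
move: tl; rewrite ler_pdivlMr //.
by nra.
Qed.

(* Near-minimisers [X eta], with value below [inf f + eta], are pairwise at distance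
   at most [e eta + e eta'] by strong convexity, so each coordinate of the minimiser
   can be defined as the supremum of [X eta a 0 - e eta]. *)
Lemma strongly_convex_has_min (gamma : R) f :
  0 < gamma -> strongly_convex gamma f -> exists x, forall y, f x <= f y.
Proof.
move=> g0 fc; have fc0 := strongly_convexW (ltW g0) fc.
have [b fb] := strongly_convex_bounded_below g0 fc.
pose I := inf (range f).
have hinf : has_inf (range f).
  by split; [exists (f 0); exists 0|exists b => _ [x _ <-]].
have If x : I <= f x by apply: ge_inf; [case: hinf|exists x].
have /choice[X HX] : forall eta : R, exists x, 0 < eta -> f x < I + eta.
  move=> eta; have [e0|_] := ltrP 0 eta; last by exists 0.
  have [_ [x _ <-] fx] := inf_adherent e0 hinf.
  by exists x.
pose e (eta : R) := Num.sqrt (4 / gamma * eta).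
have e2 eta : 0 < eta -> e eta ^+ 2 = 4 / gamma * eta.
  by move=> e0; rewrite sqr_sqrtr // mulr_ge0 ?divr_ge0 ?(ltW g0) ?(ltW e0).
have e_ge0 eta : 0 <= e eta by exact: sqrtr_ge0.
have XX eta eta' : 0 < eta -> 0 < eta' -> enorm (X eta - X eta') <= e eta + e eta'.
  move=> e0 e0'; rewrite -(@ler_pXn2r _ 2) ?nnegrE ?addr_ge0 ?enorm_ge0 //.
  rewrite sqrrD e2 // e2 //.
  have := fc (X eta) (X eta') 2^-1 ltac:(lra).
  have := If (2^-1 *: X eta + (1 - 2^-1) *: X eta').
  have := HX _ e0; have := HX _ e0'; set n2 := enorm _ ^+ 2 => h1 h2 h3 h4.
  have h5 : gamma * n2 <= 4 * eta + 4 * eta' by lra.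
  apply: (@le_trans _ _ (4 / gamma * eta + 4 / gamma * eta')).
    by rewrite -mulrDr mulrAC ler_pdivlMr // mulrC; lra.
  have : 0 <= e eta * e eta' by rewrite mulr_ge0.
  by lra.
pose x := \col_a sup [set X eta a 0 - e eta | eta in [set eta : R | 0 < eta]].
have Xx eta a : 0 < eta -> `|X eta a 0 - x a 0| <= e eta.
  move=> e0; rewrite mxE; set S := (X in sup X).
  have ubS : ubound S (X eta a 0 + e eta).
    move=> _ [eta' e0' <-]; have := coord_le_enorm (X eta - X eta') a.
    by have := XX _ _ e0 e0'; rewrite !mxE => h1 h2; have := le_trans h2 h1; rewrite ler_norml; lra.
  have h1 : sup S <= X eta a 0 + e eta.
    by apply: ge_sup => //; exists (X eta a 0 - e eta); exists eta.
  have h2 : X eta a 0 - e eta <= sup S.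
    by apply: ub_le_sup; [exists (X eta a 0 + e eta)|exists eta].
  by rewrite ler_norml; lra.
have Xxn eta : 0 < eta -> enorm (X eta - x) <= n%:R * e eta.
  by move=> e0; apply: enorm_le_coord => // a; rewrite !mxE; have := Xx _ a e0; rewrite mxE.
have [C [delta [C0 d0 Hx]]] := convex_locally_lipschitz fc0 x.
exists x => y; apply: le_trans (If y).
pose c := Num.sqrt (4 / gamma).
have c0 : 0 < c by rewrite sqrtr_gt0 divr_gt0.
(* With [eta = t ^+ 2] the distance bound [e eta] becomes linear in [t], so the Lipschitz estimate
   at [x] has the form required by [le_of_small_perturbation]. *)
have ec t : 0 < t -> e (t ^+ 2) = c * t.
  by move=> t0; rewrite /e sqrtrM ?divr_ge0 ?(ltW g0) // sqrtr_sqr gtr0_norm.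
pose nc := n%:R * c + 1.
have nc0 : 0 < nc by rewrite ltr_wpDl // mulr_ge0 // ltW.
apply: (@le_of_small_perturbation _ _ (1 + C * (n%:R * c)) (Num.min 1 (delta / nc))).
- by rewrite addr_ge0 // !mulr_ge0 // ltW.
- by rewrite lt_min ltr01 divr_gt0.
move=> t t0; rewrite le_min => /andP[t1]; rewrite ler_pdivlMr // => td.
have t20 : 0 < t ^+ 2 by rewrite exprn_gt0.
have := Xxn _ t20; rewrite ec // => h1.
have h2 : enorm (X (t ^+ 2) - x) <= delta.
  by apply: le_trans h1 _; move: td; rewrite /nc; nra.
have := Hx _ h2; rewrite subrKC ler_norml => /andP[_ h3].
have := HX _ t20 => h4.
have h5 : C * enorm (X (t ^+ 2) - x) <= C * (n%:R * (c * t)) by rewrite ler_wpM2l.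
have := Hx _ h2; rewrite subrKC ler_norml => /andP[h6 _].
have h7 : t ^+ 2 <= t by rewrite expr2 ler_piMl // ltW.
by lra.
Qed.

(** Strong convexity between [x] and [y] is compared with minimality at the intermediate point and
    divided by [t]; the full modulus [gamma / 2] is recovered as [t] tends to 0. No
    differentiability of [f] enters. *)
Lemma strongly_convex_subgradient (gamma : R) f lam x : 0 <= gamma ->
  strongly_convex gamma f ->
  (forall y, f x - dot lam x <= f y - dot lam y) ->
  forall y, f x + dot lam (y - x) + gamma / 2 * enorm (y - x) ^+ 2 <= f y.
Proof.
move=> g0 fc xmin y.
set q := gamma / 2 * _.
have q0 : 0 <= q by rewrite mulr_ge0 ?sqr_ge0 // divr_ge0.
apply: (@le_of_small_perturbation _ _ q 1) => // t t0 t1.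
have := fc y x t; rewrite (ltW t0) t1 => /(_ isT).
have := xmin (t *: y + (1 - t) *: x); rewrite !dotE => h1 h2.
have h3 : t * (f x - dot lam x + (1 - t) * q) <= t * (f y - dot lam y).
  by rewrite /q; lra.
by move: h3; rewrite ler_pM2l //; lra.
Qed.

End ConvexAnalysis.

Section Conjugate.
Variables (R : realType) (n : nat).
Implicit Types (x y u d lam : 'cV[R]_n) (f : 'cV[R]_n -> R).

Lemma conjugate_attained f lam x :
  (forall y, f x - dot lam x <= f y - dot lam y) ->
  conjugate f lam = dot lam x - f x.
Proof.
move=> xmin; apply/eqP; rewrite eq_le; apply/andP; split.
  by apply: ge_sup => [|_ [y _ <-]]; [exists (dot lam 0 - f 0); exists 0|have := xmin y; lra].
apply: ub_le_sup; last by exists x.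
by exists (dot lam x - f x) => _ [y _ <-]; have := xmin y; lra.
Qed.

Lemma conjugate_le f lam (b : R) :
  (forall x, dot lam x - f x <= b) -> conjugate f lam <= b.
Proof.
by move=> H; apply: ge_sup => [|_ [y _ <-]//]; exists (dot lam 0 - f 0); exists 0.
Qed.

(** For the lower bound [x] competes in the supremum at [mu]. The upper bound is Young's inequality
    against the quadratic growth of [f] away from [x]. Together they are a first-order expansion
    with explicit remainder, from which the partial derivatives are read off. *)
Lemma conjugate_increment (gamma : R) f lam x mu :
  0 < gamma -> strongly_convex gamma f ->
  (forall y, f x - dot lam x <= f y - dot lam y) ->
  0 <= conjugate f mu - conjugate f lam - dot x (mu - lam)
    <= enorm (mu - lam) ^+ 2 / (2 * gamma).
Proof.
move=> g0 fc xmin; rewrite (conjugate_attained xmin).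
have [y0 ymin] : exists z, forall y, f z - dot mu z <= f y - dot mu y.
  exact: (strongly_convex_has_min g0 (strongly_convex_subl mu fc)).
apply/andP; split.
  by rewrite (conjugate_attained ymin); have := ymin x; rewrite !dotE !(dotC x); lra.
rewrite lerBlDr lerBlDr; apply: conjugate_le => y.
have := strongly_convex_subgradient (ltW g0) fc xmin y.
have := dot_ge0 (gamma *: (y - x) - (mu - lam)).
rewrite !enorm_sq !dotE => H1 H2.
have : 0 <= (2 * gamma)^-1 by rewrite invr_ge0 mulr_ge0 // ltW.
move=> /(mulr_ge0 H1) {H1}; rewrite -subr_ge0 => H1.
rewrite -subr_ge0; apply: le_trans H1 _.
have -> : dot y mu = dot mu y by rewrite dotC.
have -> : dot y lam = dot lam y by rewrite dotC.
have -> : dot x mu = dot mu x by rewrite dotC.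
have -> : dot x lam = dot lam x by rewrite dotC.
have -> : dot x y = dot y x by rewrite dotC.
have -> : dot lam mu = dot mu lam by rewrite dotC.
move: H2; rewrite (dotC x y) -subr_ge0 => H2; rewrite -subr_ge0.
apply: le_trans H2 _; rewrite le_eqVlt; apply/orP; left; apply/eqP.
by field; rewrite gt_eqF.
Qed.

Lemma grad_conjugate (gamma : R) f lam x :
  0 < gamma -> strongly_convex gamma f ->
  (forall y, f x - dot lam x <= f y - dot lam y) ->
  grad (conjugate f) lam = x.
Proof.
move=> g0 fc xmin; apply/colP => a; rewrite mxE.
rewrite /derive; apply: cvg_lim => //.
apply/cvgrPdist_le => e e0.
have de0 : 0 < e * (2 * gamma) by rewrite mulr_gt0 // mulr_gt0.
exists (e * (2 * gamma)) => // h /=; rewrite sub0r normrN => hd h0.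
have /andP[H1 H2] := conjugate_increment (lam + h *: delta_mx a 0) g0 fc xmin.
have dE : lam + h *: delta_mx a 0 - lam = h *: delta_mx a 0 by rewrite addrC addKr.
move: H1 H2; rewrite dE dotZr dot_delta enormZ enorm_delta mulr1.
rewrite (addrC (h *: _)); set D := conjugate f (lam + _) - _ => H1 H2.
have -> : x a 0 - h^-1 *: D = - (h^-1 * (D - h * x a 0)).
  by rewrite /GRing.scale /=; field.
rewrite normrN normrM (ger0_norm H1) normfV mulrC ler_pdivrMr ?normr_gt0 //.
apply: le_trans H2 _; rewrite ler_pdivrMr ?mulr_gt0 // expr2.
by have := normr_ge0 h; nra.
Qed.

(** The interface for all later uses of the conjugate: its gradient is the maximiser, with Fenchel
    equality and quadratic growth there. *)
Lemma conjugateP (gamma : R) f lam : 0 < gamma -> strongly_convex gamma f ->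
  let x := grad (conjugate f) lam in
  conjugate f lam = dot lam x - f x /\
  forall y, f x + dot lam (y - x) + gamma / 2 * enorm (y - x) ^+ 2 <= f y.
Proof.
move=> g0 fc.
have [x xmin] : exists z, forall y, f z - dot lam z <= f y - dot lam y.
  exact: (strongly_convex_has_min g0 (strongly_convex_subl lam fc)).
rewrite (grad_conjugate g0 fc xmin); split; first exact: conjugate_attained.
exact: strongly_convex_subgradient (ltW g0) fc xmin.
Qed.

End Conjugate.

(** * Convex functions near a point of differentiability *)

Section DifferentiablePoint.
Variables (R : realType) (n : nat).
Implicit Types (x y u d h : 'cV[R]_n) (f : 'cV[R]_n -> R).

Lemma mx_norm_le_enorm x : `|x| <= enorm x.
Proof.
rewrite /Num.norm /= mx_normrE; apply: bigmax_le; first exact: enorm_ge0.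
by move=> [i j] _ /=; rewrite (ord1 j) coord_le_enorm.
Qed.

Lemma differentiable_expansion f x (e : R) : differentiable f x -> 0 < e ->
  exists2 rho : R, 0 < rho & forall h, enorm h <= rho ->
    `|f (x + h) - f x - dot (grad f x) h| <= e * enorm h.
Proof.
move=> df e0.
have /eqaddoP/(_ e e0)/nbhs_ballP[r /= r0 Hr] := diff_locally df.
exists (r / 2); first by rewrite divr_gt0.
move=> h hr.
have gE : 'd f x h = dot (grad f x) h.
  rewrite {1}[h]matrix_sum_delta.
  have -> : \sum_(i < n) \sum_(j < 1) h i j *: delta_mx i j =
      \sum_(i < n) h i 0 *: delta_mx i 0 :> 'cV[R]_n.
    by apply: eq_bigr => i _; rewrite big_ord1.
  rewrite linear_sum /= /dot; apply: eq_bigr => i _.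
  by rewrite linearZ /= mxE deriveE // mulrC.
have Hb : ball (0 : 'cV[R]_n) r h.
  rewrite -ball_normE /ball_ /= sub0r normrN.
  by apply: le_lt_trans (mx_norm_le_enorm h) _; lra.
have H := Hr h Hb.
have -> : f (x + h) - f x - dot (grad f x) h =
  (f \o shift x - (cst (f x) + 'd f x)) h.
  by rewrite -gE !fctE /= (addrC h) opprD addrA.
by apply: le_trans H _; rewrite ler_wpM2l ?mx_norm_le_enorm // ltW.
Qed.

Lemma convex_gradient_le f x h : strongly_convex 0 f -> differentiable f x ->
  f x + dot (grad f x) h <= f (x + h).
Proof.
move=> fc df.
apply: (@le_of_small_perturbation _ _ _ (enorm h) 1) => //; first exact: enorm_ge0.
move=> e e0 _; have [rho rho0 H] := differentiable_expansion df e0.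
pose t := Num.min 1 (rho / (enorm h + 1)).
have h1 : 0 < enorm h + 1 by rewrite ltr_wpDl // enorm_ge0.
have tp : 0 < t by rewrite lt_min ltr01 divr_gt0.
have th : enorm (t *: h) <= rho.
  rewrite enormZ gtr0_norm //; apply: (@le_trans _ _ (t * (enorm h + 1))).
    by rewrite ler_pM2l // lerDl.
  by rewrite -ler_pdivlMr // ge_min lexx orbT.
have t01 : 0 <= t <= 1 by rewrite (ltW tp) ge_min lexx.
have := convex_ray x h fc t01.
have := H _ th; rewrite dotZr enormZ (gtr0_norm tp) ler_norml => /andP[H1 _] H2.
have : t * (f x + dot (grad f x) h) <= t * (f (x + h) + enorm h * e) by lra.
by rewrite ler_pM2l.
Qed.

(** The gradient is known at [x] only; convexity carries the bound to neighbours [u]. The step [d]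
    is stretched to [v] of length [rho / 2], and secant slopes increase along the ray. The increment
    along [v] is at most [M * rho / 2] from the gradient plus [M / 2 * rho] from the expansion
    error, which gives the slope [2 * M]. *)
Lemma convex_lipschitz_near f x (M : R) :
  strongly_convex 0 f -> differentiable f x -> 0 < M -> enorm (grad f x) <= M ->
  exists2 rho : R, 0 < rho & forall u d, enorm (u - x) <= rho ->
    enorm d <= rho -> f (u + d) - f u <= 2 * M * enorm d.
Proof.
move=> fc df M0 gM.
have M2 : 0 < M / 2 by rewrite divr_gt0.
have [rho rho0 H] := differentiable_expansion df M2.
exists (rho / 2); first by rewrite divr_gt0.
move=> u d ud dr.
have [d0|d0] := eqVneq (enorm d) 0.
  have -> : d = 0 by apply: dot_eq0; rewrite -enorm_sq d0 expr0n.
  by rewrite addr0 subrr enorm0 mulr0.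
have dp : 0 < enorm d by rewrite lt_neqAle eq_sym d0 enorm_ge0.
pose t := enorm d / (rho / 2).
have tp : 0 < t by rewrite !divr_gt0.
have t1 : t <= 1 by rewrite ler_pdivrMr ?mul1r // divr_gt0.
pose v := t^-1 *: d.
have vn : enorm v = rho / 2.
  rewrite /v enormZ gtr0_norm ?invr_gt0 // /t; field.
  by rewrite !gt_eqF.
have uv : enorm (u - x + v) <= rho by apply: le_trans (enormD _ _) _; rewrite vn; lra.
have := H _ uv.
rewrite addrA (addrC x) subrK ler_norml => /andP[_ H1].
have := convex_gradient_le (u - x) fc df; rewrite (addrC x) subrK => H2.
have t01 : 0 <= t <= 1 by rewrite (ltW tp).
have := convex_ray u v fc t01.
rewrite {1}/v scalerA divff ?gt_eqF // scale1r => H3.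
have H4 : dot (grad f x) v <= M * enorm v.
  by apply: le_trans (dot_le _ _) _; rewrite ler_wpM2r // enorm_ge0.
move: H1; rewrite dotDr => H1.
have H5 : M / 2 * enorm (u - x + v) <= M / 2 * rho by rewrite ler_pM2l.
have H6 : f (u + v) - f u <= M * rho by rewrite vn in H4; lra.
apply: le_trans H3 _; apply: le_trans (_ : t * (M * rho) <= _).
  by rewrite ler_pM2l.
by rewrite /t le_eqVlt; apply/orP; left; apply/eqP; field; rewrite gt_eqF.
Qed.

End DifferentiablePoint.

(** * Spectral bounds and step sizes *)

Section Rayleigh.
Variables (R : realType).

Lemma mulmx_bounded (p q : nat) (A : 'M[R]_(p, q)) :
  exists2 K : R, 0 < K & forall x, dot (A *m x) (A *m x) <= K * dot x x.
Proof.
exists (1 + \sum_i dot (row i A)^T (row i A)^T).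
  by rewrite ltr_wpDr // sumr_ge0 // => i _; exact: dot_ge0.
move=> x; rewrite mulrDl mul1r -[leLHS]add0r lerD ?dot_ge0 //.
rewrite mulr_suml /dot; apply: ler_sum => i _.
apply: le_trans (dot_sq_le (row i A)^T x); rewrite -expr2 !mxE.
rewrite le_eqVlt; apply/orP; left; apply/eqP; congr (_ ^+ 2).
by apply: eq_bigr => j _; rewrite !mxE.
Qed.

Variables (m : nat) (W : 'M[R]_m).
Hypotheses (m_gt0 : (0 < m)%N) (Wsym : W^T = W).

Let rayleigh_quotients := [set dot x (W *m x) | x in [set x | dot x x = 1]].

Let r := sup rayleigh_quotients.

Let has_sup_quotients : has_sup rayleigh_quotients.
Proof.
split.
  exists (dot (delta_mx (Ordinal m_gt0) 0) (W *m delta_mx (Ordinal m_gt0) 0)).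
  by exists (delta_mx (Ordinal m_gt0) 0) => //=; rewrite dot_delta mxE !eqxx.
have [K K0 HK] := mulmx_bounded W.
exists (1 + K) => _ [x x1 <-]; move: x1 (HK x) => /= x1; rewrite x1 => h.
by have := dot_ge0 (x - W *m x); rewrite !dotE (dotC (W *m x) x); lra.
Qed.

Let quotient_le x : dot x (W *m x) <= r * dot x x.
Proof.
have [x0|x0] := eqVneq (dot x x) 0; first by rewrite (dot_eq0 x0) !dotE mulr0.
have xp : 0 < dot x x by rewrite lt_neqAle eq_sym x0 dot_ge0.
have n0 : enorm x != 0.
  by apply: contra_neq x0; rewrite -enorm_sq => ->; rewrite expr0n.
have : dot ((enorm x)^-1 *: x) (W *m ((enorm x)^-1 *: x)) <= r.
  apply: ub_le_sup; first by case: has_sup_quotients.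
  by exists ((enorm x)^-1 *: x) => //=; rewrite !dotE -enorm_sq; field.
rewrite -scalemxAr !dotE mulrA -invfM -expr2 enorm_sq mulrC.
by rewrite ler_pdivrMr.
Qed.

(* [A = r%:M - W] is positive semidefinite, whence [|A x|^2 <= (1 + K) <x, A x>]; if
   [A] were invertible, [<x, A x>] would be bounded away from 0 on the unit sphere. *)
Let eigenvalue_r : eigenvalue W r.
Proof.
rewrite /eigenvalue /eigenspace kermx_eq0 row_free_unit; apply/negP => uA.
pose A : 'M[R]_m := r%:M - W.
have {uA}uA : A \in unitmx.
  have -> : A = (-1) *: (W - r%:M) by rewrite /A scaleN1r opprB.
  by rewrite unitmxZ // unitrN unitr1.
have AT : A^T = A by rewrite /A linearB /= tr_scalar_mx Wsym.
have AE x : dot x (A *m x) = r * dot x x - dot x (W *m x).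
  by rewrite /A mulmxBl mul_scalar_mx !dotE.
have [K K0 HK] := mulmx_bounded A.
have [K' K0' HK'] := mulmx_bounded (invmx A).
have Aq x : dot (A *m x) (A *m x) <= (1 + K) * dot x (A *m x).
  (* The nonnegative form of [A] is evaluated at the gradient step [x - t *: y]; for this [t] the
     quadratic term cancels at most half of the linear one. *)
  pose y := A *m x; pose t := (1 + K)^-1.
  have t0 : 0 < t by rewrite invr_gt0 ltr_wpDr // ltW.
  have tK : t * (1 + K) = 1 by rewrite mulVf // gt_eqF // ltr_wpDr // ltW.
  have qy : dot y (A *m y) <= (1 + K) * dot y y.
    have := dot_ge0 (y - A *m y); have := HK y; have := dot_ge0 y.
    have := mulr_ge0 (ltW K0) (dot_ge0 y).
    by rewrite !dotE (dotC (A *m y)); lra.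
  have := AE (x - t *: y); have := quotient_le (x - t *: y).
  set d := dot _ _; rewrite -subr_ge0 => H1 H2; rewrite -H2 in H1.
  have E : dot (x - t *: y) (A *m (x - t *: y)) =
      dot x y - 2 * t * dot y y + t ^+ 2 * dot y (A *m y).
    rewrite mulmxBr -scalemxAr -/y !dotE.
    by rewrite (dot_mulmxr A x y) AT -/y; ring.
  rewrite E in H1.
  have H3 : t ^+ 2 * dot y (A *m y) <= t ^+ 2 * ((1 + K) * dot y y).
    by rewrite ler_pM2l // exprn_gt0.
  have H4 : t ^+ 2 * ((1 + K) * dot y y) = t * dot y y.
    by rewrite expr2 -!mulrA (mulrA t (1 + K)) tK mul1r.
  have H5 : t * dot y y <= dot x y by lra.
  rewrite -(ler_pM2l t0) [leRHS]mulrA tK mul1r; exact: H5.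
have Kp : 0 < 2 * (K' * (1 + K)) by rewrite !mulr_gt0 // ltr_wpDr // ltW.
have e0 : 0 < (2 * (K' * (1 + K)))^-1 by rewrite invr_gt0.
have [_ [x x1 <-] Hx] := sup_adherent e0 has_sup_quotients.
have := HK' (A *m x); rewrite mulKmx // x1 => H1.
have H2 := AE x; rewrite x1 mulr1 in H2.
have H3 : dot x (A *m x) < (2 * (K' * (1 + K)))^-1.
  by rewrite H2; move: Hx; rewrite -/r; lra.
have H4 : K' * dot (A *m x) (A *m x) <= K' * ((1 + K) * dot x (A *m x)).
  by rewrite ler_pM2l.
have H5 : 2 * (K' * (1 + K)) * dot x (A *m x) < 1.
  by rewrite -ltr_pdivlMl // mulr1.
suff: (1 : R) < 1 by rewrite ltxx.
by lra.
Qed.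

Let eigenvalue_le a : eigenvalue W a -> a <= r.
Proof.
case/eigenvalueP => v va v0; have := quotient_le v^T.
have -> : W *m v^T = a *: v^T by rewrite -{1}Wsym -trmx_mul va linearZ.
rewrite dotZr ler_pM2r // lt_neqAle dot_ge0 andbT eq_sym.
by apply: contra v0 => /eqP/dot_eq0/(congr1 trmx); rewrite trmxK trmx0 => ->.
Qed.

Lemma dot_le_lambda_max x : dot x (W *m x) <= lambda_max W * dot x x.
Proof.
apply: le_trans (quotient_le x) _; rewrite ler_wpM2r ?dot_ge0 //.
by apply: ub_le_sup => //; exists r => a; exact: eigenvalue_le.
Qed.

Lemma lambda_minp_le_max : 0 < lambda_minp W -> lambda_minp W <= lambda_max W.
Proof.
(* [inf] defaults to 0 on a set without infimum, so positivity provides a nonzero eigenvalue. *)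
move=> l0; have [[a [ea a0]] hl] : has_inf [set a | eigenvalue W a /\ a != 0].
  by apply: contrapT => /inf_out H; move: l0; rewrite /lambda_minp H ltxx.
apply: (@le_trans _ _ a); first by apply: ge_inf.
by apply: ub_le_sup => //; exists r => b; exact: eigenvalue_le.
Qed.

End Rayleigh.

Lemma laplacian_sym (R : realType) (m : nat) (e : rel 'I_m) :
  symmetric e -> (laplacian R e)^T = laplacian R e.
Proof.
move=> es; apply/matrixP => i j; rewrite !mxE (es j i) eq_sym.
by case: eqP => // ->.
Qed.

Section StepSizes.
Variables (R : realType) (L : R) (al : nat -> R).
Hypotheses (L_gt0 : 0 < L) (alP : step_sizes L al).

Lemma partial_sumS k : partial_sum al k.+1 = partial_sum al k + al k.+1.
Proof. by rewrite /partial_sum big_ord_recr. Qed.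

Lemma partial_sum0 : partial_sum al 0 = 0.
Proof. by rewrite /partial_sum big_ord_recr big_ord0 /= add0r; case: alP. Qed.

Lemma partial_sum_sq k : partial_sum al k = 2 * L * al k ^+ 2.
Proof.
case: k => [|k]; last by case: alP => _ /(_ k)[].
by rewrite partial_sum0; case: alP => -> _; rewrite expr0n mulr0.
Qed.

Lemma step_size_ge0 k : 0 <= al k.
Proof. by case: alP => a0 aS; case: k => [|k]; [rewrite a0|case: (aS k) => /ltW]. Qed.

Lemma step_size_gt0 k : 0 < al k.+1.
Proof. by case: alP => _ /(_ k)[]. Qed.

Lemma partial_sum_ge0 k : 0 <= partial_sum al k.
Proof. by apply: sumr_ge0 => i _; exact: step_size_ge0. Qed.

Lemma partial_sum_gt0 k : 0 < partial_sum al k.+1.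
Proof. by rewrite partial_sumS ltr_wpDl ?partial_sum_ge0 ?step_size_gt0. Qed.

Lemma step_size_recurrence k :
  2 * L * al k.+1 ^+ 2 = 2 * L * al k ^+ 2 + al k.+1.
Proof. by rewrite -!partial_sum_sq partial_sumS. Qed.

(** For [A = 2 * L * al k] and [B = 2 * L * al k.+1] the recurrence reads [B * (B - 1) = A ^+ 2],
    whose positive solution lies between [A + 1/2] and [A + 1]; hence linear growth of the steps. *)
Lemma step_size_bounds k : k%:R <= 4 * L * al k /\ 2 * L * al k <= k%:R.
Proof.
elim: k => [|k [IH1 IH2]]; first by case: alP => -> _; rewrite !mulr0.
have := step_size_recurrence k; have := step_size_gt0 k; have := step_size_ge0 k.
set a := al k in IH1 IH2 *; set b := al k.+1 => a0 b0 H.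
have k0 : 0 <= k%:R :> R by [].
pose A := 2 * L * a; pose B := 2 * L * b.
have B0 : 0 < B by rewrite !mulr_gt0.
have A0 : 0 <= A by rewrite !mulr_ge0 // ltW.
have HB : B * (B - 1) = A ^+ 2.
  apply: (@mulfI _ (2 * L)^-1); first by rewrite invr_neq0 // mulf_neq0 // gt_eqF.
  have -> : (2 * L)^-1 * (B * (B - 1)) = 2 * L * b ^+ 2 - b.
    by rewrite /B; field; rewrite gt_eqF.
  have -> : (2 * L)^-1 * A ^+ 2 = 2 * L * a ^+ 2.
    by rewrite /A; field; rewrite gt_eqF.
  by rewrite H addrK.
have {}IH1 : k%:R <= 2 * A by rewrite /A; lra.
have {}IH2 : A <= k%:R by [].
rewrite -natr1; split.
  have -> : 4 * L * b = 2 * B by rewrite /B; ring.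
  rewrite leNgt; apply/negP => h.
  have A1 : 0 <= A ^+ 2 by exact: sqr_ge0.
  have : 1 <= B by nra.
  have : (2 * A) ^+ 2 >= k%:R ^+ 2 by rewrite ler_pXn2r // nnegrE mulr_ge0.
  by nra.
rewrite -/B leNgt; apply/negP => h.
have : A ^+ 2 <= k%:R ^+ 2 by rewrite ler_pXn2r.
by nra.
Qed.

Lemma partial_sum_bounds k :
  k%:R ^+ 2 <= 8 * L * partial_sum al k /\ 2 * L * partial_sum al k <= k%:R ^+ 2.
Proof.
have [H1 H2] := step_size_bounds k; rewrite partial_sum_sq.
have a0 := step_size_ge0 k.
have La : 0 <= L * al k by rewrite mulr_ge0 // ltW.
split.
  have -> : 8 * L * (2 * L * al k ^+ 2) = (4 * L * al k) ^+ 2 by ring.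
  by rewrite ler_pXn2r ?nnegrE // -mulrA mulr_ge0.
have -> : 2 * L * (2 * L * al k ^+ 2) = (2 * L * al k) ^+ 2 by ring.
by rewrite ler_pXn2r ?nnegrE // -mulrA mulr_ge0.
Qed.

End StepSizes.

(** * The accelerated dual method along one realisation *)

Section Duality.
Variables (R : realType) (m n : nat).
Variables (f : 'I_m -> 'cV[R]_n -> R) (Q : 'M[R]_(m * n)) (gamma lmax : R).
Hypotheses (m_gt0 : (0 < m)%N) (gamma_gt0 : 0 < gamma) (lmax_gt0 : 0 < lmax).
Hypothesis f_sc : forall i, strongly_convex gamma (f i).
Hypothesis Qsym : Q^T = Q.
Hypothesis Q_le : forall y, dot (Q *m y) (Q *m y) <= lmax * dot y y.
Implicit Types (p x y : 'cV[R]_(m * n)).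

(** The maximiser of [dot p x - primal f x]. The factor [1/m] in [primal] is the reason for [m%:R]
    in front of each block of [p]. *)
Definition primal_argmax p : 'cV[R]_(m * n) :=
  stack (fun i => grad (conjugate (f i)) (m%:R *: blockv p i)).

Let mR_gt0 : 0 < m%:R :> R. Proof. by rewrite ltr0n. Qed.

Lemma dot_sym_mulmx x y : dot x (Q *m y) = dot (Q *m x) y.
Proof. by rewrite dot_mulmxr Qsym. Qed.

Lemma dualE y : dual f Q y =
  dot (Q *m y) (primal_argmax (Q *m y)) - primal f (primal_argmax (Q *m y)).
Proof.
rewrite /dual /primal dot_blockv -[X in X - _](mulKf (lt0r_neq0 mR_gt0)).
rewrite -mulrBr; congr (_ * _); rewrite mulr_sumr -sumrB.
apply: eq_bigr => i _; rewrite blockv_stack -dotZl.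
by case: (conjugateP (m%:R *: blockv (Q *m y) i) gamma_gt0 (f_sc i)).
Qed.

Lemma primal_lower p x : primal f (primal_argmax p) + dot p (x - primal_argmax p)
  + gamma / (2 * m%:R) * dot (x - primal_argmax p) (x - primal_argmax p)
  <= primal f x.
Proof.
rewrite /primal !dot_blockv.
have -> : \sum_i dot (blockv p i) (blockv (x - primal_argmax p) i) =
   m%:R^-1 * \sum_i m%:R * dot (blockv p i) (blockv (x - primal_argmax p) i).
  by rewrite -mulr_sumr mulKf // gt_eqF.
have -> (s : R) : gamma / (2 * m%:R) * s = m%:R^-1 * (gamma / 2 * s).
  by field; rewrite gt_eqF.
rewrite -!mulrDr ler_pM2l ?invr_gt0 // mulr_sumr -!big_split /=.
apply: ler_sum => i _; rewrite blockvD blockvN blockv_stack -dotZl -enorm_sq.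
by case: (conjugateP (m%:R *: blockv p i) gamma_gt0 (f_sc i)) => _ /(_ (blockv x i)).
Qed.

Lemma blockv_primal_argmax p i :
  blockv (primal_argmax p) i = grad (conjugate (f i)) (m%:R *: blockv p i).
Proof. exact: blockv_stack. Qed.

Local Opaque primal_argmax.

Lemma dual_ge x y : dot (Q *m y) x - primal f x <= dual f Q y.
Proof.
have := primal_lower (Q *m y) x; rewrite dualE !dotE.
have := dot_ge0 (x - primal_argmax (Q *m y)); rewrite !dotE.
set d := (X in 0 <= X) => d0.
have : 0 <= gamma / (2 * m%:R) * d.
  by rewrite mulr_ge0 // divr_ge0 ?(ltW gamma_gt0) // mulr_ge0.
by rewrite /d; lra.
Qed.

(* Smoothness of the conjugate: [c] is half the modulus of strong convexity, and the
   maximum over [w] of [<q - p, w - u> - c |w - u|^2] is [|q - p|^2 / (4 c)]. *)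
Lemma conjugate_gap_le (c K a b : R) p q u w : 0 < c ->
  a + dot p (w - u) + c * dot (w - u) (w - u) <= b ->
  (4 * c)^-1 * dot (q - p) (q - p) <= K ->
  dot q w - b <= dot p u - a + dot u (q - p) + K.
Proof.
move=> c0 H1 H2.
have H3 : 0 <= (4 * c)^-1 *
    dot ((2 * c) *: (w - u) - (q - p)) ((2 * c) *: (w - u) - (q - p)).
  by rewrite mulr_ge0 ?dot_ge0 // invr_ge0 mulr_ge0 // ltW.
have {H3} : 0 <= c * dot (w - u) (w - u) - dot (w - u) (q - p) +
    (4 * c)^-1 * dot (q - p) (q - p).
  apply: le_trans H3 _; rewrite le_eqVlt; apply/orP; left; apply/eqP.
  move: (w - u) (q - p) => s t; rewrite !dotE (dotC t s); field.
  by rewrite gt_eqF.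
have -> : dot (w - u) (q - p) = dot q w - dot p w - dot u (q - p).
  by rewrite !dotE (dotC w q) (dotC w p); ring.
move: H1 H2; rewrite dotDr dotNr (dotC p u).
by move: (dot (q - p) _) (dot (w - u) _) => s t; lra.
Qed.

Lemma dual_smooth x y : dual f Q y <= dual f Q x +
  dot (Q *m primal_argmax (Q *m x)) (y - x) +
  m%:R * lmax / gamma / 2 * dot (y - x) (y - x).
Proof.
have H1 := primal_lower (Q *m x) (primal_argmax (Q *m y)).
have H2 := Q_le (y - x); rewrite mulmxBr in H2.
rewrite !dualE -(dot_sym_mulmx _ (y - x)) mulmxBr.
set c := gamma / (2 * m%:R) in H1.
have c0 : 0 < c by rewrite divr_gt0 // mulr_gt0.
apply: (conjugate_gap_le c0 H1).
have -> : m%:R * lmax / gamma / 2 * dot (y - x) (y - x) =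
   (4 * c)^-1 * (lmax * dot (y - x) (y - x)).
  by rewrite /c; field; rewrite !gt_eqF.
by rewrite ler_pM2l // invr_gt0 mulr_gt0.
Qed.

Variables (Xs lamstar : 'cV[R]_(m * n)).
Hypotheses (XsP : primal_solution f Q Xs) (lamP : dual_solution f Q lamstar).

(** A gradient step of length [1/L] from [lamstar] would decrease the dual unless [Q *m u = 0]. Thus
    [u] is feasible, and quadratic growth of the Lagrangian around [u], compared with optimality of
    [Xs], forces [u = Xs]. Strong duality comes out as a by-product. *)
Lemma primal_argmax_dual_solution : primal_argmax (Q *m lamstar) = Xs.
Proof.
set u := primal_argmax _; pose L := m%:R * lmax / gamma.
have L0 : 0 < L by rewrite divr_gt0 // mulr_gt0.
have Qu : Q *m u = 0.
  apply: dot_eq0; apply: le_anti; rewrite dot_ge0 andbT.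
  have := le_trans (lamP (lamstar - L^-1 *: (Q *m u))) (dual_smooth lamstar _).
  have -> : lamstar - L^-1 *: (Q *m u) - lamstar = - (L^-1 *: (Q *m u)).
    by rewrite addrAC subrr add0r.
  rewrite -/u -/L !dotE; move: (dot (Q *m u) _) (dual _ _ _) => a b.
  have -> : L / 2 * - - (L^-1 * (L^-1 * a)) = L^-1 * a / 2.
    by field; rewrite gt_eqF.
  move=> H; rewrite -(ler_pM2l (x := L^-1)) ?invr_gt0 // mulr0; lra.
have [QX Xmin] := XsP.
have := primal_lower (Q *m lamstar) Xs; rewrite -/u.
rewrite dotDr dotNr -!dot_sym_mulmx QX Qu !dot0r subrr addr0 => H.
have := le_trans H (Xmin u Qu); rewrite gerDl pmulr_rle0; last first.
  by rewrite divr_gt0 // mulr_gt0.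
move=> d0; have /dot_eq0/eqP : dot (Xs - u) (Xs - u) = 0.
  by apply: le_anti; rewrite d0 dot_ge0.
by rewrite subr_eq0 eq_sym => /eqP.
Qed.

Lemma primal_ge_solution x : primal f Xs + dot lamstar (Q *m x) +
  gamma / (2 * m%:R) * dot (x - Xs) (x - Xs) <= primal f x.
Proof.
have := primal_lower (Q *m lamstar) x; rewrite primal_argmax_dual_solution.
by rewrite dotDr dotNr -!dot_sym_mulmx; case: XsP => -> _; rewrite dot0r subr0.
Qed.

Lemma dual_ge_solution y : - primal f Xs <= dual f Q y.
Proof.
by apply: le_trans (dual_ge Xs y); rewrite -dot_sym_mulmx; case: XsP => -> _; rewrite dot0r sub0r.
Qed.

Lemma primal_convex : strongly_convex 0 (primal f).
Proof.
move=> x y t t01; rewrite !mul0r subr0 /primal !(mulrCA _ m%:R^-1).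
rewrite -mulrDr ler_pM2l ?invr_gt0 // !mulr_sumr -big_split /=.
apply: ler_sum => i _.
have := strongly_convexW (ltW gamma_gt0) (f_sc i) (blockv x i) (blockv y i) t01.
by rewrite !mul0r subr0 blockvD !blockvZ.
Qed.

Variables (al : nat -> R) (z y lam d : nat -> 'cV[R]_(m * n)).
Let x k := primal_argmax (Q *m lam k).
Let S := partial_sum al.
Hypothesis alP : step_sizes (m%:R * lmax / gamma) al.
Hypothesis z0 : z 0%N = 0.
Hypothesis zS : forall k, z k.+1 = z k - Q *m (al k.+1 *: x k + d k).
Hypothesis lamE : forall k, S k.+1 *: lam k = al k.+1 *: z k + S k *: y k.
Hypothesis yS : forall k, S k.+1 *: y k.+1 = al k.+1 *: z k.+1 + S k *: y k.

(* The linear model of the dual at [lam k] is used at the point 0, where its value is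
   [- primal f (x k)]; this is why no reference point occurs. *)
Lemma accelerated_step k :
  S k.+1 * dual f Q (y k.+1) + al k.+1 * primal f (x k)
    + 2^-1 * dot (z k.+1) (z k.+1) <=
  S k * dual f Q (y k) + 2^-1 * dot (z k) (z k)
    - dot (Q *m d k) (z k) + dot (Q *m d k) (Q *m d k).
Proof.
pose L := m%:R * lmax / gamma.
have L0 : 0 < L by rewrite divr_gt0 // mulr_gt0.
have a0 : 0 < al k.+1 by exact: step_size_gt0 alP k.
have S0 : 0 <= S k by exact: partial_sum_ge0 alP k.
have SS : S k.+1 = S k + al k.+1 by exact: partial_sumS.
have S2 : S k.+1 = 2 * L * al k.+1 ^+ 2 by exact: partial_sum_sq alP k.+1.
have S1 : 0 < S k.+1 by rewrite SS ltr_wpDl.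
set g := Q *m x k; set e := Q *m d k.
have zE : z k.+1 = z k - (al k.+1 *: g + e) by rewrite zS mulmxDr scalemxAr.
have dyl : S k.+1 *: (y k.+1 - lam k) = al k.+1 *: (z k.+1 - z k).
  by rewrite scalerBr lamE yS scalerBr opprD addrACA subrr addr0.
have Ha := dual_smooth (lam k) (y k.+1); rewrite -/(x k) -/g -/L in Ha.
have Hb := dualE (lam k); rewrite -/(x k) -dot_sym_mulmx -/g (dotC (lam k)) in Hb.
have Hc := dual_ge (x k) (y k); rewrite -dot_sym_mulmx -/g (dotC (y k)) in Hc.
have Hd : S k.+1 * dot g (y k.+1 - lam k) = al k.+1 * dot g (z k.+1 - z k).
  by rewrite -!dotZr dyl.
have He : S k.+1 * (L / 2 * dot (y k.+1 - lam k) (y k.+1 - lam k)) =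
    4^-1 * dot (z k.+1 - z k) (z k.+1 - z k).
  apply: (mulfI (lt0r_neq0 S1)).
  have -> : S k.+1 * (S k.+1 * (L / 2 * dot (y k.+1 - lam k) (y k.+1 - lam k))) =
     L / 2 * (S k.+1 * (S k.+1 * dot (y k.+1 - lam k) (y k.+1 - lam k))) by ring.
  rewrite -(dotZl (S _)) -(dotZr (S _)) dyl dotZl dotZr S2.
  by field.
have Hf : S k.+1 * dot g (lam k) = al k.+1 * dot g (z k) + S k * dot g (y k).
  by rewrite -!dotZr lamE dotDr.
have {}Ha : S k.+1 * dual f Q (y k.+1) <= S k.+1 * (dual f Q (lam k) +
    dot g (y k.+1 - lam k) + L / 2 * dot (y k.+1 - lam k) (y k.+1 - lam k)).
  by rewrite ler_pM2l.
have {}Hc : S k * (dot g (y k) - primal f (x k)) <= S k * dual f Q (y k).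
  by rewrite ler_wpM2l.
rewrite mulrDr mulrDr He Hd Hb mulrBr Hf in Ha.
have -> : dot (z k.+1) (z k.+1) = dot (z k) (z k) +
   2 * dot (z k) (z k.+1 - z k) + dot (z k.+1 - z k) (z k.+1 - z k).
  by rewrite !dotE (dotC (z k.+1) (z k)); ring.
have dzE : z k.+1 - z k = - (al k.+1 *: g + e) by rewrite zE addrAC subrr add0r.
rewrite dzE in Ha *; rewrite !dotE in Ha *.
rewrite SS (dotC e g) in Ha.
have := dot_ge0 (al k.+1 *: g - e); rewrite !dotE.
rewrite !(dotC e g) !(dotC (z k)) SS.
by lra.
Qed.

(** In the application [z j] is determined before the samples behind [d j] are drawn, so every
    linear term has conditional mean zero. *)
Definition noise_sum k :=
  \sum_(j < k) (dot (Q *m d j) (lamstar - z j) + dot (Q *m d j) (Q *m d j)).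

Lemma accelerated_sum k :
  S k * dual f Q (y k) + \sum_(j < k) al j.+1 * primal f (x j)
    + 2^-1 * dot (z k) (z k) <=
  noise_sum k - dot lamstar (Q *m \sum_(j < k) d j).
Proof.
elim: k => [|k IH].
  rewrite /noise_sum !big_ord0 mulmx0 dot0r z0 dot0l mulr0 subr0 !addr0.
  by rewrite /S (partial_sum0 alP) mul0r.
have := accelerated_step k.
rewrite /noise_sum !big_ord_recr /= -/(noise_sum k) mulmxDr dotDr.
rewrite dotDr dotNr (dotC _ lamstar); lra.
Qed.

Lemma dual_iterate_sum k :
  z k = - (Q *m (\sum_(j < k) al j.+1 *: x j)) - Q *m (\sum_(j < k) d j).
Proof.
elim: k => [|k IH]; first by rewrite !big_ord0 mulmx0 z0 oppr0 addr0.
by rewrite zS IH !big_ord_recr /= !mulmxDr !opprD addrACA.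
Qed.

Lemma partial_sum_shift k : S k = \sum_(j < k) al j.+1.
Proof.
rewrite /S /partial_sum big_ord_recl; case: alP => -> _; rewrite add0r.
by apply: eq_bigr.
Qed.

(** Optimality bounds the dual value and each [primal f (x j)] from below, the multiplier [lamstar]
    paying for the infeasibility of [x j]. By [dual_iterate_sum] this payment is
    [- dot lamstar (z k)] minus a total-noise term. The latter cancels the one in [accelerated_sum],
    and the former completes the square. *)
Lemma dual_distance_le k : 2^-1 * dot (z k - lamstar) (z k - lamstar) <=
  2^-1 * dot lamstar lamstar + noise_sum k.
Proof.
have H1 := accelerated_sum k.
have H2 : - S k * primal f Xs <= S k * dual f Q (y k).
  by rewrite mulNr -mulrN ler_wpM2l ?dual_ge_solution // (partial_sum_ge0 alP).
have H3 : S k * primal f Xs + dot lamstar (Q *m (\sum_(j < k) al j.+1 *: x j)) <=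
   \sum_(j < k) al j.+1 * primal f (x j).
  rewrite partial_sum_shift mulr_suml mulmx_sumr dotC dot_suml -big_split.
  apply: ler_sum => j _ /=; rewrite -scalemxAr dotZl -mulrDr.
  rewrite ler_pM2l ?(step_size_gt0 alP) // dotC.
  apply: le_trans (primal_ge_solution (x j)); rewrite lerDl.
  by rewrite mulr_ge0 ?dot_ge0 // divr_ge0 ?mulr_ge0 // ltW.
have H4 : dot lamstar (z k) = - dot lamstar (Q *m (\sum_(j < k) al j.+1 *: x j))
    - dot lamstar (Q *m (\sum_(j < k) d j)).
  by rewrite dual_iterate_sum !dotE.
by rewrite !dotE (dotC (z k) lamstar); lra.
Qed.

Let xs k := \sum_(j < k) al j.+1 *: x j.

Lemma primal_average_le k :
  S k.+1 * primal f ((S k.+1)^-1 *: xs k.+1) <=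
  \sum_(j < k.+1) al j.+1 * primal f (x j).
Proof.
elim: k => [|k IH].
  rewrite /xs !big_ord1 partial_sum_shift big_ord1 scalerA mulVf ?scale1r //.
  by rewrite gt_eqF // (step_size_gt0 alP).
rewrite big_ord_recr /=; apply: le_trans (lerD IH (lexx _)).
have Sp : 0 < S k.+1 by exact: partial_sum_gt0 alP k.
have ap : 0 < al k.+2 by exact: step_size_gt0 alP k.+1.
have SS : S k.+2 = S k.+1 + al k.+2 by exact: partial_sumS.
have Sp2 : 0 < S k.+2 by exact: partial_sum_gt0 alP k.+1.
pose t := S k.+1 / S k.+2.
have t1 : 1 - t = al k.+2 / S k.+2.
  by rewrite /t SS; field; rewrite -SS gt_eqF.
have t01 : 0 <= t <= 1.
  by rewrite divr_ge0 ?(ltW Sp) ?(ltW Sp2) //= ler_pdivrMr // mul1r SS lerDl ltW.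
have := primal_convex ((S k.+1)^-1 *: xs k.+1) (x k.+1) t01.
rewrite !mul0r subr0 t1 !scalerA.
have -> : t / S k.+1 = (S k.+2)^-1 by rewrite /t; field; rewrite !gt_eqF.
rewrite -(ler_pM2l Sp2).
have -> : (S k.+2)^-1 *: xs k.+1 + (al k.+2 / S k.+2) *: x k.+1 =
    (S k.+2)^-1 *: xs k.+2.
  by rewrite /xs [in RHS]big_ord_recr /= scalerDr scalerA (mulrC (al _)).
move=> H; apply: le_trans H _; rewrite le_eqVlt; apply/orP; left; apply/eqP.
by rewrite /t; field; rewrite gt_eqF.
Qed.

(** Indexed by [k.+1] because [S 0 = 0] admits no average. The second bound retains the quadratic
    growth at [Xs]; it later places the average in the ball where the [f i] are Lipschitz. *)
Lemma primal_average_gap k :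
  let xhat := (S k.+1)^-1 *: xs k.+1 in
  S k.+1 * (primal f xhat - primal f Xs) <=
    noise_sum k.+1 - dot lamstar (Q *m \sum_(j < k.+1) d j) /\
  S k.+1 * (gamma / (2 * m%:R) * dot (xhat - Xs) (xhat - Xs)) <=
    2^-1 * dot lamstar lamstar + noise_sum k.+1.
Proof.
move=> xhat; have Sp : 0 < S k.+1 by exact: partial_sum_gt0 alP k.
have H1 := accelerated_sum k.+1; have H2 := primal_average_le k.
have H3 : - S k.+1 * primal f Xs <= S k.+1 * dual f Q (y k.+1).
  by rewrite mulNr -mulrN ler_pM2l ?dual_ge_solution.
have H4 := dot_ge0 (z k.+1); rewrite -/xhat in H2; split; first by lra.
have := primal_ge_solution xhat; rewrite -(ler_pM2l Sp) !mulrDr.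
rewrite -(dotZr (S k.+1)) scalemxAr /xhat scalerA divff ?gt_eqF // scale1r -/xhat.
have := congr1 (dot lamstar) (dual_iterate_sum k.+1); rewrite !dotE -/(xs _).
have := dot_ge0 (z k.+1 - lamstar); rewrite !dotE (dotC (z k.+1) lamstar).
by lra.
Qed.

End Duality.

(** * Sub-Gaussian noise *)

Section ExponentialInequalities.
Variable R : realType.
Implicit Types x p : R.

(** Only [expR 1 - 1 <= 3] is used; this is the factor 3 of [subgaussian_square_exp]. *)
Lemma expR1_le4 : expR 1 <= 4 :> R.
Proof.
have h := expR_ge1Dx (- 2^-1 : R).
have e0 := expR_gt0 (2^-1 : R).
have h1 : expR (2^-1 : R) * expR (- 2^-1) = 1 by rewrite -expRD subrr expR0.
have h2 : expR (2^-1 : R) <= 2 by nra.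
have -> : 1 = 2^-1 + 2^-1 :> R by field.
by rewrite expRD; nra.
Qed.

(** From [1/2] on, [2 * x ^+ 2] dominates [x]; below, [expR x <= (1 - x)^-1 <= 1 + x + 2 * x ^+ 2].
    The linear term is kept exactly so that it integrates to zero for centred noise. *)
Lemma expR_le_linear_expR_sq x : expR x <= x + expR (2 * x ^+ 2).
Proof.
have [x2|x2] := lerP 2^-1 x.
  have : expR x <= expR (2 * x ^+ 2) by rewrite ler_expR; nra.
  by lra.
have := expR_ge1Dx (2 * x ^+ 2); suff : expR x <= 1 + x + 2 * x ^+ 2 by lra.
have h := expR_ge1Dx (- x).
have e0 := expR_gt0 x.
have : expR x * (1 - x) <= 1.
  have E : expR x * expR (- x) = 1 by rewrite -expRD subrr expR0.
  by rewrite -[leRHS]E ler_pM2l.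
rewrite -ler_pdivlMr; last by lra.
move=> /le_trans; apply; rewrite ler_pdivrMr; last by lra.
by have := sqr_ge0 x; nra.
Qed.

Lemma expR_scale_le p x : 0 <= p <= 1 -> expR (p * x) <= 1 - p + p * expR x.
Proof.
move=> /andP[p0 p1].
have e0 := expR_gt0 (p * x).
have h1 : expR (p * x) * (1 - p * x) <= 1.
  have E : expR (p * x) * expR (- (p * x)) = 1 by rewrite -expRD subrr expR0.
  by rewrite -[leRHS]E ler_pM2l // expR_ge1Dx.
have h2 : expR (p * x) * (1 + (1 - p) * x) <= expR x.
  have E : x = p * x + (1 - p) * x by ring.
  by rewrite [in leRHS]E expRD ler_pM2l // expR_ge1Dx.
have h3 : (1 - p) * (expR (p * x) * (1 - p * x)) <= (1 - p) * 1.
  by rewrite ler_wpM2l // subr_ge0.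
have h4 : p * (expR (p * x) * (1 + (1 - p) * x)) <= p * expR x by rewrite ler_wpM2l.
by lra.
Qed.

Lemma expR_half_sum_le x y : expR (x + y) <= 2^-1 * expR (2 * x) + 2^-1 * expR (2 * y).
Proof.
have -> : 2 * x = x + x by ring.
have -> : 2 * y = y + y by ring.
rewrite !expRD; have := sqr_ge0 (expR x - expR y); rewrite expr2; lra.
Qed.

End ExponentialInequalities.

Section MeasurableVectors.
Context {d : measure_display} {T : measurableType d} {R : realType}.

Definition measurable_vec (k : nat) (V : T -> 'cV[R]_k) :=
  forall a, measurable_fun [set: T] (fun w => V w a 0).

Lemma measurable_vec_cst k (v : 'cV[R]_k) : measurable_vec (fun=> v).
Proof. by move=> a; exact: measurable_cst. Qed.

Lemma measurable_vecD k (U V : T -> 'cV[R]_k) :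
  measurable_vec U -> measurable_vec V -> measurable_vec (fun w => U w + V w).
Proof.
move=> mU mV a; under eq_fun do rewrite mxE.
exact: measurable_funD.
Qed.

Lemma measurable_vecZ k (c : T -> R) (V : T -> 'cV[R]_k) :
  measurable_fun setT c -> measurable_vec V -> measurable_vec (fun w => c w *: V w).
Proof.
move=> mc mV a; under eq_fun do rewrite mxE.
exact: measurable_funM.
Qed.

Lemma measurable_vecZl k (c : R) (V : T -> 'cV[R]_k) :
  measurable_vec V -> measurable_vec (fun w => c *: V w).
Proof. by move=> mV; apply: measurable_vecZ => //; exact: measurable_cst. Qed.

Lemma measurable_vecN k (V : T -> 'cV[R]_k) :
  measurable_vec V -> measurable_vec (fun w => - V w).
Proof.
move=> mV; under eq_fun do rewrite -scaleN1r.
exact: measurable_vecZl.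
Qed.

Lemma measurable_vecB k (U V : T -> 'cV[R]_k) :
  measurable_vec U -> measurable_vec V -> measurable_vec (fun w => U w - V w).
Proof. by move=> mU mV; apply: measurable_vecD => //; exact: measurable_vecN. Qed.

Lemma measurable_vec_sum k (I : Type) (s : seq I) (V : I -> T -> 'cV[R]_k) :
  (forall i, measurable_vec (V i)) -> measurable_vec (fun w => \sum_(i <- s) V i w).
Proof.
move=> mV a; under eq_fun do rewrite summxE.
by apply: measurable_sum => i; exact: mV.
Qed.

Lemma measurable_vec_mulmx k l (A : 'M[R]_(l, k)) (V : T -> 'cV[R]_k) :
  measurable_vec V -> measurable_vec (fun w => A *m V w).
Proof.
move=> mV a; under eq_fun do rewrite mxE.
by apply: measurable_sum => j; apply: measurable_funM.
Qed.

Lemma measurable_dot k (U V : T -> 'cV[R]_k) :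
  measurable_vec U -> measurable_vec V ->
  measurable_fun setT (fun w => dot (U w) (V w)).
Proof. by move=> mU mV; apply: measurable_sum => a; exact: measurable_funM. Qed.

Lemma measurable_vec_stack m n (V : 'I_m -> T -> 'cV[R]_n) :
  (forall i, measurable_vec (V i)) ->
  measurable_vec (fun w => stack (fun i => V i w)).
Proof.
move=> mV p; case/mxvec_indexP: p => i a.
under eq_fun do rewrite mxE mxvecE mxE.
exact: mV.
Qed.

End MeasurableVectors.

Section SubGaussianStep.
Context {d : measure_display} {T : measurableType d} {R : realType}.
Variables (P : probability T R) (n : nat) (X : T -> 'cV[R]_n) (c : 'cV[R]_n).
Variable sigma : R.
Hypotheses (sigma_gt0 : 0 < sigma) (mX : measurable_vec X).
Hypothesis X_mean : forall a, ('E_P[fun w => (X w a 0)%R] = (c a 0)%:E)%E.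
Hypothesis X_subgaussian :
  ('E_P[fun w => expR (enorm (X w - c) ^+ 2 / sigma ^+ 2)%R] <= (expR 1)%:E)%E.

Let nu w := X w - c.
Let N w := dot (nu w) (nu w) / sigma ^+ 2.

Let mnu : measurable_vec nu.
Proof. by apply: measurable_vecB => //; exact: measurable_vec_cst. Qed.

Let mN : measurable_fun setT N.
Proof.
apply: measurable_funM; first exact: measurable_dot.
exact: measurable_cst.
Qed.

Let N_ge0 w : 0 <= N w.
Proof. by rewrite divr_ge0 ?dot_ge0 ?sqr_ge0. Qed.

Let mexpR (g : T -> R) : measurable_fun setT g ->
  measurable_fun setT (fun w => (expR (g w))%:E).
Proof. by move=> mg; apply/measurable_EFinP; exact: measurableT_comp. Qed.

Let mZ (k : R) (g : T -> R) : measurable_fun setT g ->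
  measurable_fun setT (fun w => k * g w).
Proof. by move=> mg; exact: measurable_funM. Qed.

Let mEZ (k : R) (g : T -> R) : measurable_fun setT g ->
  measurable_fun setT (fun w => k%:E * (expR (g w))%:E)%E.
Proof. by move=> mg; apply: emeasurable_funM => //; exact: mexpR. Qed.

Let exp_ge0 (g : T -> R) w : (0 <= (expR (g w))%:E)%E.
Proof. by rewrite lee_fin expR_ge0. Qed.

Let int_expN : (\int[P]_w (expR (N w))%:E <= (expR 1)%:E)%E.
Proof.
move: X_subgaussian; rewrite unlock => H; apply: le_trans H.
by rewrite le_eqVlt; apply/orP; left; apply/eqP; apply: eq_integral => w _; rewrite enorm_sq.
Qed.

Lemma subgaussian_square_exp (p : R) : 0 <= p <= 1 ->
  (\int[P]_w (expR (p * N w))%:E <= (expR (3 * p))%:E)%E.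
Proof.
move=> p01; have /andP[p0 p1] := p01.
apply: (@le_trans _ _ (\int[P]_w ((1 - p)%:E + p%:E * (expR (N w))%:E))%E).
  apply: ge0_le_integral => //.
  - by apply: mexpR; exact: mZ.
  - by apply: emeasurable_funD => //; exact: mEZ.
  - by move=> w _; rewrite -EFinM -EFinD lee_fin expR_scale_le.
rewrite ge0_integralD //=; first last.
- exact: mEZ.
- by move=> w _; rewrite mule_ge0.
- by move=> w _; rewrite lee_fin subr_ge0.
rewrite ge0_integralZl_EFin //; last exact: mexpR.
rewrite integral_cst //= probability_setT mule1.
apply: (@le_trans _ _ ((1 - p)%:E + p%:E * (expR 1)%:E)%E).
  by apply: leeD => //; rewrite lee_wpmul2l // lee_fin.
rewrite -EFinM -EFinD lee_fin.
apply: le_trans (expR_ge1Dx _).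
by have := expR1_le4 R; nra.
Qed.

Let integrable_expN p : 0 <= p <= 1 ->
  P.-integrable setT (fun w => (expR (p * N w))%:E).
Proof.
move=> p01; apply/integrableP; split.
  by apply: mexpR; exact: mZ.
under eq_integral do rewrite gee0_abs ?lee_fin ?expR_ge0 //.
by apply: le_lt_trans (subgaussian_square_exp p01) _; rewrite ltry.
Qed.

Let integrable_nu a : P.-integrable setT (fun w => (nu w a 0)%:E).
Proof.
apply: (@le_integrable _ _ _ _ _ _ _ (fun w => (sigma%:E * (expR (1 * N w))%:E)%E)) => //.
- by apply/measurable_EFinP; exact: mnu.
- move=> w _; rewrite -EFinM lee_fin [leRHS]ger0_norm; last first.
    by rewrite mulr_ge0 ?expR_ge0 // ltW.
  apply: le_trans (coord_le_enorm _ _) _.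
  rewrite -ler_pdivrMl // mul1r.
  apply: le_trans (expR_ge1Dx _); rewrite /N -enorm_sq.
  have -> : enorm (nu w) ^+ 2 / sigma ^+ 2 = (sigma^-1 * enorm (nu w)) ^+ 2.
    by field; rewrite gt_eqF.
  by have := sqr_ge0 (sigma^-1 * enorm (nu w) - 2^-1); nra.
- by apply: integrableZl => //; apply: integrable_expN; rewrite lexx ler01.
Qed.

Let int_nu a : (\int[P]_w (nu w a 0)%:E = 0)%E.
Proof.
have iX : P.-integrable setT (fun w => (X w a 0)%:E).
  have -> : (fun w => (X w a 0)%:E) = (fun w => (nu w a 0)%:E + (c a 0)%:E)%E.
    by apply/funext => w; rewrite -EFinD !mxE subrK.
  apply: integrableD => //.
  exact: (finite_measure_integrable_cst P (c a 0)).
have -> : (fun w => (nu w a 0)%:E) = (fun w => (X w a 0)%:E - (c a 0)%:E)%E.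
  by apply/funext => w; rewrite -EFinB !mxE.
rewrite integralB //; last exact: (finite_measure_integrable_cst P (c a 0)).
have := X_mean a; rewrite unlock => ->.
by rewrite integral_cst //= probability_setT mule1 subee.
Qed.

(* In [expR x <= x + expR (2 * x ^+ 2)] the linear term has mean zero and the second
   one is controlled by the sub-Gaussian hypothesis when [p <= 1]; for [p > 1] the
   exponent is bounded by Young's inequality. *)
Lemma subgaussian_linear_exp (u : 'cV[R]_n) :
  (\int[P]_w (expR (2 * dot (nu w) u))%:E <=
    (expR (24 * (sigma ^+ 2 * dot u u)))%:E)%E.
Proof.
(* Chosen so that Cauchy-Schwarz gives [2 * (2 * dot (nu w) u) ^+ 2 <= p * N w]. *)
pose p := 8 * (sigma ^+ 2 * dot u u).
have s2 : 0 < sigma ^+ 2 by rewrite exprn_gt0.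
have p0 : 0 <= p by rewrite !mulr_ge0 ?dot_ge0 // ltW.
have mdu : measurable_fun setT (fun w => dot (nu w) u).
  by apply: measurable_dot => //; exact: measurable_vec_cst.
have m2 : measurable_fun setT (fun w => 2 * dot (nu w) u).
  exact: mZ.
have nuN w : dot (nu w) (nu w) = sigma ^+ 2 * N w.
  by rewrite /N mulrC divfK // gt_eqF.
have -> : 24 * (sigma ^+ 2 * dot u u) = 3 * p by rewrite /p; ring.
have [p1|p1] := lerP p 1.
  have p01 : 0 <= p <= 1 by rewrite p0.
  have i1 : P.-integrable setT (fun w => (2 * dot (nu w) u)%:E).
    have -> : (fun w => (2 * dot (nu w) u)%:E) =
       (fun w => \sum_(a < n) (2 * u a 0)%:E * (nu w a 0)%:E)%E.
      apply/funext => w; rewrite sumEFin; congr (_%:E).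
      by rewrite mulr_sumr; apply: eq_bigr => a _; ring.
    by apply: integrable_sum => // a _; apply: integrableZl.
  have e1 : (\int[P]_w (2 * dot (nu w) u)%:E = 0)%E.
    transitivity (\int[P]_w \sum_(a < n) (2 * u a 0)%:E * (nu w a 0)%:E)%E.
      apply: eq_integral => w _; rewrite sumEFin; congr (_%:E).
      by rewrite mulr_sumr; apply: eq_bigr => a _; ring.
    rewrite integral_sum //; last by move=> a; apply: integrableZl.
    by rewrite big1 // => a _; rewrite integralZl // int_nu mule0.
  apply: (@le_trans _ _ (\int[P]_w ((2 * dot (nu w) u)%:E + (expR (p * N w))%:E))%E).
    apply: le_integral => //.
    - apply: (@le_integrable _ _ _ _ _ _ _
         (fun w => (2 * dot (nu w) u)%:E + (expR (p * N w))%:E)%E) => //.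
      + exact: mexpR.
      + move=> w _; rewrite -EFinD lee_fin ger0_norm ?expR_ge0 //.
        apply: le_trans (ler_norm _).
        apply: le_trans (expR_le_linear_expR_sq _) _; rewrite lerD2l ler_expR.
        have := dot_sq_le (nu w) u; rewrite nuN /p; lra.
      + by apply: integrableD => //; exact: integrable_expN.
    - by apply: integrableD => //; exact: integrable_expN.
    - move=> w _; rewrite -EFinD lee_fin.
      apply: le_trans (expR_le_linear_expR_sq _) _; rewrite lerD2l ler_expR.
      by have := dot_sq_le (nu w) u; rewrite nuN /p; lra.
  rewrite integralD //; last exact: integrable_expN.
  by rewrite e1 add0e; exact: subgaussian_square_exp.
apply: (@le_trans _ _ (\int[P]_w ((expR (p / 4))%:E * (expR (2^-1 * N w))%:E))%E).
  apply: ge0_le_integral => //.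
  - exact: mexpR.
  - by apply: mEZ; exact: mZ.
  - move=> w _; rewrite -EFinM -expRD lee_fin ler_expR.
    have := dot_ge0 (sigma^-1 *: nu w - (2 * sigma) *: u).
    have -> : dot (sigma^-1 *: nu w - (2 * sigma) *: u) (sigma^-1 *: nu w - (2 * sigma) *: u)
      = N w - 4 * dot (nu w) u + 4 * (sigma ^+ 2 * dot u u).
      rewrite /N; move: (nu w) => v; rewrite !dotE (dotC u v); field.
      by rewrite gt_eqF.
    by rewrite /p; lra.
rewrite ge0_integralZl_EFin ?expR_ge0 //; last by apply: mexpR; exact: mZ.
(* The moment at [1/2] costs [3/2], and [p / 4 + 3 / 2 <= 3 * p] because [p > 1]. *)
have h : 0 <= (2^-1 : R) <= 1 by lra.
apply: le_trans (lee_wpmul2l _ (subgaussian_square_exp h)) _.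
  by rewrite lee_fin expR_ge0.
by rewrite -EFinM -expRD lee_fin ler_expR; lra.
Qed.

(** [expR_half_sum_le] decouples the two parts by doubling both exponents: hence the 2 in
    [subgaussian_linear_exp] and the range condition, which is [p <= 1] for the squared norm. Both
    resulting exponents are nonnegative, so the mean of the exponentials is below the exponential of
    the sum. *)
Lemma subgaussian_quadratic_exp (u : 'cV[R]_n) (tau : R) :
  0 <= tau -> 2 * tau * sigma ^+ 2 <= 1 ->
  (\int[P]_w (expR (dot (X w - c) u + tau * dot (X w - c) (X w - c)))%:E <=
    (expR (6 * (tau * sigma ^+ 2) + 24 * (sigma ^+ 2 * dot u u)))%:E)%E.
Proof.
move=> t0 t1.
have s2 : 0 < sigma ^+ 2 by rewrite exprn_gt0.
set p := 2 * tau * sigma ^+ 2 in t1.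
have p01 : 0 <= p <= 1 by rewrite t1 andbT !mulr_ge0 // ltW.
have nuN w : dot (nu w) (nu w) = sigma ^+ 2 * N w.
  by rewrite /N mulrC divfK // gt_eqF.
have mdu : measurable_fun setT (fun w => dot (nu w) u).
  by apply: measurable_dot => //; exact: measurable_vec_cst.
have m1 : measurable_fun setT (fun w => (expR (2 * dot (nu w) u))%:E).
  by apply: mexpR; exact: mZ.
have m2 : measurable_fun setT (fun w => (expR (p * N w))%:E).
  by apply: mexpR; exact: mZ.
have h2 : 0 <= (2^-1 : R) by rewrite invr_ge0.
apply: (@le_trans _ _ (\int[P]_w ((2^-1)%:E * (expR (2 * dot (nu w) u))%:E +
    (2^-1)%:E * (expR (p * N w))%:E))%E).
  apply: ge0_le_integral => //.
  - apply: mexpR; apply: measurable_funD => //.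
    by apply: mZ; exact: measurable_dot.
  - by apply: emeasurable_funD; apply: emeasurable_funM.
  - move=> w _; rewrite -!EFinM -EFinD lee_fin; apply: le_trans (expR_half_sum_le _ _) _.
    by rewrite lerD2l ler_wpM2l // ler_expR nuN /p; lra.
have mule (g : T -> R) w : (0 <= (2^-1)%:E * (expR (g w))%:E)%E.
  by rewrite mule_ge0 // lee_fin.
rewrite ge0_integralD //; [|exact: emeasurable_funM..].
rewrite !ge0_integralZl_EFin //.
have h2E : (0 <= (2^-1 : R)%:E)%E by rewrite lee_fin.
apply: le_trans (leeD (lee_wpmul2l h2E (subgaussian_linear_exp u))
   (lee_wpmul2l h2E (subgaussian_square_exp p01))) _.
have a0 : 0 <= 24 * (sigma ^+ 2 * dot u u) by rewrite !mulr_ge0 ?dot_ge0 // ltW.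
have b0 : 0 <= 6 * (tau * sigma ^+ 2) by rewrite !mulr_ge0 // ltW.
rewrite -!EFinM -EFinD lee_fin.
have -> : 3 * p = 6 * (tau * sigma ^+ 2) by rewrite /p; ring.
set a := 24 * _ in a0 *; set b := 6 * _ in b0 *.
have : expR a <= expR (b + a) by rewrite ler_expR lerDr.
have : expR b <= expR (b + a) by rewrite ler_expR lerDl.
by lra.
Qed.

End SubGaussianStep.

(** * Freezing the past *)

Section Freezing.
Context {dO dX : measure_display}.
Variables (R : realType) (Omega : measurableType dO) (Xi : measurableType dX).
Variables (P : probability Omega R) (I : choiceType) (X : I -> Omega -> Xi).
Hypothesis mX : forall i, measurable_fun [set: Omega] (X i).
Hypothesis iX : mutually_independent P X.

(** A pi-system: [mutually_independent] speaks only of such finite intersections, and uniqueness of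
    measures extends it to the generated sigma-algebra. *)
Definition cylinder (U : set I) : set (set Omega) :=
  [set E | exists (s : seq I) (B : I -> set Xi),
    [/\ uniq s, forall i, i \in s -> U i, forall i, measurable (B i) &
        E = \bigcap_(i in [set i | i \in s]) (X i @^-1` B i)]].

(** The sample space itself with the coarser sigma-algebra of the samples in [U]; measurability on
    it expresses dependence on these samples alone. *)
Definition history (U : set I) := g_sigma_algebraType (cylinder U).

Let measurable_preimage i B : measurable B -> measurable (X i @^-1` B).
Proof. by move=> mB; rewrite -[X in measurable X]setTI; exact: mX. Qed.

Let cylinder_measurable U E : cylinder U E -> measurable E.
Proof.
move=> [s [B [us sU mB ->]]].
rewrite -/[set` s] bigcap_seq; elim/big_ind: _ => //.
  by move=> *; exact: measurableI.
by move=> i _; exact: measurable_preimage.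
Qed.

Let cylinderT U : cylinder U setT.
Proof.
exists [::], (fun=> setT); split => //.
by apply/seteqP; split => // w _ i.
Qed.

Let cylinder_setI U : setI_closed (cylinder U).
Proof.
move=> _ _ [s [B [us sU mB ->]]] [t [C [ut tU mC ->]]].
exists (undup (s ++ t)), (fun i => (if i \in s then B i else setT) `&`
                                   (if i \in t then C i else setT)); split.
- exact: undup_uniq.
- by move=> i; rewrite mem_undup mem_cat => /orP[/sU|/tU].
- by move=> i; apply: measurableI; case: ifP.
apply/seteqP; split => [w [H1 H2] i /= _|w H].
  by split; case: ifP => // h; [exact: H1|exact: H2].
split=> i /= h.
  by have [] := H i; rewrite /= ?mem_undup ?mem_cat ?h.
by have [] := H i; rewrite /= ?mem_undup ?mem_cat ?h ?orbT.
Qed.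

Lemma measurable_history_id U :
  measurable_fun [set: Omega] (id : Omega -> history U).
Proof.
move=> _ E mE; rewrite setTI preimage_id.
by apply: (smallest_sub (@sigma_algebra_measurable _ Omega)) mE; exact: cylinder_measurable.
Qed.

Lemma measurable_sample_history (U : set I) i : U i ->
  measurable_fun [set: history U] (X i : history U -> Xi).
Proof.
move=> Ui _ B mB; rewrite setTI; apply: sub_sigma_algebra.
exists [:: i], (fun=> B); split => //.
  by move=> j; rewrite inE => /eqP ->.
apply/seteqP; split => w /= h; first by move=> j /=; rewrite inE => /eqP ->.
by apply: h; rewrite /= inE.
Qed.

Let cylinder_indep U j E B : ~ U j -> cylinder U E -> measurable B ->
  P (E `&` (X j @^-1` B)) = (P E * P (X j @^-1` B))%E.
Proof.
move=> Uj [s [C [us sU mC ->]]] mB.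
have js : j \notin s by apply/negP => /sU.
pose D i := if i == j then B else C i.
have mD i : measurable (D i) by rewrite /D; case: ifP.
have -> : \bigcap_(i in [set i | i \in s]) (X i @^-1` C i) `&` (X j @^-1` B) =
  \bigcap_(i in [set i | i \in j :: s]) (X i @^-1` D i).
  apply/seteqP; split => [w [H1 H2] i /=|w H].
    rewrite inE /D => /orP[/eqP ->|is_]; first by rewrite eqxx.
    by case: eqP => [->//|_]; exact: H1.
  split=> [i /= is_|].
    have := H i; rewrite /= inE is_ orbT => /(_ isT); rewrite /D.
    by case: eqP => // ij; move: js; rewrite -ij is_.
  by have := H j; rewrite /= inE eqxx => /(_ isT); rewrite /D eqxx.
rewrite iX //=; last by rewrite js.
rewrite iX // big_cons {1}/D eqxx muleC; congr (_ * _)%E.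
apply: eq_big_seq => i is_; rewrite /D; case: eqP => // ij.
by move: js; rewrite -ij is_.
Qed.

(** Both sides are finite measures in [E], a restriction and a rescaling of [P], and they agree on
    cylinders. *)
Lemma history_sample_independent (U : set I) j (E : set (history U)) B :
  ~ U j -> measurable E -> measurable B ->
  P (E `&` (X j @^-1` B)) = (P E * P (X j @^-1` B))%E.
Proof.
move=> Uj mE mB.
have mXB := measurable_preimage j mB.
have r0 : 0 <= fine (P (X j @^-1` B)) by rewrite fine_ge0.
pose m1 := mrestr P mXB.
pose m2 := mscale (NngNum r0) P.
have rE : (fine (P (X j @^-1` B)))%:E = P (X j @^-1` B).
  by rewrite fineK // fin_num_measure.
have m1E A : m1 A = P (A `&` (X j @^-1` B)) by [].
have m2E A : m2 A = (P A * P (X j @^-1` B))%E.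
  by rewrite -rE muleC.
rewrite -m1E -m2E.
apply: (@g_sigma_algebra_measure_unique _ R Omega (cylinder U)
  (@cylinder_measurable U) (fun=> setT) (fun=> cylinderT U) _ m1 m2
  (@cylinder_setI U)) => //.
- by apply/seteqP; split => // w _; exists 0%N.
- by move=> A cA; exact: (etrans (cylinder_indep Uj cA mB) (esym (m2E A))).
- move=> _; change (P (setT `&` (X j @^-1` B)) < +oo)%E.
  by rewrite setTI ltey_eq fin_num_measure.
Qed.

(* The history is frozen by taking the identity map into [history U] as the
   random element that is independent of the sample [X j]. *)
Lemma freezing_le (U : set I) j (phi : history U * Xi -> R) (psi : Omega -> R) :
  ~ U j -> measurable_fun setT phi -> (forall z, 0 <= phi z) ->
  measurable_fun setT psi ->
  (forall w, \int[P]_w' (phi (w, X j w'))%:E <= (psi w)%:E)%E ->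
  (\int[P]_w (phi (w, X j w))%:E <= \int[P]_w (psi w)%:E)%E.
Proof.
move=> Uj mphi phi0 mpsi le_psi.
pose hid : Omega -> history U := id.
have mhid : measurable_fun setT hid := @measurable_history_id U.
pose pr : Omega -> history U * Xi := fun w => (hid w, X j w).
have mpr : measurable_fun setT pr by exact: measurable_fun_pair.
pose fhid : {mfun Omega >-> history U} :=
  HB.pack hid (isMeasurableFun.Build _ _ _ _ hid mhid).
pose fX : {mfun Omega >-> Xi} :=
  HB.pack (X j) (isMeasurableFun.Build _ _ _ _ (X j) (mX j)).
pose fpr : {mfun Omega >-> (history U * Xi)%type} :=
  HB.pack pr (isMeasurableFun.Build _ _ _ _ pr mpr).
pose m1 := distribution P fhid; pose m2 := distribution P fX.
have mE : measurable_fun setT (EFin \o phi) by exact/measurable_EFinP.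
have E0 z : (0 <= (EFin \o phi) z)%E by rewrite lee_fin.
have -> : (\int[P]_w (phi (w, X j w))%:E =
    \int[(m1 \x m2)%E]_z (EFin \o phi) z)%E.
  transitivity (\int[distribution P fpr]_z (EFin \o phi) z)%E.
    exact: (esym (ge0_integral_distribution (P := P) fpr mE E0)).
  apply: eq_measure_integral => A mA _.
  apply/esym; apply: product_measure_unique => // C D mC mD.
  exact: (history_sample_independent Uj mC mD).
have mF : measurable_fun setT (fubini_F m2 (EFin \o phi)).
  exact: measurable_fun_fubini_tonelli_F.
have F0 w : (0 <= fubini_F m2 (EFin \o phi) w)%E by apply: integral_ge0.
rewrite fubini_tonelli1 //.
rewrite (ge0_integral_distribution (P := P) fhid mF F0).
apply: ge0_le_integral => //.
- by move=> w _; exact: F0.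
- exact: measurableT_comp.
- exact/measurable_EFinP.
move=> w _; apply: le_trans (le_psi w); rewrite le_eqVlt; apply/orP; left; apply/eqP.
apply: (ge0_integral_distribution (P := P) fX) => //; exact: measurableT_comp.
Qed.

End Freezing.

(** * The stochastic processes of the algorithm *)

Section LocallyLipschitz.
Variables (R : realType) (n : nat).
Implicit Types (x d : 'cV[R]_n) (g : 'cV[R]_n -> R).

Lemma locally_lipschitz_box_gt g x (c : R) : locally_lipschitz g -> c < g x ->
  exists2 rho : R, 0 < rho &
    forall y : 'cV[R]_n, (forall a, `|y a 0 - x a 0| <= rho) -> c < g y.
Proof.
move=> lg cx; have [C [delta [C0 d0 H]]] := lg x.
pose K := (C + 1) * (n%:R + 1).
have n1 : 0 < n%:R + 1 :> R by rewrite ltr_wpDl.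
have K0 : 0 < K by rewrite mulr_gt0 // ltr_wpDl.
pose rho := Num.min (delta / (n%:R + 1)) ((g x - c) / 2 / K).
have r0 : 0 < rho by rewrite lt_min !divr_gt0 // subr_gt0.
exists rho => // y yx.
have yx' a : `|(y - x) a 0| <= rho by rewrite !mxE.
have h := enorm_le_coord (ltW r0) yx'.
have r1 : rho * (n%:R + 1) <= delta by rewrite -ler_pdivlMr // ge_min lexx.
have r2 : rho * K <= (g x - c) / 2 by rewrite -ler_pdivlMr // ge_min lexx orbT.
have hd : enorm (y - x) <= delta by lra.
have := H _ hd; rewrite subrKC.
rewrite ler_norml => /andP[h1 _].
have h2 : C * enorm (y - x) <= (C + 1) * (rho * (n%:R + 1)).
  apply: ler_pM => //; [exact: enorm_ge0|by rewrite lerDl|].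
  by apply: le_trans h _; lra.
have : (C + 1) * (rho * (n%:R + 1)) = rho * K by rewrite /K; ring.
have : 0 < g x - c by rewrite subr_gt0.
by lra.
Qed.

(** A superlevel set of [g] is the union of the countably many boxes with rational centre and radius
    [1/(k+1)] inside it, so coordinatewise measurability of [V] suffices. The radius is taken below
    [rho / 2] because the box is centred near [V w], not at it. *)
Lemma measurable_locally_lipschitz_comp (dT : measure_display)
    (T : measurableType dT)    (V : T -> 'cV[R]_n) g :
  locally_lipschitz g -> measurable_vec V -> measurable_fun setT (g \o V).
Proof.
move=> lg mV mD.
apply: (measurability _ (RGenOInfty.measurableE R)) => //.
move=> _ [_ [c ->] <-]; rewrite setTI.
pose box (q : 'cV[rat]_n * nat) :=
  [set x : 'cV[R]_n | forall a, `|x a 0 - ratr (q.1 a 0)| < q.2.+1%:R^-1].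
pose F (q : 'cV[rat]_n * nat) : set T :=
  if `[< box q `<=` [set x | c < g x] >] then V @^-1` box q else set0.
have -> : (g \o V) @^-1` `]c, +oo[ = \bigcup_q F q.
  apply/seteqP; split => [w /=|w [q _]]; last first.
    rewrite /F; case: asboolP => // qc /qc /=.
    by rewrite in_itv /= andbT.
  rewrite in_itv /= andbT => /(locally_lipschitz_box_gt lg)[rho r0 H].
  have r2 : 0 < rho / 2 by rewrite divr_gt0.
  pose k := Num.bound (rho / 2)^-1.
  have Hk : k.+1%:R^-1 < rho / 2.
    rewrite invf_plt ?posrE //; apply: lt_le_trans (archi_boundP _) _.
      by rewrite invr_ge0 ltW.
    by rewrite ler_nat.
  have k0 : 0 < k.+1%:R^-1 :> R by rewrite invr_gt0.
  have /choice[q Hq] : forall a, exists q : rat,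
      `|V w a 0 - ratr q| < k.+1%:R^-1.
    move=> a.
    move: (k.+1%:R^-1 : R) k0 => e e0.
    have Vk : V w a 0 - e < V w a 0 + e by lra.
    have [q] := rat_in_itvoo Vk; rewrite in_itv /= => /andP[h1 h2]; exists q; rewrite ltr_norml; lra.
  exists ((\col_a q a)%R, k) => //; rewrite /F.
  have bV : box ((\col_a q a)%R, k) (V w) by move=> a /=; rewrite mxE.
  case: asboolP => // h; exfalso; apply: h => y yb; apply: H => a.
  have := bV a; have := yb a; rewrite /= ltr_norml ltr_norml ler_norml.
  by move: (k.+1%:R^-1 : R) Hk => t Ht; lra.
apply: countable_bigcupT_measurable => // q; rewrite /F.
case: asboolP => // _.
have -> : V @^-1` box q = \bigcap_(a in [set: 'I_n]) ((fun w => V w a 0) @^-1`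
     `](ratr (q.1 a 0) - q.2.+1%:R^-1), (ratr (q.1 a 0) + q.2.+1%:R^-1)[).
  apply/seteqP; split => w /= h a; have := h a; rewrite ltr_norml /= in_itv /=;
    move: (q.2.+1%:R^-1 : R) => e.
    by move=> /andP[h1 h2] _; apply/andP; split; lra.
  by move=> /(_ I)/andP[h1 h2]; apply/andP; split; lra.
apply: fin_bigcap_measurable => [|a _]; first exact: finite_finset.
by rewrite -[X in measurable X]setTI; apply: mV.
Qed.

End LocallyLipschitz.

Section ConjugateGradientRegularity.
Variables (R : realType) (n : nat) (gamma : R) (f : 'cV[R]_n -> R).
Hypotheses (gamma_gt0 : 0 < gamma) (f_sc : strongly_convex gamma f).

(** Adding the quadratic growth inequalities of the two maximisers gives [gamma * |x - y|^2 <= dot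
    (lam - mu) (x - y)]. This regularity is what makes the exact gradients along the iterates
    measurable. *)
Lemma grad_conjugate_lipschitz lam mu :
  gamma * enorm (grad (conjugate f) lam - grad (conjugate f) mu) <= enorm (lam - mu).
Proof.
have [_ /(_ (grad (conjugate f) mu)) H1] := conjugateP lam gamma_gt0 f_sc.
have [_ /(_ (grad (conjugate f) lam)) H2] := conjugateP mu gamma_gt0 f_sc.
move: (grad _ lam) (grad _ mu) H1 H2 => x y H1 H2.
have H3 := dot_le (lam - mu) (x - y).
have nE : enorm (y - x) = enorm (x - y) by rewrite -enormN opprB.
have H4 : gamma * enorm (x - y) * enorm (x - y) <= enorm (lam - mu) * enorm (x - y).
  by move: H1 H2 H3; rewrite nE !dotE; lra.
have [->|x0] := eqVneq (enorm (x - y)) 0; first by rewrite mulr0 enorm_ge0.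
by move: H4; rewrite ler_pM2r // lt_neqAle eq_sym x0 enorm_ge0.
Qed.

Lemma grad_conjugate_locally_lipschitz a :
  locally_lipschitz (fun lam => grad (conjugate f) lam a 0).
Proof.
move=> lam; exists gamma^-1, 1; split; [by rewrite invr_ge0 ltW|by []|].
move=> d _; have := grad_conjugate_lipschitz (lam + d) lam.
have -> : lam + d - lam = d by rewrite addrC addKr.
rewrite -ler_pdivlMl // => H; apply: le_trans H.
have := coord_le_enorm (grad (conjugate f) (lam + d) - grad (conjugate f) lam) a.
by rewrite !mxE.
Qed.

End ConjugateGradientRegularity.

Section Injection.
Variables (R : realType) (m n : nat).

Definition inject (i : 'I_m) (v : 'cV[R]_n) : 'cV[R]_(m * n) :=
  stack (fun j => if j == i then v else 0).

Lemma dot_inject i v u : dot (inject i v) u = dot v (blockv u i).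
Proof.
rewrite dot_blockv (bigD1 i) //= blockv_stack eqxx big1 ?addr0 // => j /negbTE ji.
by rewrite blockv_stack ji dot0l.
Qed.

Lemma blockv_inject i v : blockv (inject i v) i = v.
Proof. by rewrite blockv_stack eqxx. Qed.

Lemma dot_block_le (u : 'cV[R]_(m * n)) i : dot (blockv u i) (blockv u i) <= dot u u.
Proof.
rewrite [leRHS]dot_blockv (bigD1 i) //= lerDl.
by apply: sumr_ge0 => j _; exact: dot_ge0.
Qed.

Lemma blockv_sum (I : Type) (s : seq I) (F : I -> 'cV[R]_(m * n)) i :
  blockv (\sum_(t <- s) F t) i = \sum_(t <- s) blockv (F t) i.
Proof.
by apply: (big_morph (fun u => blockv u i)) => [u v|]; [rewrite blockvD|rewrite blockv0].
Qed.

End Injection.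

Section Processes.
Variables (R : realType) (m n : nat) (T Xi : Type).
Variables (f : 'I_m -> 'cV[R]_n -> R) (bW Q : 'M[R]_(m * n)).
Variables (al : nat -> R) (r : nat -> nat).
Variables (G : 'I_m -> 'cV[R]_n -> Xi -> 'cV[R]_n).
Variables (xi : nat -> 'I_m -> nat -> T -> Xi).

Definition answers (w : T) k i l lam := G i lam (xi k i l w).

Definition state_at k w := iterate bW al r (answers w) k.

Definition query k w i := lam_next al k (state_at k w) i.

Definition exact_grad k w : 'cV[R]_(m * n) :=
  stack (fun i => grad (conjugate (f i)) (m%:R *: query k w i)).

Definition sampled_grad k w : 'cV[R]_(m * n) :=
  stack (fun i => grad_next al r (answers w) k (state_at k w) i).

Definition grad_noise k w := al k.+1 *: (sampled_grad k w - exact_grad k w).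

(* The algorithm runs in the variables multiplied by [Q = sqrt W]; this is the
   corresponding unbarred iterate, see [zeta_dual_iterate]. *)
Definition dual_iterate k w := - (Q *m \sum_(j < k) al j.+1 *: sampled_grad j w).

Definition sample_noise i lam x := G i lam x - grad (conjugate (f i)) lam.

Definition sample_weight k := al k.+1 / (r k.+1)%:R.

(** Splitting an iteration into single weighted samples replaces a concentration inequality for
    vector averages by repeated use of the one-sample moment bound. *)
Definition batch_noise k (p : seq ('I_m * nat)) w : 'cV[R]_(m * n) :=
  \sum_(t <- p) sample_weight k *:
    inject t.1 (sample_noise t.1 (m%:R *: query k w t.1) (xi k.+1 t.1 t.2 w)).

Definition full_batch k := [seq (i, l) | i <- enum 'I_m, l <- iota 0 (r k.+1)].

Lemma full_batch_uniq k : uniq (full_batch k).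
Proof.
rewrite /full_batch; apply: (allpairs_uniq (enum_uniq _) (iota_uniq _ _)).
by move=> [i l] [j q] _ _ [/= -> ->].
Qed.

Lemma size_full_batch k : size (full_batch k) = (m * r k.+1)%N.
Proof. by rewrite size_allpairs size_enum_ord size_iota. Qed.

Lemma batch_noise_full k w : (0 < r k.+1)%N ->
  batch_noise k (full_batch k) w = grad_noise k w.
Proof.
move=> r0; apply: eq_blockv => i.
rewrite blockv_sum blockvZ blockvD blockvN !blockv_stack /full_batch.
rewrite big_allpairs_dep big_enum /= (bigD1 i) //= [X in _ + X]big1 ?addr0; last first.
  move=> j ji; apply: big1 => l _.
  by rewrite blockvZ blockv_stack eq_sym (negbTE ji) scaler0.
under eq_bigr do rewrite blockvZ blockv_inject.
rewrite -scaler_sumr /sample_weight -scalerA; congr (_ *: _).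
rewrite /sample_noise sumrB /grad_next scalerBr; congr (_ - _).
  congr (_ *: _); rewrite /query -/(state_at k w).
  rewrite -(big_mkord xpredT (fun l => answers w k.+1 i l
     (m%:R *: lam_next al k (state_at k w) i))).
  by rewrite /index_iota subn0.
rewrite big_const_seq count_predT size_iota iter_addr_0 -[X in _ *: X]scaler_nat scalerA.
by rewrite mulVf ?scale1r // pnatr_eq0 -lt0n.
Qed.

Lemma dual_iterateS k w :
  dual_iterate k.+1 w = dual_iterate k w - Q *m (al k.+1 *: exact_grad k w + grad_noise k w).
Proof.
rewrite /dual_iterate big_ord_recr /= mulmxDr opprD; congr (_ - _ *m _).
by rewrite /grad_noise scalerBr subrKC.
Qed.

Lemma dual_iterate0 w : dual_iterate 0 w = 0.
Proof. by rewrite /dual_iterate big_ord0 mulmx0 oppr0. Qed.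

Hypothesis QQ : Q *m Q = bW.

Lemma zeta_dual_iterate k w i :
  zeta (state_at k w) i = blockv (Q *m dual_iterate k w) i.
Proof.
elim: k i => [|k IH] i; first by rewrite dual_iterate0 mulmx0 blockv0.
rewrite /state_at /= /zeta_next -/(state_at k w) IH /dual_iterate big_ord_recr /=.
rewrite mulmxDr opprD mulmxDr blockvD; congr (_ + _).
rewrite mulmxN mulmxA QQ -scalemxAr blockvN blockvZ blockv_mulmx.
congr (- (_ *: _)); apply: eq_bigr => j _.
by rewrite blockv_stack.
Qed.

Fixpoint dual_average k w : 'cV[R]_(m * n) :=
  if k is k'.+1 then (partial_sum al k)^-1 *:
    (al k *: dual_iterate k w + partial_sum al k' *: dual_average k' w)
  else 0.

Definition dual_query k w : 'cV[R]_(m * n) := (partial_sum al k.+1)^-1 *: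
  (al k.+1 *: dual_iterate k w + partial_sum al k *: dual_average k w).

Lemma eta_dual_average k w i :
  Defs.eta (state_at k w) i = blockv (Q *m dual_average k w) i.
Proof.
elim: k i => [|k IH] i; first by rewrite mulmx0 blockv0.
rewrite [LHS]/= /eta_next -/(state_at k w) IH.
rewrite -[zeta_next _ _ _ _ _ _ _]/(zeta (state_at k.+1 w) i) zeta_dual_iterate /=.
by rewrite -scalemxAr mulmxDr -!scalemxAr !(blockvZ, blockvD).
Qed.

Lemma query_dual_query k w i : query k w i = blockv (Q *m dual_query k w) i.
Proof.
rewrite /query /lam_next zeta_dual_iterate eta_dual_average.
by rewrite -scalemxAr mulmxDr -!scalemxAr !(blockvZ, blockvD).
Qed.

Lemma exact_grad_argmax k w :
  exact_grad k w = primal_argmax f (Q *m dual_query k w).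
Proof.
apply: eq_blockv => i.
by rewrite [RHS]blockv_primal_argmax [LHS]blockv_stack query_dual_query.
Qed.

Lemma output_sum N w : al 0%N = 0 ->
  output bW al r (answers w) N =
  (partial_sum al N)^-1 *: \sum_(k < N) al k.+1 *: sampled_grad k w.
Proof.
move=> al0; apply: eq_blockv => i; rewrite blockv_stack blockvZ.
congr (_ *: _); rewrite big_ord_recl al0 scale0r add0r blockv_sum.
by apply: eq_bigr => k _; rewrite blockvZ blockv_stack.
Qed.

Variables (lmax : R) (lamstar : 'cV[R]_(m * n)).

(* [p] lists the samples of the current batch that have already been drawn. *)
Definition potential k p w : R :=
  2^-1 * dot lamstar lamstar
  + noise_sum Q lamstar (dual_iterate ^~ w) (grad_noise ^~ w) k
  + dot (Q *m batch_noise k p w) (lamstar - dual_iterate k w)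
  + dot (Q *m batch_noise k p w) (Q *m batch_noise k p w)
  + lmax * dot (\sum_(j < k) grad_noise j w + batch_noise k p w)
               (\sum_(j < k) grad_noise j w + batch_noise k p w).

Lemma potential_nil k w : potential k [::] w =
  2^-1 * dot lamstar lamstar
  + noise_sum Q lamstar (dual_iterate ^~ w) (grad_noise ^~ w) k
  + lmax * dot (\sum_(j < k) grad_noise j w) (\sum_(j < k) grad_noise j w).
Proof.
rewrite /potential /batch_noise big_nil mulmx0 !dot0l addr0.
by rewrite !addr0.
Qed.

Lemma potential_full k w : (0 < r k.+1)%N ->
  potential k (full_batch k) w = potential k.+1 [::] w.
Proof.
move=> r0; rewrite potential_nil /potential batch_noise_full //.
by rewrite /noise_sum !big_ord_recr /=; ring.
Qed.

Lemma potential0 w : potential 0 [::] w = 2^-1 * dot lamstar lamstar.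
Proof. by rewrite potential_nil /noise_sum !big_ord0 dot0l mulr0 !addr0. Qed.

End Processes.

Section ProcessMeasurability.
Context {dT dX : measure_display} {T : measurableType dT} {Xi : measurableType dX}.
Variables (R : realType) (m n : nat).
Variables (f : 'I_m -> 'cV[R]_n -> R) (bW Q : 'M[R]_(m * n)) (gamma : R).
Variables (al : nat -> R) (r : nat -> nat).
Variables (G : 'I_m -> 'cV[R]_n -> Xi -> 'cV[R]_n).
Variables (xi : nat -> 'I_m -> nat -> T -> Xi).
Hypotheses (gamma_gt0 : 0 < gamma) (f_sc : forall i, strongly_convex gamma (f i)).
Hypothesis mG : forall i a, measurable_fun [set: n.-tuple R * Xi]
  (fun p => G i (\col_b tnth p.1 b) p.2 a 0).

Lemma measurable_oracle i (L : T -> 'cV[R]_n) (x : T -> Xi) :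
  measurable_vec L -> measurable_fun setT x ->
  measurable_vec (fun w => G i (L w) (x w)).
Proof.
move=> mL mx a.
have -> : (fun w => G i (L w) (x w) a 0) =
   (fun p : n.-tuple R * Xi => G i (\col_b tnth p.1 b) p.2 a 0) \o
   (fun w => ([tuple L w b 0 | b < n], x w)).
  apply/funext => w /=; congr (G i _ _ a 0).
  by apply/colP => b; rewrite mxE tnth_mktuple.
apply: measurableT_comp; first exact: mG.
apply: measurable_fun_pair => //.
apply/measurable_fun_tnthP => b.
rewrite (_ : _ \o _ = fun w => L w b 0); first exact: mL.
by apply/funext => w /=; rewrite tnth_mktuple.
Qed.

Lemma measurable_grad_conjugate i (L : T -> 'cV[R]_n) :
  measurable_vec L -> measurable_vec (fun w => grad (conjugate (f i)) (L w)).
Proof.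
move=> mL a.
apply: (measurable_locally_lipschitz_comp
  (grad_conjugate_locally_lipschitz gamma_gt0 (f_sc i) a) mL).
Qed.

Let mquery_of k :
  (forall i, measurable_vec (fun w => zeta (state_at bW al r G xi k w) i)) ->
  (forall i, measurable_vec (fun w => Defs.eta (state_at bW al r G xi k w) i)) ->
  forall i, measurable_vec (fun w => query bW al r G xi k w i).
Proof.
move=> mz me i; apply: measurable_vecZl; apply: measurable_vecD; apply: measurable_vecZl.
  exact: mz.
exact: me.
Qed.

Let mgrad_of k :
  (forall i l, measurable_fun setT (xi k.+1 i l)) ->
  (forall i, measurable_vec (fun w => query bW al r G xi k w i)) ->
  forall i, measurable_vec
    (fun w => grad_next al r (answers G xi w) k (state_at bW al r G xi k w) i).
Proof.
move=> mx mq i; apply: measurable_vecZl; apply: measurable_vec_sum => l.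
by apply: measurable_oracle => //; apply: measurable_vecZl; exact: mq.
Qed.

(** Only samples up to iteration [k] are assumed measurable, since [T] is also taken to be a
    [history], on which later samples need not be. *)
Lemma measurable_state_at k :
  (forall j i l, (j <= k)%N -> measurable_fun setT (xi j i l)) ->
  (forall i, measurable_vec (fun w => zeta (state_at bW al r G xi k w) i)) /\
  (forall i, measurable_vec (fun w => Defs.eta (state_at bW al r G xi k w) i)).
Proof.
elim: k => [|k IH] mx; first by split => i; exact: measurable_vec_cst.
have [mz me] : _ /\ _ := IH (fun j i l jk => mx j i l (leqW jk)).
have mg := mgrad_of (fun i l => mx _ i l (leqnn _)) (mquery_of mz me).
have mz' i : measurable_vec (fun w => zeta (state_at bW al r G xi k.+1 w) i).
  apply: measurable_vecB; first exact: mz.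
  apply: measurable_vecZl; apply: measurable_vec_sum => j.
  by apply: measurable_vec_mulmx; exact: mg.
split => // i; apply: measurable_vecZl; apply: measurable_vecD.
  by apply: measurable_vecZl; exact: mz'.
by apply: measurable_vecZl; exact: me.
Qed.

Section UpTo.
Variable k : nat.
Hypothesis mxi : forall j i l, (j <= k)%N -> measurable_fun setT (xi j i l).

Lemma measurable_query i : measurable_vec (fun w => query bW al r G xi k w i).
Proof. by have [mz me] := measurable_state_at mxi; exact: mquery_of. Qed.

End UpTo.

Lemma measurable_sampled_grad k :
  (forall j i l, (j <= k.+1)%N -> measurable_fun setT (xi j i l)) ->
  measurable_vec (sampled_grad bW al r G xi k).
Proof.
move=> mx; apply: measurable_vec_stack; apply: mgrad_of => [i l|]; first exact: mx.
by apply: measurable_query => j i l jk; apply: mx; exact: leqW.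
Qed.

Lemma measurable_exact_grad k :
  (forall j i l, (j <= k)%N -> measurable_fun setT (xi j i l)) ->
  measurable_vec (exact_grad f bW al r G xi k).
Proof.
move=> mx; apply: measurable_vec_stack => i; apply: measurable_grad_conjugate.
by apply: measurable_vecZl; exact: measurable_query.
Qed.

Lemma measurable_grad_noise k :
  (forall j i l, (j <= k.+1)%N -> measurable_fun setT (xi j i l)) ->
  measurable_vec (grad_noise f bW al r G xi k).
Proof.
move=> mx; apply: measurable_vecZl; apply: measurable_vecB.
  exact: measurable_sampled_grad.
by apply: measurable_exact_grad => j i l jk; apply: mx; exact: leqW.
Qed.

Lemma measurable_dual_iterate k :
  (forall j i l, (j <= k)%N -> measurable_fun setT (xi j i l)) ->
  measurable_vec (dual_iterate bW Q al r G xi k).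
Proof.
move=> mx; apply: measurable_vecN; apply: measurable_vec_mulmx.
apply: measurable_vec_sum => j; apply: measurable_vecZl.
by apply: measurable_sampled_grad => i ? ? ij; apply: mx; exact: leq_trans ij _.
Qed.

Lemma measurable_noise_total k :
  (forall j i l, (j <= k)%N -> measurable_fun setT (xi j i l)) ->
  measurable_vec (fun w => \sum_(j < k) grad_noise f bW al r G xi j w).
Proof.
move=> mx; apply: measurable_vec_sum => j.
by apply: measurable_grad_noise => i ? ? ij; apply: mx; exact: leq_trans ij _.
Qed.

Lemma measurable_batch_noise k p :
  (forall j i l, (j <= k)%N -> measurable_fun setT (xi j i l)) ->
  (forall t, t \in p -> measurable_fun setT (xi k.+1 t.1 t.2)) ->
  measurable_vec (batch_noise f bW al r G xi k p).
Proof.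
move=> mx; elim: p => [|t p IH] mp a.
  by under eq_fun do rewrite /batch_noise big_nil; exact: measurable_vec_cst.
under eq_fun do rewrite /batch_noise big_cons.
move: a; apply: measurable_vecD; last first.
  by apply: IH => s sp; apply: mp; rewrite inE sp orbT.
apply: measurable_vecZl; apply: measurable_vec_stack => j.
case: (j == t.1); last exact: measurable_vec_cst.
have mq : measurable_vec (fun w => m%:R *: query bW al r G xi k w t.1).
  by apply: measurable_vecZl; exact: measurable_query.
apply: measurable_vecB; last exact: measurable_grad_conjugate.
by apply: measurable_oracle => //; apply: mp; rewrite inE eqxx.
Qed.

Lemma measurable_potential lmax lamstar k p :
  (forall j i l, (j <= k)%N -> measurable_fun setT (xi j i l)) ->
  (forall t, t \in p -> measurable_fun setT (xi k.+1 t.1 t.2)) ->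
  measurable_fun setT (potential f bW Q al r G xi lmax lamstar k p).
Proof.
move=> mx mp.
have mz j : (j <= k)%N -> measurable_vec (dual_iterate bW Q al r G xi j).
  by move=> jk; apply: measurable_dual_iterate => i ? ? ij; apply: mx; exact: leq_trans ij jk.
have mn j : (j < k)%N -> measurable_vec (grad_noise f bW al r G xi j).
  by move=> jk; apply: measurable_grad_noise => i ? ? ij; apply: mx; exact: leq_trans ij jk.
have mb := measurable_batch_noise mx mp.
have mlz j : (j <= k)%N ->
    measurable_vec (fun w => lamstar - dual_iterate bW Q al r G xi j w).
  by move=> jk; apply: measurable_vecB; [exact: measurable_vec_cst|exact: mz].
have mt := measurable_vecD (measurable_noise_total mx) mb.
have mQ (V : T -> 'cV[R]_(m * n)) : measurable_vec V -> measurable_vec (fun w => Q *m V w).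
  exact: measurable_vec_mulmx.
apply: measurable_funD; last first.
  by apply: measurable_funM => //; exact: measurable_dot.
apply: measurable_funD; last by apply: measurable_dot; exact: mQ.
apply: measurable_funD; last by apply: measurable_dot; [exact: mQ|exact: mlz].
apply: measurable_funD => //.
rewrite /noise_sum; apply: measurable_sum => j; apply: measurable_funD; apply: measurable_dot.
- by apply: mQ; exact: mn.
- by apply: mlz; exact: ltnW.
- by apply: mQ; exact: mn.
- by apply: mQ; exact: mn.
Qed.

End ProcessMeasurability.

(** * The exponential supermartingale *)

Section PotentialStep.
Variables (R : realType) (m n : nat) (T Xi : Type).
Variables (f : 'I_m -> 'cV[R]_n -> R) (bW Q : 'M[R]_(m * n)) (gamma lmax : R).
Hypotheses (m_gt0 : (0 < m)%N) (gamma_gt0 : 0 < gamma) (lmax_gt0 : 0 < lmax).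
Hypothesis f_sc : forall i, strongly_convex gamma (f i).
Hypotheses (Qsym : Q^T = Q) (QQ : Q *m Q = bW).
Hypothesis Q_le : forall y, dot (Q *m y) (Q *m y) <= lmax * dot y y.
Variables (Xs lamstar : 'cV[R]_(m * n)).
Hypotheses (XsP : primal_solution f Q Xs) (lamP : dual_solution f Q lamstar).
Variables (al : nat -> R) (r : nat -> nat).
Hypothesis alP : step_sizes (m%:R * lmax / gamma) al.
Variables (G : 'I_m -> 'cV[R]_n -> Xi -> 'cV[R]_n).
Variables (xi : nat -> 'I_m -> nat -> T -> Xi).

Let pot := potential f bW Q al r G xi lmax lamstar.
Let z := dual_iterate bW Q al r G xi.
Let d := grad_noise f bW al r G xi.
Let a := sample_weight al r.

Lemma dual_iterateE w k : z k.+1 w = z k w - Q *m (al k.+1 *: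
  primal_argmax f (Q *m dual_query bW Q al r G xi k w) + d k w).
Proof. by rewrite /z (dual_iterateS f) -(exact_grad_argmax f _ _ _ _ QQ). Qed.

Lemma dual_queryE w k : partial_sum al k.+1 *: dual_query bW Q al r G xi k w =
  al k.+1 *: z k w + partial_sum al k *: dual_average bW Q al r G xi k w.
Proof. by rewrite scalerA divff ?scale1r // gt_eqF // (partial_sum_gt0 alP). Qed.

Lemma dual_averageE w k :
  partial_sum al k.+1 *: dual_average bW Q al r G xi k.+1 w =
  al k.+1 *: z k.+1 w + partial_sum al k *: dual_average bW Q al r G xi k w.
Proof. by rewrite /= scalerA divff ?scale1r // gt_eqF // (partial_sum_gt0 alP). Qed.

Lemma dual_iterate_distance w k :
  2^-1 * dot (z k w - lamstar) (z k w - lamstar) <=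
  2^-1 * dot lamstar lamstar + noise_sum Q lamstar (z ^~ w) (d ^~ w) k.
Proof.
apply: (dual_distance_le m_gt0 gamma_gt0 lmax_gt0 f_sc Qsym Q_le XsP lamP alP
  (dual_iterate0 bW Q al r G xi w) (dual_iterateE w) (dual_queryE w)
  (dual_averageE w)).
Qed.

(** The gradient of the potential with respect to the batch noise. *)
Definition potential_gradient k p w : 'cV[R]_(m * n) :=
  Q *m (lamstar - z k w + 2 *: (Q *m batch_noise f bW al r G xi k p w)) +
  (2 * lmax) *: (\sum_(j < k) d j w + batch_noise f bW al r G xi k p w).

(** The self-bounding step. By [dual_iterate_distance] the potential without its [Y] term is at
    least a quarter of [dot x x]. Then [|a + b|^2 <= 2 |a|^2 + 2 |b|^2] and [Q_le] give [8 * lmax]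
    on both terms, the weight [lmax] of [Y] being what makes them match. *)
Lemma potential_gradient_le k p w :
  dot (potential_gradient k p w) (potential_gradient k p w) <=
  8 * lmax * pot k p w.
Proof.
have := dual_iterate_distance w k.
rewrite /potential_gradient /pot /potential -/z -/d.
set v := lamstar - z k w; set b := batch_noise _ _ _ _ _ _ _ _ _.
set Y := _ + b; set B := _ + noise_sum _ _ _ _ _ => HB.
have E : dot (z k w - lamstar) (z k w - lamstar) = dot v v.
  by rewrite -opprB dotNl dotNr opprK.
rewrite E in HB; set x := v + 2 *: (Q *m b).
have H1 := Q_le x.
have H2 : dot x x = dot v v + 4 * dot (Q *m b) v + 4 * dot (Q *m b) (Q *m b).
  by rewrite /x; move: (Q *m b) {HB} (v) => c v0; rewrite !dotE (dotC v0 c); ring.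
have H3 := dot_ge0 (Q *m x - (2 * lmax) *: Y).
have H4 : dot (Q *m x + (2 * lmax) *: Y) (Q *m x + (2 * lmax) *: Y) +
    dot (Q *m x - (2 * lmax) *: Y) (Q *m x - (2 * lmax) *: Y) =
    2 * dot (Q *m x) (Q *m x) + 8 * lmax ^+ 2 * dot Y Y.
  by move: (Q *m x) (Y) => c Y0; rewrite !dotE (dotC Y0 c); ring.
have H5 : lmax * dot x x <=
   lmax * (4 * (B + dot (Q *m b) v + dot (Q *m b) (Q *m b))).
  rewrite ler_pM2l // H2; have := dot_ge0 v; lra.
by move: H3 H4 H5 H1; move: (dot (_ + _) (_ + _)) (dot (_ - _) (_ - _)) => s t; lra.
Qed.

Lemma potential_ge0 k p w : 0 <= pot k p w.
Proof.
have := le_trans (dot_ge0 _) (potential_gradient_le k p w).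
by rewrite pmulr_rge0 // mulr_gt0.
Qed.

(** The potential is quadratic in the batch noise, so its expansion is exact except for [Q_le] on
    the square of the new term; that bound and the [Y] term contribute [lmax] each. *)
Lemma potential_cons_le k p t w nu :
  nu = sample_noise f G t.1 (m%:R *: query bW al r G xi k w t.1)
         (xi k.+1 t.1 t.2 w) ->
  pot k (t :: p) w <= pot k p w +
    (dot nu (a k *: blockv (potential_gradient k p w) t.1)
     + 2 * lmax * a k ^+ 2 * dot nu nu).
Proof.
move=> nuE; rewrite /pot /potential -/z -/d.
have -> : batch_noise f bW al r G xi k (t :: p) w =
    a k *: inject t.1 nu + batch_noise f bW al r G xi k p w.
  by rewrite /batch_noise big_cons -nuE.
have -> : dot nu (a k *: blockv (potential_gradient k p w) t.1) =
    dot (a k *: inject t.1 nu) (potential_gradient k p w).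
  by rewrite dotZl dot_inject dotZr.
have -> : 2 * lmax * a k ^+ 2 * dot nu nu =
    2 * lmax * dot (a k *: inject t.1 nu) (a k *: inject t.1 nu).
  by rewrite dotZl dotZr dot_inject blockv_inject; ring.
rewrite /potential_gradient -/z.
have H := Q_le (a k *: inject t.1 nu).
move: H; move: (a k *: inject t.1 nu) (batch_noise _ _ _ _ _ _ _ _ _) => y b.
move: (\sum_(j < k) d j w) (lamstar - z k w) (noise_sum _ _ _ _ _) => Y v N H.
rewrite !mulmxDr !(dotDr, dotDl) (dot_sym_mulmx Qsym y v).
rewrite (dot_sym_mulmx Qsym y (2 *: _)) !(dotZr, dotDr).
rewrite (dotC (Q *m b) (Q *m y)) (dotC b y) (dotC Y y) (dotC Y b).
by lra.
Qed.

End PotentialStep.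

(* 192 = 24 * 8, from [subgaussian_quadratic_exp] and [potential_gradient_le]. *)
Definition exp_const (R : realType) : R := 192.

Lemma exp_const_gt0 (R : realType) : 0 < exp_const R.
Proof. by rewrite ltr0n. Qed.

Section Supermartingale.
Context {dO dX : measure_display}.
Variables (R : realType) (Omega : measurableType dO) (Xi : measurableType dX).
Variables (P : probability Omega R) (m n : nat).
Variables (f : 'I_m -> 'cV[R]_n -> R) (bW Q : 'M[R]_(m * n)) (gamma lmax : R).
Hypotheses (m_gt0 : (0 < m)%N) (gamma_gt0 : 0 < gamma) (lmax_gt0 : 0 < lmax).
Hypothesis f_sc : forall i, strongly_convex gamma (f i).
Hypotheses (Qsym : Q^T = Q) (QQ : Q *m Q = bW).
Hypothesis Q_le : forall y, dot (Q *m y) (Q *m y) <= lmax * dot y y.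
Variables (Xs lamstar : 'cV[R]_(m * n)).
Hypotheses (XsP : primal_solution f Q Xs) (lamP : dual_solution f Q lamstar).
Variables (al : nat -> R) (r : nat -> nat).
Hypothesis alP : step_sizes (m%:R * lmax / gamma) al.
Hypothesis r_gt0 : forall k, (0 < r k)%N.
Variables (G : 'I_m -> 'cV[R]_n -> Xi -> 'cV[R]_n).
Variables (xi : nat -> 'I_m -> nat -> Omega -> Xi) (sigma : R).
Hypothesis sigma_gt0 : 0 < sigma.
Hypothesis oracle : stochastic_dual_oracle P f sigma G xi.

Let pot := potential f bW Q al r G xi lmax lamstar.
Let a := sample_weight al r.
Let X (t : nat * 'I_m * nat) : Omega -> Xi := xi t.1.1 t.1.2 t.2.

Definition sample_variance k := lmax * a k ^+ 2 * sigma ^+ 2.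

Lemma sample_variance_ge0 k : 0 <= sample_variance k.
Proof.
by rewrite /sample_variance mulr_ge0 ?sqr_ge0 // mulr_ge0 ?sqr_ge0 // ltW.
Qed.

Definition used_samples k (p : seq ('I_m * nat)) : set (nat * 'I_m * nat) :=
  [set t | (t.1.1 <= k)%N \/ (t.1.1 = k.+1 /\ (t.1.2, t.2) \in p)].

Let mX t : measurable_fun setT (X t).
Proof. exact: (sample_measurable oracle). Qed.

Let mpot k p : measurable_fun setT (pot k p).
Proof.
apply: (measurable_potential bW Q al r gamma_gt0 f_sc (oracle_measurable oracle)).
  by move=> *; exact: (sample_measurable oracle).
by move=> *; exact: (sample_measurable oracle).
Qed.

Lemma sample_exp_le k i l (lam u : 'cV[R]_n) (tau : R) :
  0 <= tau -> 2 * tau * sigma ^+ 2 <= 1 ->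
  (\int[P]_w (expR (dot (sample_noise f G i lam (xi k i l w)) u +
      tau * dot (sample_noise f G i lam (xi k i l w))
                (sample_noise f G i lam (xi k i l w))))%:E <=
    (expR (6 * (tau * sigma ^+ 2) + 24 * (sigma ^+ 2 * dot u u)))%:E)%E.
Proof.
move=> t0 t1.
apply: (subgaussian_quadratic_exp (X := fun w => G i lam (xi k i l w))) => //.
- apply: (measurable_oracle (oracle_measurable oracle)).
    exact: measurable_vec_cst.
  exact: (sample_measurable oracle).
- by move=> b; exact: (oracle_unbiased oracle).
- exact: (oracle_subgaussian oracle).
Qed.

(** With [tau = 2 * s' * lmax * a k ^+ 2] the second numerical hypothesis is the range condition
    [2 * tau * sigma ^+ 2 <= 1]. The sample adds [12 * s'] times its variance to the exponent, and
    also [192 * s' ^+ 2] times the variance times the potential; the latter forces the rate down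
    from [s] to [s']. *)
Lemma potential_exp_step k p t (s s' : R) : t \notin p ->
  0 <= s' -> 4 * s' * sample_variance k <= 1 ->
  s' * (1 + exp_const R * s' * sample_variance k) <= s ->
  (\int[P]_w (expR (s' * pot k (t :: p) w))%:E <=
   (expR (12 * s' * sample_variance k))%:E * \int[P]_w (expR (s * pot k p w))%:E)%E.
Proof.
move=> tp s0 s1 ss; have [i l] := t.
set U := used_samples k p.
pose j : nat * 'I_m * nat := (k.+1, t.1, t.2).
have Uj : ~ U j.
  by rewrite /U /used_samples /= -surjective_pairing ltnn => -[//|[_]]; apply/negP.
pose tau := 2 * s' * lmax * a k ^+ 2.
have tau0 : 0 <= tau by rewrite /tau mulr_ge0 ?sqr_ge0 // !mulr_ge0 // ltW.
pose nu (w : history X U) x := sample_noise f G t.1 (m%:R *: query bW al r G xi k w t.1) x.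
pose u (w : history X U) := (s' * a k) *:
  blockv (potential_gradient f bW Q lmax lamstar al r G xi k p w) t.1.
(* Past and fresh sample are separate arguments: query, gradient and potential read the first
   component only, as [freezing_le] requires. *)
pose phi (y : history X U * Xi) := expR (s' * pot k p y.1 +
   (dot (nu y.1 y.2) (u y.1) + tau * dot (nu y.1 y.2) (nu y.1 y.2))).
pose psi w := expR (12 * s' * sample_variance k) * expR (s * pot k p w).
have mxi q b c : U (q, b, c) -> measurable_fun [set: history X U] (xi q b c).
  by move=> Uq; exact: (measurable_sample_history (X := X) Uq).
have mxk q b c : (q <= k)%N -> measurable_fun [set: history X U] (xi q b c).
  by move=> qk; apply: mxi; left.
have mxp s2 : s2 \in p -> measurable_fun [set: history X U] (xi k.+1 s2.1 s2.2).
  by move=> sp; apply: mxi; right; rewrite /= -surjective_pairing.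
have mpotH : measurable_fun [set: history X U] (pot k p).
  exact: (measurable_potential bW Q al r gamma_gt0 f_sc (oracle_measurable oracle)).
have mq : measurable_vec (fun w : history X U => m%:R *: query bW al r G xi k w t.1).
  by apply: measurable_vecZl; apply: (measurable_query bW al r (oracle_measurable oracle)).
have mbn := measurable_batch_noise bW al r gamma_gt0 f_sc (oracle_measurable oracle) mxk mxp.
have mu : measurable_vec u.
  apply: measurable_vecZl => b; under eq_fun do rewrite mxE.
  move: (mxvec_index _ _); apply: measurable_vecD.
    apply: measurable_vec_mulmx; apply: measurable_vecD.
      apply: measurable_vecB; first exact: measurable_vec_cst.
      exact: (measurable_dual_iterate bW Q al r (oracle_measurable oracle)).
    by apply: measurable_vecZl; exact: measurable_vec_mulmx.
  apply: measurable_vecZl; apply: measurable_vecD => //.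
  exact: (measurable_noise_total bW al r gamma_gt0 f_sc (oracle_measurable oracle)).
have mfst k' (V : history X U -> 'cV[R]_k') : measurable_vec V ->
    measurable_vec (fun y : history X U * Xi => V y.1).
  by move=> mV b; apply: (measurableT_comp (mV b)); exact: measurable_fst.
have mnu : measurable_vec (fun y : history X U * Xi => nu y.1 y.2).
  have mq1 := mfst _ _ mq.
  apply: measurable_vecB.
    exact: (measurable_oracle (oracle_measurable oracle) t.1 mq1 measurable_snd).
  exact: (measurable_grad_conjugate gamma_gt0 f_sc t.1 mq1).
have mpot1 : measurable_fun setT (fun y : history X U * Xi => pot k p y.1).
  exact: (measurableT_comp mpotH measurable_fst).
have mphi : measurable_fun setT phi.
  apply: measurableT_comp; first exact: measurable_expR.
  apply: measurable_funD; first exact: (measurable_funM (measurable_cst s') mpot1).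
  apply: measurable_funD; first exact: (measurable_dot mnu (mfst _ _ mu)).
  exact: (measurable_funM (measurable_cst tau) (measurable_dot mnu mnu)).
have mpsi : measurable_fun setT psi.
  apply: measurable_funM => //; apply: measurableT_comp => //.
  exact: (measurable_funM (measurable_cst s) (mpot k p)).
have mexp c q : measurable_fun setT (fun w => expR (c * pot k q w)).
  apply: measurableT_comp; first exact: measurable_expR.
  exact: (measurable_funM (measurable_cst c) (mpot k q)).
have mpair : measurable_fun setT (fun w : Omega => (w : history X U, X j w)).
  by apply: measurable_fun_pair => //; exact: measurable_history_id.
apply: (@le_trans _ _ (\int[P]_w (phi (w, X j w))%:E)%E).
  apply: ge0_le_integral => //.
  - by apply/measurable_EFinP; exact: mexp.
  - by apply/measurable_EFinP; exact: (measurableT_comp mphi mpair).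
  - move=> w _; rewrite lee_fin ler_expR.
    have H : pot k (t :: p) w <= pot k p w + (dot (nu w (X j w)) (a k *:
        blockv (potential_gradient f bW Q lmax lamstar al r G xi k p w) t.1)
      + 2 * lmax * a k ^+ 2 * dot (nu w (X j w)) (nu w (X j w))).
      exact: potential_cons_le.
    apply: le_trans (ler_wpM2l s0 H) _.
    rewrite le_eqVlt; apply/orP; left; apply/eqP.
    by rewrite /= /u /tau !dotZr; ring.
apply: (@le_trans _ _ (\int[P]_w (psi w)%:E)%E).
  apply: (freezing_le mX (sample_independent oracle) Uj mphi _ mpsi) => [y|w].
    exact: expR_ge0.
  have E w' : (phi (w, X j w'))%:E = ((expR (s' * pot k p w))%:E *
      (expR (dot (nu w (X j w')) (u w) +
             tau * dot (nu w (X j w')) (nu w (X j w'))))%:E)%E.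
    by rewrite -EFinM -expRD.
  under eq_integral do rewrite E.
  have mnu' : measurable_vec (fun w' => nu w (X j w')).
    apply: measurable_vecB; last exact: measurable_vec_cst.
    exact: (measurable_oracle (oracle_measurable oracle) t.1
      (measurable_vec_cst (m%:R *: query bW al r G xi k w t.1)) (mX j)).
  rewrite ge0_integralZl_EFin ?expR_ge0 //; last first.
    apply/measurable_EFinP; apply: measurableT_comp; first exact: measurable_expR.
    apply: measurable_funD; first exact: (measurable_dot mnu' (measurable_vec_cst (u w))).
    exact: (measurable_funM (measurable_cst tau) (measurable_dot mnu' mnu')).
  have taus : 2 * tau * sigma ^+ 2 <= 1.
    by move: s1; rewrite /tau /sample_variance; lra.
  have H := sample_exp_le k.+1 t.1 t.2 (m%:R *: query bW al r G xi k w t.1)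
    (u w) tau0 taus.
  have exp0 : (0 <= (expR (s' * pot k p w))%:E)%E by rewrite lee_fin expR_ge0.
  apply: le_trans (lee_wpmul2l exp0 H) _.
  rewrite -EFinM -expRD lee_fin /psi -expRD ler_expR.
  have g1 : dot (potential_gradient f bW Q lmax lamstar al r G xi k p w)
      (potential_gradient f bW Q lmax lamstar al r G xi k p w) <= 8 * lmax * pot k p w.
    exact: (potential_gradient_le m_gt0 gamma_gt0 lmax_gt0 f_sc Qsym QQ Q_le XsP lamP).
  have g0 : 0 <= pot k p w.
    exact: (potential_ge0 m_gt0 gamma_gt0 lmax_gt0 f_sc Qsym QQ Q_le XsP lamP).
  have g2 := le_trans (dot_block_le _ t.1) g1.
  have c0 : 0 <= 24 * sigma ^+ 2 * (s' * a k) ^+ 2.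
    by rewrite mulr_ge0 ?sqr_ge0 // mulr_ge0 ?sqr_ge0.
  have {}g2 := ler_wpM2l c0 g2.
  have {}ss := ler_wpM2r g0 ss; rewrite /exp_const in ss.
  rewrite /u !dotZl !dotZr.
  by move: g2 ss; rewrite /tau /sample_variance; lra.
rewrite le_eqVlt; apply/orP; left; apply/eqP; rewrite -ge0_integralZl_EFin ?expR_ge0 //.
by apply/measurable_EFinP; exact: mexp.
Qed.

Variable V : R.
Hypothesis V_gt0 : 0 < V.

(* [1 / exp_rate] grows with the variance [v] already used; the decrease of the rate
   absorbs the term of the one-step bound that is proportional to the potential. *)
Definition exp_rate v : R := (exp_const R * (V + v))^-1.

Definition used_variance k := \sum_(j < k) (m * r j.+1)%:R * sample_variance j.

(** With [b = V + v] the third inequality is [b * (b + 2 * sv) <= (b + sv) ^+ 2], which explains the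
    reciprocal form of the rate. The 16 is [exp_const R / 12]; the drifts add up to at most [1/16]
    while the used variance is at most [V]. *)
Let exp_rate_step v sv : 0 <= v -> 0 <= sv -> v + sv <= V ->
  [/\ 0 <= exp_rate (v + sv), 4 * exp_rate (v + sv) * sv <= 1,
      exp_rate (v + sv) * (1 + exp_const R * exp_rate (v + sv) * sv) <= exp_rate v &
      12 * exp_rate (v + sv) * sv <= sv / (16 * V)].
Proof.
move=> v0 s0 vV; rewrite /exp_rate addrA; set b := V + v.
have b0 : 0 < b by rewrite ltr_wpDr.
have c0 : 0 < b + sv by rewrite ltr_wpDr.
have K0 := exp_const_gt0 R.
have -> : 12 = exp_const R / 16 by rewrite /exp_const; field.
have K4 : 4 <= exp_const R by rewrite ler_nat.
move: (exp_const R) K0 K4 => K K0 K4; split.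
- by rewrite invr_ge0 mulr_ge0 // ltW.
- rewrite mulrAC ler_pdivrMr ?mulr_gt0 // mul1r.
  by apply: ler_pM => //; rewrite lerDr ltW.
- have -> : (K * (b + sv))^-1 * (1 + K * (K * (b + sv))^-1 * sv) =
     (b + sv + sv) / (K * (b + sv) ^+ 2) by field; rewrite !gt_eqF.
  rewrite ler_pdivrMr ?mulr_gt0 ?exprn_gt0 // ler_pdivlMl ?mulr_gt0 //.
  rewrite -mulrA ler_pM2l //; have := sqr_ge0 sv; lra.
- have -> : K / 16 * (K * (b + sv))^-1 * sv = sv / (16 * (b + sv)).
    by field; rewrite !gt_eqF.
  rewrite ler_wpM2l // lef_pV2 ?posrE ?mulr_gt0 // ler_pM2l //.
  by rewrite /b -addrA lerDl addr_ge0.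
Qed.

Let claim k (p : seq ('I_m * nat)) v :=
  (\int[P]_w (expR (exp_rate v * pot k p w))%:E <=
    (expR (exp_rate 0 * (2^-1 * dot lamstar lamstar) + v / (16 * V)))%:E)%E.

Let claim_cons k p t v : 0 <= v -> v + sample_variance k <= V -> t \notin p ->
  claim k p v -> claim k (t :: p) (v + sample_variance k).
Proof.
move=> v0 vV tp IH; rewrite /claim.
have s0 := sample_variance_ge0 k.
have [e1 e2 e3 e4] := exp_rate_step v0 s0 vV.
apply: le_trans (potential_exp_step tp e1 e2 e3) _.
have exp0 : (0 <= (expR (12 * exp_rate (v + sample_variance k) *
   sample_variance k))%:E)%E by rewrite lee_fin expR_ge0.
apply: le_trans (lee_wpmul2l exp0 IH) _.
rewrite -EFinM -expRD lee_fin ler_expR [(v + _) / _]mulrDl.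
by move: e4; move: (_ / (16 * V)) (12 * _ * _) => q1 q2; lra.
Qed.

Lemma potential_exp_moment k : used_variance k <= V ->
  (\int[P]_w (expR (exp_rate (used_variance k) * pot k [::] w))%:E <=
    (expR (exp_rate 0 * (2^-1 * dot lamstar lamstar)
           + used_variance k / (16 * V)))%:E)%E.
Proof.
elim: k => [|k IH] kV.
  rewrite /used_variance big_ord0 mul0r addr0.
  under eq_integral do rewrite /pot potential0.
  by rewrite integral_cst //= probability_setT mule1.
have usedS : used_variance k.+1 =
   used_variance k + (size (full_batch m r k))%:R * sample_variance k.
  by rewrite /used_variance big_ord_recr /= size_full_batch.
have used0 : 0 <= used_variance k.
  by apply: sumr_ge0 => j _; rewrite mulr_ge0 // sample_variance_ge0.
have kV' : used_variance k <= V.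
  by apply: le_trans kV; rewrite usedS lerDl mulr_ge0 // sample_variance_ge0.
have {}IH := IH kV'.
suff H (p : seq ('I_m * nat)) : uniq p ->
    used_variance k + (size p)%:R * sample_variance k <= V ->
    claim k p (used_variance k + (size p)%:R * sample_variance k).
  have := H _ (full_batch_uniq m r k); rewrite -usedS => /(_ kV).
  have E : pot k (full_batch m r k) = pot k.+1 [::].
    apply/funext => w.
    exact: (potential_full f bW Q al G xi lmax lamstar w (r_gt0 k.+1)).
  by rewrite /claim E.
elim: p => [|t p IHp] /=; first by rewrite mul0r addr0.
move=> /andP[tp up]; rewrite -natr1 mulrDl mul1r addrA => pV.
have v0 : 0 <= used_variance k + (size p)%:R * sample_variance k.
  by rewrite addr_ge0 // mulr_ge0 // sample_variance_ge0.
apply: claim_cons => //; apply: IHp => //.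
by apply: le_trans pV; rewrite lerDl sample_variance_ge0.
Qed.

End Supermartingale.

(** * Conclusion on the good event *)

Section TailBound.
Context {d : measure_display} {T : measurableType d} {R : realType}.
Variables (P : probability T R) (Z : T -> R).
Hypothesis mZ : measurable_fun setT Z.

Lemma exp_moment_tail (s b t : R) : 0 <= s ->
  (\int[P]_w (expR (s * Z w))%:E <= (expR b)%:E)%E ->
  ((1 - expR (b - s * t))%:E <= P [set w | (Z w <= t)%R])%E.
Proof.
move=> s0 H.
have mE : measurable [set w | Z w <= t].
  have -> : [set w | Z w <= t] = Z @^-1` `]-oo, t].
    by apply/seteqP; split => w /=; rewrite in_itv.
  by rewrite -[X in measurable X]setTI; exact: mZ.
have mexp : measurable_fun setT (fun w => expR (s * Z w)).
  apply: measurableT_comp; first exact: measurable_expR.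
  exact: (measurable_funM (measurable_cst s) mZ).
have PC : (P (~` [set w | (Z w <= t)%R]) <= (expR (b - s * t))%:E)%E.
  have e0 : (0 < (expR (s * t))%:E)%E by rewrite lte_fin expR_gt0.
  rewrite -(lee_pmul2l _ e0) // -EFinM -expRD subrKC.
  apply: le_trans H; rewrite -integral_cst; last exact: measurableC.
  apply: (@le_trans _ _ (\int[P]_(w in ~` [set w | (Z w <= t)%R]) (expR (s * Z w))%:E)%E).
    apply: ge0_le_integral => //; [exact: measurableC|by move=> w _; rewrite lee_fin expR_ge0|..]. 
    - by apply/measurable_EFinP; apply: measurable_funTS.
    - move=> w /negP; rewrite -ltNge => h; rewrite lee_fin ler_expR.
      by rewrite ler_wpM2l // ltW.
  apply: ge0_subset_integral => //; first exact: measurableC.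
  exact/measurable_EFinP.
have -> : P [set w | Z w <= t] = (1 - P (~` [set w | (Z w <= t)%R]))%E.
  by rewrite -probability_setC ?setCK //; exact: measurableC.
by rewrite EFinB; apply: leeB.
Qed.

End TailBound.

Section GoodEvent.
Variables (R : realType) (m n : nat).
Variables (f : 'I_m -> 'cV[R]_n -> R) (Q : 'M[R]_(m * n)).
Variables (lmax M rho eps A S : R) (xstar : 'cV[R]_n).
Variables (lamstar z xhat Y : 'cV[R]_(m * n)) (gamma ns : R).
Let Xs : 'cV[R]_(m * n) := stack (fun=> xstar).
Hypotheses (m_gt0 : (0 < m)%N) (gamma_gt0 : 0 < gamma) (lmax_gt0 : 0 < lmax).
Hypotheses (M_gt0 : 0 < M) (eps_gt0 : 0 < eps) (S_gt0 : 0 < S) (rho_gt0 : 0 < rho).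
Hypothesis AE : A = S * eps.
Hypothesis A_ge : 16 * M ^+ 2 <= m%:R * lmax * A.
Hypothesis Q_le : forall y, dot (Q *m y) (Q *m y) <= lmax * dot y y.
Hypothesis f_lip : forall i u d, enorm (u - xstar) <= rho -> enorm d <= rho ->
  f i (u + d) - f i u <= 2 * M * enorm d.
Hypothesis eps_le1 : m%:R * eps <= 4 * gamma * rho ^+ 2.
Hypothesis eps_le2 : m%:R * eps ^+ 2 <= 128 * M ^+ 2 * rho ^+ 2.
Hypothesis pot_le :
  2^-1 * dot lamstar lamstar + ns + lmax * dot Y Y <= A / 8.
Hypothesis gap : S * (primal f xhat - primal f Xs) <= ns - dot lamstar (Q *m Y).
Hypothesis xhat_close : S * (gamma / (2 * m%:R) * dot (xhat - Xs) (xhat - Xs)) <=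
  2^-1 * dot lamstar lamstar + ns.
Hypothesis z_close : 2^-1 * dot (z - lamstar) (z - lamstar) <=
  2^-1 * dot lamstar lamstar + ns.

Let mR_gt0 : 0 < m%:R :> R. Proof. by rewrite ltr0n. Qed.

Let A_gt0 : 0 < A. Proof. by rewrite AE mulr_gt0. Qed.

(** The last dual iterate is [- S] times [Q] applied to the output, so bounding it bounds the
    constraint violation. *)
Lemma good_event_feasibility (R_lam : R) : 0 < R_lam -> enorm lamstar <= R_lam ->
  16 * R_lam ^+ 2 <= A -> enorm z <= A / R_lam.
Proof.
move=> R0 lR RA.
have Y0 := mulr_ge0 (ltW lmax_gt0) (dot_ge0 Y).
have l2 : dot lamstar lamstar <= R_lam ^+ 2 by rewrite -enorm_le // ltW.
rewrite enorm_le; last by rewrite divr_ge0 // ltW.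
(* [|z|^2 <= 2 |z - lamstar|^2 + 2 |lamstar|^2 <= A / 2 + A / 8]. *)
have h1 : dot z z <= 5 / 8 * A.
  have := dot_ge0 (z - 2 *: lamstar); rewrite !dotE.
  by move: z_close pot_le; rewrite !dotE (dotC z lamstar); lra.
apply: le_trans h1 _; rewrite exprMn exprVn ler_pdivlMr ?exprn_gt0 //.
by rewrite expr2; nra.
Qed.

(** The budget is [eps / 8] for the average of exact gradients and [(1/2 + 1/64) * eps] for the
    shift [D]. The conditions [eps_le1] and [eps_le2] are what places that average and the shift
    within [rho]. *)
Lemma good_event_suboptimality :
  primal f (xhat + S^-1 *: Y) - primal f Xs <= eps.
Proof.
have Y0 := dot_ge0 Y.
have gap' : primal f xhat - primal f Xs <= eps / 8.
  rewrite -(ler_pM2l S_gt0); apply: le_trans gap _.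
  have := dot_ge0 (lamstar + Q *m Y); rewrite !dotE (dotC (Q *m Y) lamstar).
  have := Q_le Y; have := mulr_ge0 (ltW lmax_gt0) Y0.
  by move: pot_le; rewrite AE; lra.
pose D := S^-1 *: Y.
(* By [z_close] the rest of the potential is nonnegative, so its [Y] term alone is at most
   [A / 8]. *)
have DD : 8 * lmax * S ^+ 2 * dot D D <= A.
  have -> : 8 * lmax * S ^+ 2 * dot D D = 8 * lmax * dot Y Y.
    by rewrite /D !dotE; field; rewrite gt_eqF.
  move: pot_le; have := dot_ge0 (z - lamstar); move: z_close; lra.
have DD' : 128 * M ^+ 2 * dot D D <= m%:R * eps ^+ 2.
  have D0 := dot_ge0 D.
  have h1 : 16 * M ^+ 2 * (8 * dot D D * S) <= m%:R * lmax * A * (8 * dot D D * S).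
    by rewrite ler_wpM2r // !mulr_ge0 // ltW.
  have h2 : eps * m%:R * (8 * lmax * S ^+ 2 * dot D D) <= eps * m%:R * A.
    by rewrite ler_pM2l // mulr_gt0.
  have h3 : S * (128 * M ^+ 2 * dot D D) <= S * (m%:R * eps ^+ 2).
    by move: h1 h2; rewrite AE; lra.
  by rewrite ler_pM2l in h3.
have Drho i : enorm (blockv D i) <= rho.
  rewrite enorm_le ?(ltW rho_gt0) //; apply: le_trans (dot_block_le D i) _.
  rewrite -(ler_pM2l (x := 128 * M ^+ 2)) ?mulr_gt0 ?exprn_gt0 //.
  exact: le_trans DD' eps_le2.
have xrho i : enorm (blockv xhat i - xstar) <= rho.
  rewrite enorm_le ?(ltW rho_gt0) //.
  have -> : blockv xhat i - xstar = blockv (xhat - Xs) i.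
    by rewrite blockvD blockvN blockv_stack.
  apply: le_trans (dot_block_le _ i) _.
  have h1 : S * (gamma / (2 * m%:R) * dot (xhat - Xs) (xhat - Xs)) <= S * (eps / 8).
    apply: le_trans xhat_close _; have := mulr_ge0 (ltW lmax_gt0) Y0.
    by move: pot_le; rewrite AE; lra.
  rewrite ler_pM2l // in h1.
  have c0 : 0 < gamma / (2 * m%:R) by rewrite divr_gt0 // mulr_gt0.
  rewrite -(ler_pM2l c0); apply: le_trans h1 _.
  have -> : gamma / (2 * m%:R) * rho ^+ 2 = 4 * gamma * rho ^+ 2 / (8 * m%:R).
    by field; rewrite gt_eqF.
  by rewrite ler_pdivlMr ?mulr_gt0 //; move: eps_le1; lra.
suff H : primal f (xhat + D) - primal f xhat <= 7 / 8 * eps by lra.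
rewrite /primal -mulrBr -sumrB mulrC ler_pdivrMr //.
(* AM-GM: [2 M t <= eps / 2 + 2 M^2 t^2 / eps]. *)
apply: (@le_trans _ _ (\sum_(i < m)
    (eps / 2 + 2 * M ^+ 2 / eps * dot (blockv D i) (blockv D i)))).
  apply: ler_sum => i _; rewrite blockvD; apply: le_trans (f_lip i (xrho i) (Drho i)) _.
  rewrite -enorm_sq; have := sqr_ge0 (eps - 2 * M * enorm (blockv D i)) => h.
  have -> : eps / 2 + 2 * M ^+ 2 / eps * enorm (blockv D i) ^+ 2 =
    2 * M * enorm (blockv D i) + (eps - 2 * M * enorm (blockv D i)) ^+ 2 / (2 * eps).
    by field; rewrite gt_eqF.
  by rewrite lerDl divr_ge0 // mulr_ge0 // ltW.
have DE : \sum_(i < m) 2 * M ^+ 2 / eps * dot (blockv D i) (blockv D i) =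
    2 * M ^+ 2 / eps * dot D D by rewrite -mulr_sumr -dot_blockv.
rewrite big_split /= DE sumr_const card_ord -[_ *+ m]mulr_natl.
have : 2 * M ^+ 2 / eps * dot D D <= m%:R * eps / 64.
  rewrite mulrAC ler_pdivrMr //; move: DD'; rewrite expr2; lra.
have : 0 < m%:R * eps by rewrite mulr_gt0.
by lra.
Qed.

End GoodEvent.

(** * Batch sizes, variance spent and oracle calls *)

Section BatchSize.
Variable R : realType.

Lemma nat_ceil_bounds (x : R) : 0 <= x ->
  x <= (nat_ceil x)%:R /\ (nat_ceil x)%:R <= x + 1.
Proof.
move=> x0; rewrite /nat_ceil natr_absz ger0_norm; last first.
  by rewrite -(ler_int R) (le_trans x0) // ceil_ge.
split; first exact: ceil_ge.
by rewrite -lerBlDr ltW //; have := ceilB1_lt x; rewrite intrB.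
Qed.

Variables (m : nat) (c gamma lmax sigma eps alpha : R) (N : nat) (al : nat -> R).
Hypotheses (m_gt0 : (0 < m)%N) (gamma_gt0 : 0 < gamma) (lmax_gt0 : 0 < lmax).
Hypotheses (c_gt0 : 0 < c) (sigma_gt0 : 0 < sigma) (eps_gt0 : 0 < eps).
Hypothesis alP : step_sizes (m%:R * lmax / gamma) al.
Hypothesis ell_gt0 : 0 < ln (N%:R / alpha).

Let ell := ln (N%:R / alpha).
Let sigma2 := c * (lmax * m%:R * sigma ^+ 2).
Let r := batch_size sigma2 eps alpha N al.

Let mR_gt0 : 0 < m%:R :> R. Proof. by rewrite ltr0n. Qed.

Let K_gt0 : 0 < 50 * sigma2.
Proof. by rewrite !mulr_gt0 // exprn_gt0. Qed.

Let batch_ge0 k : 0 <= 50 * sigma2 * al k * ell / eps.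
Proof.
rewrite divr_ge0 ?(ltW eps_gt0) // mulr_ge0 ?(ltW ell_gt0) // mulr_ge0 ?(ltW K_gt0) //.
exact: step_size_ge0 alP k.
Qed.

Lemma batch_size_gt0 k : (0 < r k)%N.
Proof. by rewrite /r /batch_size leq_max. Qed.

(** A batch proportional to [al] turns the variance [al ^+ 2 / r] of an iteration into a multiple of
    [al], and the steps sum to [partial_sum al k]. *)
Lemma used_variance_le k :
  used_variance m lmax al r sigma k <= partial_sum al k * eps / (50 * c * ell).
Proof.
rewrite (partial_sum_shift alP) !mulr_suml /used_variance.
apply: ler_sum => j _; rewrite /sample_variance /sample_weight natrM.
have a0 : 0 < al j.+1 by exact: step_size_gt0 alP j.
have [H _] := nat_ceil_bounds (batch_ge0 j.+1).
have rj : 50 * sigma2 * al j.+1 * ell / eps <= (r j.+1)%:R.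
  by apply: le_trans H _; rewrite ler_nat /r /batch_size leq_max leqnn orbT.
have r0 : 0 < (r j.+1)%:R :> R by rewrite ltr0n batch_size_gt0.
have -> : m%:R * (r j.+1)%:R * (lmax * (al j.+1 / (r j.+1)%:R) ^+ 2 * sigma ^+ 2) =
   (m%:R * lmax * sigma ^+ 2) * al j.+1 ^+ 2 / (r j.+1)%:R.
  by field; rewrite gt_eqF.
rewrite ler_pdivrMr // -ler_pdivrMl; last by rewrite divr_gt0 ?mulr_gt0.
apply: le_trans rj; rewrite le_eqVlt; apply/orP; left; apply/eqP.
by rewrite /sigma2; field; rewrite !gt_eqF.
Qed.

(** The 2 per iteration pays for rounding up and for the maximum with 1. *)
Lemma oracle_calls_le : (oracle_calls r N)%:R <=
  2 * N%:R + 50 * sigma2 * ell / eps * partial_sum al N.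
Proof.
rewrite (partial_sum_shift alP) mulr_sumr /oracle_calls natr_sum.
have -> : 2 * N%:R = \sum_(j < N) (2 : R).
  by rewrite sumr_const card_ord mulr_natr.
rewrite -big_split; apply: ler_sum => j _ /=.
have [_ H] := nat_ceil_bounds (batch_ge0 j.+1).
have E : 50 * sigma2 * ell / eps * al j.+1 = 50 * sigma2 * al j.+1 * ell / eps by ring.
rewrite E; have b0 := batch_ge0 j.+1.
apply: (@le_trans _ _ (1 + (nat_ceil (50 * sigma2 * al j.+1 * ell / eps))%:R)).
  by rewrite nat1r ler_nat /r /batch_size geq_max ltn0Sn leqnSn.
by move: b0 H; move: (_ / eps) => b; lra.
Qed.

End BatchSize.

Lemma finite_lower_bound (R : realType) (m : nat) (F : 'I_m -> R) :
  (forall i, 0 < F i) -> exists2 rho, 0 < rho & forall i, rho <= F i.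
Proof.
move=> F0; exists (1 + \sum_i (F i)^-1)^-1.
  by rewrite invr_gt0 ltr_wpDr // sumr_ge0 // => i _; rewrite invr_ge0 ltW.
move=> i; rewrite -[leRHS]invrK lef_pV2 ?posrE ?invr_gt0 //; last first.
  by rewrite ltr_wpDr // sumr_ge0 // => j _; rewrite invr_ge0 ltW.
rewrite (bigD1 i) //= addrCA lerDl addr_ge0 // sumr_ge0 // => j _.
by rewrite invr_ge0 ltW.
Qed.

Lemma measurable_feasible_event (R : realType) (d : measure_display)
    (T : measurableType d) (m n : nat) (f : 'I_m -> 'cV[R]_n -> R)
    (Q : 'M[R]_(m * n)) (X : T -> 'cV[R]_(m * n)) (a b c : R) :
  (forall i, strongly_convex 0 (f i)) -> measurable_vec X -> 0 <= b ->
  measurable [set w | primal f (X w) - a <= c /\ enorm (Q *m X w) <= b].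
Proof.
move=> fc mX b0.
have m1 : measurable_fun setT (fun w => primal f (X w)).
  apply: (measurable_funM (measurable_cst _)); apply: measurable_sum => i.
  apply: (measurable_locally_lipschitz_comp (convex_locally_lipschitz (fc i))).
  by move=> a'; under eq_fun do rewrite mxE; exact: mX.
have m2 : measurable_fun setT (fun w => dot (Q *m X w) (Q *m X w)).
  by apply: measurable_dot; exact: measurable_vec_mulmx.
have -> : [set w | primal f (X w) - a <= c /\ enorm (Q *m X w) <= b] =
    ((fun w => primal f (X w)) @^-1` `]-oo, c + a]) `&`
    ((fun w => dot (Q *m X w) (Q *m X w)) @^-1` `]-oo, b ^+ 2]).
  by apply/seteqP; split => w /=; rewrite !in_itv /= lerBlDr enorm_le.
apply: measurableI; rewrite -[X in measurable X]setTI; [exact: m1|exact: m2].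
Qed.

(** * Choice of constants and assembly *)

Section Assembly.
Context {R : realType} {dO dX : measure_display}.
Context {Omega : measurableType dO} {Xi : measurableType dX}.
Variables (P : probability Omega R) (m n : nat).
Variables (f : 'I_m -> 'cV[R]_n -> R) (bW Q : 'M[R]_(m * n)).
Variables (gamma lmin lmax kappa M R_lam rho eps rate sigma alpha : R).
Variables (xstar : 'cV[R]_n) (lamstar : 'cV[R]_(m * n)) (al : nat -> R).
Variables (G : 'I_m -> 'cV[R]_n -> Xi -> 'cV[R]_n).
Variables (xi : nat -> 'I_m -> nat -> Omega -> Xi).

(** Makes the lower bound [(exp_const R * (2 * V))^-1] for the final rate, times the threshold
    [A / 8], equal to [4 * ell]; 50 is the constant of the batch rule. *)
Definition c_sigma : R := 64 * exp_const R / 50.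
(** Since [S] is at least [N^2 gamma / (8 m lmax)], this yields [m lmin A >= 18 (1 + kappa)^2 M^2].
    The [kappa] covers [16 * R_lam ^+ 2], the summand 1 covers [16 * M ^+ 2]. *)
Definition c_iter : R := 12 * (1 + kappa).
Definition c_calls : R := 2 * (c_iter + 1) + 25 * c_sigma * (c_iter + 1) ^+ 2.

Let Xs : 'cV[R]_(m * n) := stack (fun=> xstar).
Let N := nat_ceil (c_iter * rate).
Let sigma2 := c_sigma * (lmax * m%:R * sigma ^+ 2).
Let r := batch_size sigma2 eps alpha N al.
Let xN w := output bW al r (answers G xi w) N.
Let ell := ln (N%:R / alpha).
Let S := partial_sum al N.

Hypotheses (m_gt0 : (0 < m)%N) (gamma_gt0 : 0 < gamma).
Hypotheses (lmin_gt0 : 0 < lmin) (lmin_max : lmin <= lmax) (kappa_gt0 : 0 < kappa).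
Hypotheses (M_gt0 : 0 < M) (rho_gt0 : 0 < rho) (eps_gt0 : 0 < eps).
Hypotheses (sigma_gt0 : 0 < sigma) (alpha01 : 0 < alpha < 1).
Hypothesis f_sc : forall i, strongly_convex gamma (f i).
Hypotheses (Qsym : Q^T = Q) (QQ : Q *m Q = bW).
Hypothesis Q_le : forall y, dot (Q *m y) (Q *m y) <= lmax * dot y y.
Hypotheses (XsP : primal_solution f Q Xs) (lamP : dual_solution f Q lamstar).
Hypotheses (R_gt0 : 0 < R_lam) (lam_le : enorm lamstar <= R_lam).
Hypothesis R_le : R_lam ^+ 2 <= kappa ^+ 2 * (M ^+ 2 / (m%:R * lmin)).
Hypothesis f_lip : forall i u d, enorm (u - xstar) <= rho -> enorm d <= rho ->
  f i (u + d) - f i u <= 2 * M * enorm d.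
Hypothesis rate_ge : 2 <= rate.
Hypothesis rate_sq : rate ^+ 2 = M ^+ 2 / (gamma * eps) * (lmax / lmin).
Hypothesis eps_le1 : m%:R * eps <= 4 * gamma * rho ^+ 2.
Hypothesis eps_le2 : m%:R * eps ^+ 2 <= 128 * M ^+ 2 * rho ^+ 2.
Hypothesis alP : step_sizes (m%:R * lmax / gamma) al.
Hypothesis oracle : stochastic_dual_oracle P f sigma G xi.

Let mR_gt0 : 0 < m%:R :> R. Proof. by rewrite ltr0n. Qed.

Let lmax_gt0 : 0 < lmax. Proof. exact: lt_le_trans lmin_max. Qed.

Let L_gt0 : 0 < m%:R * lmax / gamma.
Proof. by rewrite divr_gt0 // mulr_gt0. Qed.

Let c_gt0 : 0 < c_sigma.
Proof. by rewrite divr_gt0 // mulr_gt0 // exp_const_gt0. Qed.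

Let ci_ge : 12 <= c_iter. Proof. by rewrite /c_iter ler_peMr // lerDl ltW. Qed.

Let ci_gt0 : 0 < c_iter. Proof. exact: lt_le_trans ci_ge. Qed.

Let rate_gt0 : 0 < rate. Proof. exact: lt_le_trans rate_ge. Qed.

Let cr_ge0 : 0 <= c_iter * rate. Proof. by rewrite mulr_ge0 // ltW. Qed.

Let N_bounds : c_iter * rate <= N%:R /\ N%:R <= (c_iter + 1) * rate.
Proof.
have [H1 H2] := nat_ceil_bounds cr_ge0; split => //.
by apply: le_trans H2 _; rewrite mulrDl mul1r lerD2l; apply: le_trans rate_ge; lra.
Qed.

Let N_ge2 : 2 <= N%:R :> R.
Proof.
by case: N_bounds => H _; apply: le_trans H; have := ci_ge; have := rate_ge; nra.
Qed.

Let ell_ge : 2^-1 - ln alpha <= ell /\ 2^-1 <= ell.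
Proof.
have /andP[a0 a1] := alpha01.
have N0 : 0 < N%:R :> R by apply: lt_le_trans N_ge2.
rewrite /ell lnM ?posrE ?invr_gt0 // lnV ?posrE //.
have h : 2^-1 <= ln (N%:R : R).
  rewrite -[leLHS]expRK ler_ln ?posrE ?expR_gt0 //; apply: le_trans N_ge2.
  have := expR_gt0 (2^-1 : R); have := expR_ge1Dx (- 2^-1 : R).
  have : expR (2^-1 : R) * expR (- 2^-1) = 1 by rewrite -expRD subrr expR0.
  by nra.
have : ln alpha < 0 by rewrite ln_lt0 // a0.
by split; lra.
Qed.

Let ell_gt0 : 0 < ell. Proof. by case: ell_ge => _; apply: lt_le_trans; rewrite invr_gt0. Qed.

Let N_gt0 : (0 < N)%N.
Proof. by rewrite -(ltr_nat R); apply: lt_le_trans N_ge2. Qed.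

Let S_gt0 : 0 < S.
Proof. by rewrite /S -(prednK N_gt0); exact: partial_sum_gt0 alP _. Qed.

Let A := S * eps.

Let A_ge : 16 * (1 + kappa) ^+ 2 * M ^+ 2 <= m%:R * lmin * A.
Proof.
have [H1 _] := partial_sum_bounds L_gt0 alP N; rewrite -/S in H1.
have [H2 _] := N_bounds.
have H3 : (c_iter * rate) ^+ 2 <= 8 * (m%:R * lmax / gamma) * S.
  by apply: le_trans H1; rewrite ler_pXn2r ?nnegrE.
have : c_iter ^+ 2 * M ^+ 2 <= 8 * (m%:R * lmin * A).
  have c0 : 0 < lmax / (gamma * eps * lmin) by rewrite divr_gt0 // !mulr_gt0.
  rewrite -(ler_pM2r c0).
  have -> : c_iter ^+ 2 * M ^+ 2 * (lmax / (gamma * eps * lmin)) = (c_iter * rate) ^+ 2.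
    by rewrite [RHS]exprMn rate_sq; field; rewrite !gt_eqF.
  apply: le_trans H3 _; rewrite le_eqVlt; apply/orP; left; apply/eqP.
  by rewrite /A; field; rewrite !gt_eqF.
rewrite /c_iter exprMn; have := mulr_ge0 (sqr_ge0 (1 + kappa)) (sqr_ge0 M).
by lra.
Qed.

Let A_gt0 : 0 < A. Proof. by rewrite mulr_gt0. Qed.

Let A_ge_R : 16 * R_lam ^+ 2 <= A.
Proof.
have ml0 : 0 < m%:R * lmin by rewrite mulr_gt0.
rewrite -(ler_pM2l ml0); apply: le_trans A_ge.
have : m%:R * lmin * R_lam ^+ 2 <= kappa ^+ 2 * M ^+ 2.
  apply: le_trans (ler_wpM2l (ltW ml0) R_le) _.
  by rewrite le_eqVlt; apply/orP; left; apply/eqP; field; rewrite !gt_eqF.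
have := mulr_ge0 (ltW kappa_gt0) (sqr_ge0 M); have := sqr_ge0 M.
by lra.
Qed.

Let A_ge_M : 16 * M ^+ 2 <= m%:R * lmax * A.
Proof.
have := mulr_ge0 (ltW kappa_gt0) (sqr_ge0 M).
have := mulr_ge0 (sqr_ge0 kappa) (sqr_ge0 M).
have : m%:R * lmin * A <= m%:R * lmax * A.
  by rewrite ler_pM2r // ler_pM2l.
by move: A_ge; lra.
Qed.

Let V := A / (50 * c_sigma * ell).

Let V_gt0 : 0 < V. Proof. by rewrite divr_gt0 // !mulr_gt0. Qed.

Let variance_le : used_variance m lmax al r sigma N <= V.
Proof. exact: (used_variance_le m_gt0 lmax_gt0 c_gt0 sigma_gt0 eps_gt0 alP ell_gt0). Qed.

Let pot w := potential f bW Q al r G xi lmax lamstar N [::] w.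

(** The tail exponent is at most [2 * ell + 1/16 - 4 * ell]: the initial potential at the initial
    rate, the accumulated drift, and the threshold at a rate still at least half the initial one.
    The two bounds of [ell_ge] bring this below [ln alpha]. *)
Lemma good_event_probability :
  ((1 - alpha)%:E <= P [set w | (pot w <= A / 8)%R])%E.
Proof.
have /andP[a0 a1] := alpha01.
have mpot : measurable_fun setT pot.
  apply: (measurable_potential bW Q al r gamma_gt0 f_sc (oracle_measurable oracle)) => //.
  by move=> *; exact: (sample_measurable oracle).
have r_gt0 k : (0 < r k)%N by exact: batch_size_gt0.
have H := potential_exp_moment m_gt0 gamma_gt0 lmax_gt0 f_sc Qsym QQ Q_le XsP lamP
  alP r_gt0 sigma_gt0 oracle V_gt0 variance_le.
have vV := variance_le; set v := used_variance _ _ _ _ _ _ in vV H.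
have v0 : 0 <= v.
  by apply: sumr_ge0 => j _; rewrite mulr_ge0 // sample_variance_ge0.
have h0 := exp_const_gt0 R.
have s0 : 0 <= exp_rate V v.
  by rewrite invr_ge0 mulr_ge0 ?(ltW h0) // addr_ge0 // ltW.
have tail := exp_moment_tail mpot (A / 8) s0 H.
apply: le_trans tail; rewrite lee_fin lerD2l lerN2.
rewrite -[leRHS](lnK a0) ler_expR.
have hV : 0 < exp_const R * (V + v) by rewrite mulr_gt0 // ltr_wpDr.
have h2V : 0 < exp_const R * (2 * V) by rewrite mulr_gt0 // mulr_gt0.
have s1 : (exp_const R * (2 * V))^-1 <= exp_rate V v.
  rewrite /exp_rate lef_pV2 ?posrE // ler_pM2l //.
  by rewrite [leRHS]mulr_natl mulr2n lerD2l.
have s2 : (exp_const R * (2 * V))^-1 * (A / 8) <= exp_rate V v * (A / 8).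
  by rewrite ler_wpM2r // divr_ge0 // ltW.
have l2 : dot lamstar lamstar <= R_lam ^+ 2 by rewrite -enorm_le // ltW.
have b1 : exp_rate V 0 * (2^-1 * dot lamstar lamstar) <=
    (exp_const R * V)^-1 * (2^-1 * (A / 16)).
  rewrite /exp_rate addr0; apply: ler_wpM2l.
    by rewrite invr_ge0 ltW // mulr_gt0.
  rewrite ler_pM2l ?invr_gt0 // ler_pdivlMr // mulrC.
  by apply: le_trans A_ge_R; rewrite ler_pM2l.
have b2 : v / (16 * V) <= 16^-1.
  have V16 : 0 < 16 * V by rewrite mulr_gt0.
  by rewrite ler_pdivrMr // mulrA mulVf ?mul1r // pnatr_eq0.
have E1 : (exp_const R * (2 * V))^-1 * (A / 8) = 4 * ell.
  by rewrite /V /c_sigma; field; rewrite !gt_eqF.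
have E2 : (exp_const R * V)^-1 * (2^-1 * (A / 16)) = 2 * ell.
  by rewrite /V /c_sigma; field; rewrite !gt_eqF.
rewrite E1 in s2; rewrite E2 in b1.
have [e1 e2] := ell_ge.
move: (exp_rate V v * _) (exp_rate V 0 * _) (v / _) s2 b1 b2 e1 e2 => x y t.
by move: (ell) (ln alpha) => p q; lra.
Qed.

Lemma good_event_conclusion w : pot w <= A / 8 ->
  primal f (xN w) - primal f Xs <= eps /\ enorm (Q *m xN w) <= eps / R_lam.
Proof.
move=> potw.
pose d j := grad_noise f bW al r G xi j w.
pose z k := dual_iterate bW Q al r G xi k w.
pose x k := primal_argmax f (Q *m dual_query bW Q al r G xi k w).
pose xhat := S^-1 *: \sum_(j < N) al j.+1 *: x j.
pose Y := \sum_(j < N) d j.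
have al0 : al 0%N = 0 by case: alP.
have sE j : al j.+1 *: sampled_grad bW al r G xi j w = al j.+1 *: x j + d j.
  by rewrite /d /grad_noise scalerBr (exact_grad_argmax f _ _ _ _ QQ) subrKC.
have xNE : xN w = xhat + S^-1 *: Y.
  rewrite /xN output_sum // /xhat /Y -scalerDr -big_split; congr (_ *: _).
  by apply: eq_bigr => j _; exact: sE.
have zE : z N = - (S *: (Q *m xN w)).
  rewrite /z /dual_iterate /xN output_sum // scalemxAr scalerA divff ?scale1r //.
  by rewrite gt_eqF.
have [gap close] : S * (primal f xhat - primal f Xs) <=
    noise_sum Q lamstar z d N - dot lamstar (Q *m Y) /\
    S * (gamma / (2 * m%:R) * dot (xhat - Xs) (xhat - Xs)) <=
    2^-1 * dot lamstar lamstar + noise_sum Q lamstar z d N.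
  have := primal_average_gap m_gt0 gamma_gt0 lmax_gt0 f_sc Qsym Q_le XsP lamP alP
    (dual_iterate0 bW Q al r G xi w) (dual_iterateE f QQ al r G xi w)
    (dual_queryE bW Q r alP G xi w) (dual_averageE bW Q r alP G xi w) N.-1.
  by rewrite (prednK N_gt0).
have zclose : 2^-1 * dot (z N - lamstar) (z N - lamstar) <=
    2^-1 * dot lamstar lamstar + noise_sum Q lamstar z d N.
  exact: (dual_iterate_distance m_gt0 gamma_gt0 lmax_gt0 f_sc Qsym QQ Q_le XsP lamP).
have potw' : 2^-1 * dot lamstar lamstar + noise_sum Q lamstar z d N +
    lmax * dot Y Y <= A / 8 by move: potw; rewrite /pot potential_nil.
split.
  rewrite xNE.
  exact: (good_event_suboptimality m_gt0 gamma_gt0 lmax_gt0 M_gt0 eps_gt0 S_gt0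
    rho_gt0 (erefl A) A_ge_M Q_le f_lip eps_le1 eps_le2 potw' gap close zclose).
have := good_event_feasibility lmax_gt0 eps_gt0 S_gt0 (erefl A) potw' zclose
  R_gt0 lam_le A_ge_R.
rewrite zE enormN enormZ gtr0_norm // /A -mulrA ler_pM2l //.
Qed.

Lemma success_probability :
  ((1 - 3 * alpha)%:E <= P [set w | (primal f (xN w) - primal f Xs <= eps)%R /\
    (enorm (Q *m xN w) <= eps / R_lam)%R])%E.
Proof.
have /andP[a0 a1] := alpha01.
have al0 : al 0%N = 0 by case: alP.
apply: (@le_trans _ _ (1 - alpha)%:E); first by rewrite lee_fin; lra.
apply: le_trans good_event_probability _.
have mpot : measurable_fun setT pot.
  apply: (measurable_potential bW Q al r gamma_gt0 f_sc (oracle_measurable oracle)) => //.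
  by move=> *; exact: (sample_measurable oracle).
apply: le_measure; rewrite ?inE.
- have -> : [set w | pot w <= A / 8] = pot @^-1` `]-oo, A / 8].
    by apply/seteqP; split => w /=; rewrite in_itv.
  by rewrite -[X in measurable X]setTI; exact: mpot.
- apply: measurable_feasible_event.
  + by move=> i; exact: strongly_convexW (ltW gamma_gt0) (f_sc i).
  + have -> : xN = fun w => S^-1 *: \sum_(k < N) al k.+1 *: sampled_grad bW al r G xi k w.
      by apply/funext => w; rewrite /xN output_sum.
    apply: measurable_vecZl; apply: measurable_vec_sum => k; apply: measurable_vecZl.
    apply: (measurable_sampled_grad bW al r (oracle_measurable oracle)) => *.
    exact: (sample_measurable oracle).
  + by rewrite divr_ge0 // ltW.
- by move=> w; exact: good_event_conclusion.
Qed.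

(** The batch part is proportional to [S], at most [gamma N^2 / (2 m lmax)]; this cancels [m lmax]
    in the variance, and [rate ^+ 2] supplies the missing [M ^+ 2 / (gamma * eps)] and the condition
    number. *)
Lemma oracle_complexity : (oracle_calls r N)%:R <=
  c_calls * (1 + ell) *
  Num.max rate (M ^+ 2 * sigma ^+ 2 / eps ^+ 2 * (lmax / lmin)).
Proof.
set T2 := M ^+ 2 * sigma ^+ 2 / eps ^+ 2 * (lmax / lmin).
have T20 : 0 <= T2.
  by rewrite mulr_ge0 ?divr_ge0 ?mulr_ge0 ?sqr_ge0 // ltW.
have H := oracle_calls_le m_gt0 lmax_gt0 c_gt0 sigma_gt0 eps_gt0 alP ell_gt0.
apply: le_trans H _; rewrite -/ell -/S.
have [_ H2] := N_bounds.
have [_ H1] := partial_sum_bounds L_gt0 alP N; rewrite -/S in H1.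
have ci0 : 0 <= (c_iter + 1) * rate by rewrite mulr_ge0 ?addr_ge0 // ltW.
have H3 : 2 * (m%:R * lmax / gamma) * S <= ((c_iter + 1) * rate) ^+ 2.
  by apply: le_trans H1 _; rewrite ler_pXn2r ?nnegrE.
have H4 : 50 * (c_sigma * (lmax * m%:R * sigma ^+ 2)) * ell / eps * S <=
    25 * c_sigma * (c_iter + 1) ^+ 2 * ell * T2.
  have k0 : 0 <= 25 * c_sigma * ell * gamma * sigma ^+ 2 / eps.
    rewrite divr_ge0 ?(ltW eps_gt0) // mulr_ge0 ?sqr_ge0 //.
    by rewrite !mulr_ge0 // ltW.
  apply: le_trans (_ : 25 * c_sigma * ell * gamma * sigma ^+ 2 / eps *
     (2 * (m%:R * lmax / gamma) * S) <= _).
    by rewrite le_eqVlt; apply/orP; left; apply/eqP; field; rewrite !gt_eqF.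
  apply: le_trans (ler_wpM2l k0 H3) _.
  rewrite le_eqVlt; apply/orP; left; apply/eqP.
  by rewrite exprMn rate_sq /T2; field; rewrite !gt_eqF.
have m1 : rate <= Num.max rate T2 by rewrite le_max lexx.
have m2 : T2 <= Num.max rate T2 by rewrite le_max lexx orbT.
move: (Num.max rate T2) m1 m2 => mx m1 m2.
have mx0 : 0 <= mx by apply: le_trans m2.
have k1 : 0 <= 2 * (c_iter + 1) by rewrite mulr_ge0 // addr_ge0 // ltW.
have k2 : 0 <= 25 * c_sigma * (c_iter + 1) ^+ 2.
  by rewrite mulr_ge0 ?sqr_ge0 // mulr_ge0 // ltW.
have H5 : 2 * N%:R <= 2 * (c_iter + 1) * mx.
  by have := ler_wpM2l k1 m1; lra.
have H6 : 25 * c_sigma * (c_iter + 1) ^+ 2 * ell * T2 <=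
    25 * c_sigma * (c_iter + 1) ^+ 2 * (ell * mx).
  by rewrite -mulrA ler_wpM2l // ler_pM2l.
rewrite /c_calls; move: k1 k2 H5 H4 H6.
move: (2 * (c_iter + 1)) (25 * c_sigma * (c_iter + 1) ^+ 2) => p q k1 k2 H5 H4 H6.
have := mulr_ge0 k1 (mulr_ge0 (ltW ell_gt0) mx0); have := mulr_ge0 k2 mx0.
by lra.
Qed.

End Assembly.

Theorem theorem3p2p3 (R : realType) :
  exists2 c_sigma : R, 0 < c_sigma &
  forall kappa : R, 0 < kappa ->
  exists c_N c_T : R, 0 < c_N /\ 0 < c_T /\
  forall (m n : nat) (e : rel 'I_m) (f : 'I_m -> 'cV[R]_n -> R)
    (gamma M R_lam : R) (sqrtW : 'M[R]_(m * n))
    (xstar : 'cV[R]_n) (lamstar : 'cV[R]_(m * n)),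
  let W : 'M[R]_m := laplacian R e in
  let bW : 'M[R]_(m * n) := kron W 1%:M in
  let Xstar : 'cV[R]_(m * n) := stack (fun=> xstar) in
  (1 < m)%N -> connected_graph e -> psd_sqrt bW sqrtW ->
  0 < gamma -> (forall i, strongly_convex gamma (f i)) ->
  primal_solution f sqrtW Xstar ->
  dual_solution f sqrtW lamstar ->
  0 < R_lam -> enorm lamstar <= R_lam ->
  R_lam <= kappa * (M / Num.sqrt (m%:R * lambda_minp W)) ->
  (forall i, differentiable (f i) xstar) ->
  (forall i, enorm (grad (f i) xstar) <= M) ->
  \forall eps \near 0^'+,
  forall (sigma_psi alpha : R) (al : nat -> R)
    (dO dX : measure_display) (Omega : measurableType dO)
    (Xi : measurableType dX) (P : probability Omega R)
    (G : 'I_m -> 'cV[R]_n -> Xi -> 'cV[R]_n)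
    (xi : nat -> 'I_m -> nat -> Omega -> Xi),
  let rate : R := Num.sqrt (M ^+ 2 / (gamma * eps) * chi W) in
  let N : nat := nat_ceil (c_N * rate) in
  let L_Psi : R := m%:R * lambda_max W / gamma in
  let sigma2_Psi : R := c_sigma * (lambda_max W * m%:R * sigma_psi ^+ 2) in
  let r : nat -> nat := batch_size sigma2_Psi eps alpha N al in
  let xN : Omega -> 'cV[R]_(m * n) :=
    fun w => output bW al r (fun k i l lam => G i lam (xi k i l w)) N in
  0 < sigma_psi -> 0 < alpha < 1 -> step_sizes L_Psi al ->
  stochastic_dual_oracle P f sigma_psi G xi ->
  ((1 - 3 * alpha)%R%:E <=
     P [set w | (primal f (xN w) - primal f Xstar <= eps)%R /\
                (enorm (sqrtW *m xN w) <= eps / R_lam)%R])%E /\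
  (oracle_calls r N)%:R <=
    c_T * (1 + ln (N%:R / alpha)) *
    Num.max rate (M ^+ 2 * sigma_psi ^+ 2 / eps ^+ 2 * chi W).

Proof.
exists (c_sigma (R := R)); first by rewrite divr_gt0 // mulr_gt0 // exp_const_gt0.
move=> kappa kappa0; exists (c_iter kappa), (c_calls kappa).
have ci0 : 0 < c_iter kappa by rewrite mulr_gt0 // addr_gt0.
have cs0 : 0 < c_sigma (R := R).
  by rewrite divr_gt0 // mulr_gt0 // exp_const_gt0.
split=> //; split.
  rewrite /c_calls addr_gt0 // mulr_gt0 ?addr_gt0 //; last by rewrite exprn_gt0 // addr_gt0.
  by rewrite mulr_gt0.
move=> m n e f gamma M R_lam Q xstar lamstar W bW Xs m_gt1 [esym _ _] [Qsym _ QQ].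
move=> gamma0 f_sc XsP lamP R0 lam_le R_le f_diff f_grad.
have m0 : (0 < m)%N by exact: ltnW.
have Wsym : W^T = W by exact: laplacian_sym.
(* Otherwise [Num.sqrt _ = 0], and [M / 0 = 0] would force [R_lam <= 0]. *)
have mlmin0 : 0 < m%:R * lambda_minp W.
  rewrite ltNge; apply/negP => h.
  by move: R_le; rewrite ler0_sqrtr // invr0 !mulr0 leNgt R0.
have mR0 : 0 < m%:R :> R by rewrite ltr0n.
have lmin0 : 0 < lambda_minp W by move: mlmin0; rewrite pmulr_rgt0.
have sq0 : 0 < Num.sqrt (m%:R * lambda_minp W) by rewrite sqrtr_gt0.
have M0 : 0 < M.
  by have := lt_le_trans R0 R_le; rewrite pmulr_rgt0 // pmulr_lgt0 // invr_gt0.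
have lminmax := lambda_minp_le_max m0 Wsym lmin0.
have lmax0 := lt_le_trans lmin0 lminmax.
(* [kron W 1%:M] acts as [W] on each of the [n] coordinates separately, so the Rayleigh bound for
   [W] is summed over them. *)
have Q_le y : dot (Q *m y) (Q *m y) <= lambda_max W * dot y y.
  rewrite -(dot_sym_mulmx Qsym) mulmxA QQ dot_kron1 dot_blockv.
  apply: (@le_trans _ _ (\sum_(b < n) lambda_max W *
    (let v := \col_i y (mxvec_index i b) 0 in dot v v))).
    by apply: ler_sum => b _; exact: dot_le_lambda_max.
  rewrite -mulr_sumr ler_wpM2l ?(ltW lmax0) //= /dot exchange_big /=.
  apply: ler_sum => i _; apply: ler_sum => b _.
  by rewrite !mxE.
have R2 : R_lam ^+ 2 <= kappa ^+ 2 * (M ^+ 2 / (m%:R * lambda_minp W)).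
  have -> : kappa ^+ 2 * (M ^+ 2 / (m%:R * lambda_minp W)) =
      (kappa * (M / Num.sqrt (m%:R * lambda_minp W))) ^+ 2.
    by rewrite !exprMn exprVn sqr_sqrtr // ltW.
  rewrite ler_pXn2r // nnegrE; first exact: ltW.
  by apply: le_trans R_le; exact: ltW.
have [rho rho0 f_lip] : exists2 rho : R, 0 < rho & forall i u d,
    enorm (u - xstar) <= rho -> enorm d <= rho ->
    f i (u + d) - f i u <= 2 * M * enorm d.
  have /choice[F HF] : forall i, exists rho : R, 0 < rho /\ forall u d,
      enorm (u - xstar) <= rho -> enorm d <= rho ->
      f i (u + d) - f i u <= 2 * M * enorm d.
    move=> i; have [rho r0 H] := convex_lipschitz_near
      (strongly_convexW (ltW gamma0) (f_sc i)) (f_diff i) M0 (f_grad i).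
    by exists rho.
  have [rho r0 Hr] := finite_lower_bound (fun i => proj1 (HF i)).
  exists rho => // i u d hu hd; apply: (proj2 (HF i)); exact: le_trans (Hr i).
pose C := M ^+ 2 / gamma * chi W.
have chi0 : 0 < chi W by rewrite divr_gt0.
have C0 : 0 < C by rewrite mulr_gt0 // divr_gt0 // exprn_gt0.
(* The thresholds for [eps]: [C / 4] gives [rate >= 2], so that rounding up [N] costs at most one
   extra [rate]; the other two give [eps_le1] and, with [eps <= 1], [eps_le2]. *)
have e1 : 0 < C / 4 by rewrite divr_gt0.
have e2 : 0 < 4 * gamma * rho ^+ 2 / m%:R by rewrite !divr_gt0 // !mulr_gt0 // exprn_gt0.
have e3 : 0 < 128 * M ^+ 2 * rho ^+ 2 / m%:R.
  by rewrite divr_gt0 // mulr_gt0 ?exprn_gt0 // mulr_gt0 ?exprn_gt0.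
near=> eps.
have eps0 : 0 < eps by near: eps; exact: nbhs_right_gt.
have eps1 : eps <= 1 by near: eps; exact: nbhs_right_le.
have epsC : eps <= C / 4 by near: eps; exact: nbhs_right_le.
have eps_le1 : m%:R * eps <= 4 * gamma * rho ^+ 2.
  by rewrite mulrC -ler_pdivlMr //; near: eps; exact: nbhs_right_le.
have eps_le2 : m%:R * eps ^+ 2 <= 128 * M ^+ 2 * rho ^+ 2.
  apply: (@le_trans _ _ (m%:R * eps)).
    by rewrite ler_pM2l // expr2 ler_piMl // ltW.
  by rewrite mulrC -ler_pdivlMr //; near: eps; exact: nbhs_right_le.
move=> sigma alpha al dO dX Omega Xi P G xi sigma0 alpha01 alP oracle.
set rate := Num.sqrt (M ^+ 2 / (gamma * eps) * chi W).
have rate_sq : rate ^+ 2 = M ^+ 2 / (gamma * eps) * (lambda_max W / lambda_minp W).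
  by rewrite sqr_sqrtr // mulr_ge0 ?(ltW chi0) // divr_ge0 ?sqr_ge0 // mulr_ge0 // ltW.
have rate_ge : 2 <= rate.
  rewrite -(@ler_pXn2r _ 2) ?nnegrE ?sqrtr_ge0 // rate_sq -/(chi W).
  have -> : M ^+ 2 / (gamma * eps) * chi W = C / eps.
    by rewrite /C; field; rewrite !gt_eqF.
  by rewrite ler_pdivlMr //; move: epsC; rewrite expr2; lra.
split.
  exact: (success_probability m0 gamma0 lmin0 lminmax kappa0 M0 rho0 eps0 sigma0
    alpha01 f_sc Qsym QQ Q_le XsP lamP R0 lam_le R2 f_lip rate_ge rate_sq
    eps_le1 eps_le2 alP oracle).
exact: (oracle_complexity m0 gamma0 lmin0 lminmax kappa0 M0 eps0 sigma0
    alpha01 rate_ge rate_sq alP).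
Unshelve. all: by end_near.
Qed.
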